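(* Let $K$ be a field of characteristic zero, let $l\ge 3$, $S=K[x_1,\dots,x_l]$, let $\mathcal{A}$ be a central hyperplane arrangement in $K^l$ with Jacobian ideal $J(\mathcal{A})\subseteq S$, and let $d_0=r_{l-2}(S/J(\mathcal{A}))$. Then $\mathcal{A}$ is free if and only if either $\mathcal{M}_{S/J(\mathcal{A})}$ is the zero function, or the following two conditions hold: (1) $\mathcal{M}_{S/J(\mathcal{A})}(3,d_0)=\mathcal{M}_{S/J(\mathcal{A})}(3,d_0+1)=\mathcal{M}_{S/J(\mathcal{A})}(3,d_0+2)$; (2) $\mathcal{M}_{S/J(\mathcal{A})}(3,d_0)=\sum_{d=0}^{d_0}\mathcal{M}_{S/J(\mathcal{A})}(2,d)$, or, equivalently, $\mathcal{M}_{S/J(\mathcal{A})}(3,d)=\mathcal{M}_{S/J(\mathcal{A})}(2,d)+\mathcal{M}_{S/J(\mathcal{A})}(3,d-1)$ for all $2\le d\le d_0$.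
   Context: A central hyperplane arrangement in $K^l$ is a finite set $\mathcal{A}=\{H_1,\dots,H_n\}$ of distinct hyperplanes through the origin; write $H_i=\alpha_i^{-1}(0)$ with $\alpha_i\in S=K[x_1,\dots,x_l]$ a linear form, and $Q(\mathcal{A})=\prod_{i=1}^n\alpha_i$. The Jacobian ideal $J(\mathcal{A})$ is the ideal of $S$ generated by $Q(\mathcal{A})$ and all its partial derivatives. Let $D(\mathcal{A})=\{\delta=\sum_i f_i\partial_{x_i}\mid f_i\in S,\ \delta(\alpha_j)\in\langle\alpha_j\rangle \text{ for all } j\}$; $\mathcal{A}$ is free if $D(\mathcal{A})$ is a free $S$-module. For a homogeneous ideal $I\subseteq S$, the sectional matrix of $S/I$ is the function $\mathcal{M}_{S/I}:\{1,\dots,l\}\times\mathbb{N}\to\mathbb{N}$, $\mathcal{M}_{S/I}(i,d)=\dim_K\big(S_d/(I+(L_1,\dots,L_{l-i}))_d\big)$, where $L_1,\dots,L_{l-i}$ are generic linear forms (the value is constant for $(L_1,\dots,L_{l-i})$ in a nonempty Zariski open set). The $i$-reduction number of $S/I$ is $r_i(S/I)=\max\{d\mid \mathcal{M}_{S/I}(l-i,d)\neq 0\}$ (so $r_{l-2}$ concerns the row $\mathcal{M}_{S/I}(2,\cdot)$). For a central arrangement with $J(\mathcal{A})\ne S$, the number $r_{l-2}(S/J(\mathcal{A}))$ is finite. *)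

(* Defs.v *)
From HB Require Import structures.
From mathcomp Require Import all_boot all_order all_algebra.
From mathcomp Require Import boolp classical_sets.
From mathcomp Require Import mpoly.

Set Implicit Arguments.
Unset Strict Implicit.
Unset Printing Implicit Defensive.

Import GRing.Theory.

Local Open Scope classical_set_scope.
Local Open Scope ring_scope.

(* Ideals of S = K[x_1, ..., x_l] are arbitrary classical sets of polynomials:
   the ideals of ring_quotient are decidable predicates. *)

Definition ideal_gen (R : comNzRingType) (G : seq R) : set R :=
  [set f | exists c : 'I_(size G) -> R, f = \sum_i c i * G`_i].

Definition ideal_add (R : comNzRingType) (I J : set R) : set R :=
  [set f | exists g h, [/\ I g, J h & f = g + h]].

(* A submodule M of V is free of finite rank.  Only used for M = D(A), which is
   contained in S^l, so that a basis has at most l elements. *)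
Definition free_submodule (R : nzRingType) (V : lmodType R) (M : set V) : Prop :=
  exists (r : nat) (b : 'I_r -> V),
    (forall i, M (b i)) /\
    (forall v, M v -> exists! c : 'rV[R]_r, v = \sum_i c 0 i *: b i).

Definition hyperplane (K : fieldType) (l : nat) (a : {mpoly K[l]}) :
    set 'rV[K]_l :=
  [set v : 'rV[K]_l | a.@[v 0] = 0].

(* A central arrangement, given with a chosen defining form of each hyperplane.
   The family may be empty. *)
Record arrangement (K : fieldType) (l : nat) := Arrangement {
  arr_size : nat;
  arr_form : 'I_arr_size -> {mpoly K[l]};
  arr_form_homog : forall i, arr_form i \is 1.-homog;
  arr_form_neq0 : forall i, arr_form i != 0;
  arr_hyperplane_inj : injective (fun i => hyperplane (arr_form i))
}.

Section Arrangements.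
Variables (K : fieldType) (l : nat) (A : arrangement K l).

Definition defining_poly : {mpoly K[l]} := \prod_(i < arr_size A) arr_form i.

Definition jacobian_ideal : set {mpoly K[l]} :=
  ideal_gen (defining_poly :: [seq defining_poly^`M(j) | j : 'I_l]).

Definition derivation_apply (delta : 'rV[{mpoly K[l]}]_l) (g : {mpoly K[l]}) :
    {mpoly K[l]} :=
  \sum_i delta 0 i * g^`M(i).

Definition derivation_module : set 'rV[{mpoly K[l]}]_l :=
  [set delta | forall j : 'I_(arr_size A),
     ideal_gen [:: arr_form j] (derivation_apply delta (arr_form j))].

Definition free_arrangement : Prop := free_submodule derivation_module.

End Arrangements.

Section SectionalMatrix.
Variables (K : fieldType) (l : nat).

(* dim_K (S_d / (I `&` S_d)) = m: the classes of b_1, ..., b_m form a basis. *)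
Definition quotient_has_dim (I : set {mpoly K[l]}) (d m : nat) : Prop :=
  exists b : 'I_m -> {mpoly K[l]},
    (forall i, b i \is d.-homog) /\
    (forall f : {mpoly K[l]}, f \is d.-homog ->
       exists! c : 'rV[K]_m, I (f - \sum_i c 0 i *: b i)).

Definition quotient_dim (I : set {mpoly K[l]}) (d : nat) : nat :=
  xget 0%N [set m | quotient_has_dim I d m].

Definition linear_form (a : 'rV[K]_l) : {mpoly K[l]} := \sum_j a 0 j *: 'X_j.

Definition linear_ideal (k : nat) (L : 'M[K]_(k, l)) : set {mpoly K[l]} :=
  ideal_gen [seq linear_form (row j L) | j : 'I_k].

Definition zariski_open (N : nat) (U : set 'rV[K]_N) : Prop :=
  exists E : set {mpoly K[N]},
    U = [set v : 'rV[K]_N | exists2 p, E p & p.@[v 0] != 0].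

(* k-tuples of linear forms are the rows of k x l matrices, i.e. the points of
   K^(k * l) through mxvec. *)
Definition for_generic_forms (k : nat) (P : 'M[K]_(k, l) -> Prop) : Prop :=
  exists U : set 'rV[K]_(k * l),
    [/\ zariski_open U, U !=set0 & forall L, U (mxvec L) -> P L].

(* Meaningful for 1 <= i <= l. *)
Definition sectional_matrix (I : set {mpoly K[l]}) (i d : nat) : nat :=
  xget 0%N [set m | for_generic_forms (fun L : 'M[K]_(l - i, l) =>
                      quotient_dim (ideal_add I (linear_ideal L)) d = m)].

(* The maximum of {d | M(l - i, d) <> 0}; the value is 0 if there is none. *)
Definition reduction_number (I : set {mpoly K[l]}) (i : nat) : nat :=
  xget 0%N [set d | sectional_matrix I (l - i) d <> 0%N /\
                    forall e, sectional_matrix I (l - i) e <> 0%N -> (e <= d)%N].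

End SectionalMatrix.

(* Main.v *)
From HB Require Import structures.
Require Import Defs.
From mathcomp Require Import all_boot all_order all_algebra.
From mathcomp Require Import boolp classical_sets.
From mathcomp Require Import mpoly.
From mathcomp Require Import ring zify.

(** Let [S] be the polynomial ring, [J] the Jacobian ideal, [Q] the defining
    polynomial and [D0] the module of derivations killing [Q].  In
    characteristic zero the Euler derivation splits [D(A) = S theta + D0], so
    the question is whether [D0], the syzygy module of the gradient of [Q], is
    free.  For generic linear forms put [I = J + (L_1, ..., L_(l-3))] and
    [z = L_(l-2)].  Always [M(3,d) <= M(2,d) + M(3,d-1)], and equality means
    that [z] is injective on [S/I] from degree [d-1] to degree [d].

    If [D(A)] is free and [v . grad Q] lies in [(L_1, ..., L_(l-2))], then for
    large [N] every form of degree [N] multiplies [v] into [D0 + (L) S^l],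
    because [S/(J + (L))] has finite length and Koszul syzygies lie in [D0].
    Dividing by the linear forms of two of the hyperplanes, which is possible
    in a basis of [D(A)], gives [v] in [D0 + (L) S^l]; hence [z] is regular on
    [S/I].

    Conversely the two conditions give injectivity of [z] in degrees at most
    [d0 + 1], and the argument of Bayer and Stillman propagates it to all
    degrees.  Deforming [L_i] to [L_i + t L_(i+1)] and differentiating in [t]
    shows that [L_i] is regular modulo its predecessors as soon as [L_(i+1)]
    is, for generic choices; so [L_1, ..., L_(l-2)] is a regular sequence on
    [S/J].  It extends to [l] linear forms which are a regular sequence on
    [D0], and then a minimal set of homogeneous generators of [D0] is a
    basis. *)

Set Implicit Arguments.
Unset Strict Implicit.
Unset Printing Implicit Defensive.

Import GRing.Theory.

Local Open Scope ring_scope.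

Local Notation set := classical_sets.set.

(** * Ideals and gradings *)

Section Ideals.
Variable R : comNzRingType.
Implicit Types (I : set R) (f g p : R) (G : seq R).

(** The degrees in the conditions have the following origin. As [M(2,d) = 0] for [d > d0], condition
    (1) is the equality [M(3,d) = M(2,d) + M(3,d-1)] at [d0+1] and [d0+2], and condition (2) is the
    same equality for [1 <= d <= d0], summed up. Propagation starts in degree [d0+1], the first one
    after which row 2 vanishes, and needs generators of [I] of degree at most [d0+2]. These exist:
    [J] starts in degree [n-1], and below that degree no power of a linear form of the arrangement
    lies in [J + (L)], whence [n <= d0+2]. The second form of condition (2) omits [d = 1], which has
    to be proved apart, with two hyperplanes as a special case. Finite length comes from the
    products of all linear forms but one: any two of these multiply into [J]. The deformation needs
    [L + t E] to be generic for all but finitely many [t]; hence genericity is recorded as a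
    property of lines, and only for finitely many degrees at a time. Depth and projective dimension
    are replaced by explicit cancellation of linear forms from relations. *)

Record ideal I : Prop := Ideal {
  ideal0 : I 0;
  idealD : forall f g, I f -> I g -> I (f + g);
  idealMr : forall g f, I f -> I (g * f) }.

Lemma idealMl I : ideal I -> forall g f, I f -> I (f * g).
Proof. by move=> hI g f If; rewrite mulrC; apply: idealMr. Qed.

Lemma idealN I : ideal I -> forall f, I f -> I (- f).
Proof. by move=> hI f If; rewrite -mulN1r; apply: idealMr. Qed.

Lemma idealB I : ideal I -> forall f g, I f -> I g -> I (f - g).
Proof. by move=> hI f g If Ig; apply: idealD => //; apply: idealN. Qed.

Lemma ideal_sum I (T : Type) (r : seq T) (P : pred T) (F : T -> R) :
  ideal I -> (forall i, P i -> I (F i)) -> I (\sum_(i <- r | P i) F i).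
Proof.
by move=> hI IF; elim/big_ind: _ => //; [exact: ideal0 | exact: idealD].
Qed.

Lemma idealBK I f g : ideal I -> I (f - g) -> I g -> I f.
Proof. by move=> hI Ifg Ig; rewrite -(subrK g f); apply: idealD. Qed.

Lemma idealBKl I f g : ideal I -> I (f - g) -> I f -> I g.
Proof. by move=> hI Ifg If; have := idealB hI If Ifg; rewrite subKr. Qed.

Definition adjoin I p : set R := fun f => exists g, I (f - g * p).

Lemma adjoinW I p f : I f -> adjoin I p f.
Proof. by move=> If; exists 0; rewrite mul0r subr0. Qed.

Lemma adjoin_gen I p g : ideal I -> adjoin I p (g * p).
Proof. by move=> hI; exists g; rewrite subrr; apply: ideal0. Qed.

Lemma adjoin_id I p : ideal I -> adjoin I p p.
Proof. by move=> hI; exists 1; rewrite mul1r subrr; apply: ideal0. Qed.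

Lemma adjoin_ideal I p : ideal I -> ideal (adjoin I p).
Proof.
move=> hI; split; first by apply: adjoinW; apply: ideal0.
- move=> f g [a Ia] [b Ib]; exists (a + b).
  have -> : f + g - (a + b) * p = (f - a * p) + (g - b * p) by ring.
  exact: idealD.
- move=> g f [a Ia]; exists (g * a).
  by rewrite -mulrA -mulrBr; apply: idealMr.
Qed.

Lemma ideal_gen_ideal G : ideal (ideal_gen G).
Proof.
split.
- exists (fun=> 0); rewrite big1 // => i _; exact: mul0r.
- move=> _ _ [c ->] [d ->]; exists (fun i => c i + d i).
  by rewrite -big_split; apply: eq_bigr => i _ /=; rewrite mulrDl.
- move=> g _ [c ->]; exists (fun i => g * c i).
  by rewrite mulr_sumr; apply: eq_bigr => i _; rewrite mulrA.
Qed.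

Lemma mem_ideal_gen G p : p \in G -> ideal_gen G p.
Proof.
move=> /(nthP 0) [i iG <-]; exists (fun j => (j == Ordinal iG)%:R).
by rewrite (bigD1 (Ordinal iG)) //= eqxx mul1r big1 ?addr0 // => j /negPf ->;
  rewrite mul0r.
Qed.

Lemma ideal_gen_sub G I : ideal I -> (forall p, p \in G -> I p) ->
  forall f, ideal_gen G f -> I f.
Proof.
move=> hI GI _ [c ->]; apply: ideal_sum => // i _; apply: idealMr => //.
by apply: GI; apply: mem_nth.
Qed.

Lemma ideal_gen1 p f : ideal_gen [:: p] f <-> exists g, f = g * p.
Proof.
split=> [[c ->]|[g ->]].
  by exists (c ord0); rewrite big_ord1.
by exists (fun=> g); rewrite big_ord1.
Qed.

Lemma ideal_add_ideal I I' : ideal I -> ideal I' -> ideal (ideal_add I I').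
Proof.
move=> hI hI'; split.
- by exists 0, 0; split; rewrite ?addr0 //; exact: ideal0.
- move=> _ _ [a [b [Ia Ib ->]]] [c [d [Ic Id ->]]].
  exists (a + c), (b + d); split; [exact: idealD | exact: idealD |].
  by rewrite addrACA.
- move=> g _ [a [b [Ia Ib ->]]].
  by exists (g * a), (g * b); split; [exact: idealMr | exact: idealMr |]; rewrite mulrDr.
Qed.

Definition addgen I G := ideal_add I (ideal_gen G).

Lemma addgen_ideal I G : ideal I -> ideal (addgen I G).
Proof. by move=> hI; apply: ideal_add_ideal => //; apply: ideal_gen_ideal. Qed.

Lemma addgenl I G f : I f -> addgen I G f.
Proof.
by move=> If; exists f, 0; split; rewrite ?addr0 //;
  apply: ideal0; apply: ideal_gen_ideal.
Qed.

Lemma addgenr I G f : ideal I -> ideal_gen G f -> addgen I G f.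
Proof. by move=> hI Gf; exists 0, f; split; rewrite ?add0r //; apply: ideal0. Qed.

Lemma addgen_mem I G p : ideal I -> p \in G -> addgen I G p.
Proof. by move=> hI pG; apply: addgenr => //; apply: mem_ideal_gen. Qed.

Lemma addgen_sub I G I' : ideal I' -> (forall f, I f -> I' f) ->
  (forall p, p \in G -> I' p) -> forall f, addgen I G f -> I' f.
Proof.
move=> hI' II' GI' _ [g [h [Ig Gh ->]]]; apply: idealD => //; first exact: II'.
exact: (ideal_gen_sub hI' GI').
Qed.

Lemma adjoin_sub I p I' : ideal I' -> (forall f, I f -> I' f) -> I' p ->
  forall f, adjoin I p f -> I' f.
Proof.
move=> hI' II' I'p f [g /II' I'fg]; apply: (idealBK hI' I'fg).
exact: idealMr.
Qed.

Lemma addgen_rcons I G p : ideal I ->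
  addgen I (rcons G p) = adjoin (addgen I G) p.
Proof.
move=> hI; have hIG := addgen_ideal G hI; have hIr := addgen_ideal (rcons G p) hI.
apply/seteqP; split=> f.
  apply: addgen_sub; first exact: adjoin_ideal.
    by move=> g Ig; apply/adjoinW/addgenl.
  move=> q; rewrite mem_rcons inE => /orP[/eqP ->|qG].
    exact: adjoin_id.
  by apply/adjoinW/addgen_mem.
apply: adjoin_sub => //; last by apply: addgen_mem; rewrite // mem_rcons mem_head.
apply: addgen_sub => //; first by move=> g; apply: addgenl.
by move=> q qG; apply: addgen_mem; rewrite // mem_rcons inE qG orbT.
Qed.

End Ideals.

Section Graded.
Variables (K : fieldType) (l : nat).
Local Notation S := {mpoly K[l]}.
Implicit Types (I : set S) (f g p : S) (d e k : nat).

Local Notation pi d f := (pihomog (@mdeg l) d f).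

Lemma pihomogM_homog p k g d : p \is k.-homog ->
  pi d (g * p) = if (k <= d)%N then pi (d - k) g * p else 0.
Proof.
move=> hp; rewrite {1}(pihomog_partitionE (mf := @mdeg l) (leqnn (msize g))).
set N := msize g; rewrite mulr_suml linear_sum /=.
have E i : pi d (pi i g * p) = if (i + k == d)%N then pi i g * p else 0.
  have h : pi i g * p \is (i + k).-homog by apply: dhomogM => //; apply: pihomogP.
  have [<-|ne] := eqVneq (i + k)%N d; first by rewrite pihomog_dE.
  exact: (pihomog_ne0 ne h).
under eq_bigr => i _ do rewrite E.
rewrite -big_mkcond /=.
have [led|gtd] := leqP k d; last first.
  by rewrite big1 // => i /eqP h; exfalso; lia.
have [lt|ge] := ltnP (d - k) N.
  rewrite (big_pred1 (Ordinal lt)) // => i /=.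
  by rewrite -(inj_eq val_inj) /=; apply/eqP/eqP => /=; lia.
rewrite big1; last by move=> i /eqP h; exfalso; have := ltn_ord i; lia.
suff -> : pi (d - k) g = 0 by rewrite mul0r.
rewrite pihomogE big_seq_cond big1 // => m /andP[/msize_mdeg_lt mg /eqP /= md].
by exfalso; rewrite -/N in mg; lia.
Qed.


Definition graded I := forall f d, I f -> I (pi d f).

Lemma ideal_pieces I f : ideal I -> (forall d, I (pi d f)) -> I f.
Proof.
move=> hI h; rewrite (pihomog_partitionE (mf := @mdeg l) (leqnn (msize f))).
exact: ideal_sum.
Qed.

Lemma graded_sum I (J : finType) (P : pred J) (F : J -> S) :
  ideal I -> (forall j, P j -> forall d, I (pi d (F j))) ->
  forall d, I (pi d (\sum_(j | P j) F j)).
Proof. by move=> hI h d; rewrite linear_sum; apply: ideal_sum => // j Pj; apply: h. Qed.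

Definition homogeneous p := exists k, p \is k.-homog.

Lemma ideal_gen_graded (G : seq S) : (forall p, p \in G -> homogeneous p) ->
  graded (ideal_gen G).
Proof.
move=> hG _ d [c ->]; have hI := ideal_gen_ideal G.
apply: graded_sum => // i _ e; have pG : G`_i \in G by apply: mem_nth.
have [k hk] := hG _ pG; rewrite (pihomogM_homog _ _ hk).
case: ifP => _; last exact: ideal0.
by apply: idealMr => //; apply: mem_ideal_gen.
Qed.

Lemma ideal_add_graded I I' : graded I -> graded I' -> graded (ideal_add I I').
Proof.
move=> gI gI' _ d [a [b [Ia Ib ->]]]; rewrite linearD.
by exists (pi d a), (pi d b); split => //; [apply: gI | apply: gI'].
Qed.

Lemma addgen_graded I (G : seq S) : graded I ->
  (forall p, p \in G -> homogeneous p) -> graded (addgen I G).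
Proof. by move=> gI hG; apply: ideal_add_graded => //; apply: ideal_gen_graded. Qed.

Lemma adjoin_graded I p : ideal I -> graded I -> homogeneous p ->
  graded (adjoin I p).
Proof.
move=> hI gI [k hp] f d [g /(gI _ d)]; rewrite linearB /= (pihomogM_homog _ _ hp).
case: ifP => _ h; first by exists (pi (d - k) g).
by rewrite subr0 in h; apply: adjoinW.
Qed.

Lemma adjoin_homog I p k f d : ideal I -> graded I -> p \is k.-homog ->
  f \is (d + k).-homog -> adjoin I p f ->
  exists2 g, g \is d.-homog & I (f - g * p).
Proof.
move=> hI gI hp hf [g /(gI _ (d + k)%N)].
rewrite linearB /= (pihomogM_homog _ _ hp) leq_addl addnK (pihomog_dE hf) => h.
by exists (pi d g) => //; apply: pihomogP.
Qed.

Lemma adjoin_low I p k f d : ideal I -> graded I -> p \is k.-homog ->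
  f \is d.-homog -> (d < k)%N -> adjoin I p f -> I f.
Proof.
move=> hI gI hp hf ltdk [g /(gI _ d)].
by rewrite linearB /= (pihomogM_homog _ _ hp) leqNgt ltdk subr0 (pihomog_dE hf).
Qed.

End Graded.

(** * Hilbert functions *)

(** [P] is not decidable, so no basis is computed: dimensions are bounded, so some subspace inside
    [P] has maximal dimension, and a vector of [P] outside it would enlarge it. *)
Lemma subspace_vspace (K : fieldType) (V : vectType K) (P : V -> Prop) :
  P 0 -> (forall a u v, P u -> P v -> P (a *: u + v)) ->
  exists U : {vspace V}, forall v, v \in U <-> P v.
Proof.
move=> P0 PD.
pose small m := `[< exists2 U : {vspace V}, (forall v, v \in U -> P v) & \dim U = m >].
have s0 : exists m, small m.
  exists 0%N; apply/asboolP; exists 0%VS; last exact: dimv0.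
  by move=> v; rewrite memv0 => /eqP ->.
have sle m : small m -> (m <= dim V)%N.
  by move/asboolP => [U _ <-]; rewrite -(dimvf V) dimvS ?subvf.
case: (ex_maxnP s0 sle) => m /asboolP[U UP dU] mmax.
exists U => v; split; first exact: UP.
move=> Pv; apply: contraT => vU.
have dUv : \dim (<[v]> + U) = m.+1.
  rewrite dimv_disjoint_sum ?dU.
    by rewrite dim_vline; case: eqP vU => // ->; rewrite mem0v.
  apply/eqP; rewrite -subv0; apply/subvP => u /memv_capP[/vlineP[a ->] avU].
  rewrite memv0 scaler_eq0; have [//|a0] := eqVneq a 0.
  by case/negP: vU; rewrite -(scalerK a0 v) rpredZ.
suff /mmax : small m.+1 by rewrite ltnn.
apply/asboolP; exists (<[v]> + U)%VS => // w /memv_addP[_ /vlineP[a ->] [u uU ->]].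
by apply: PD => //; apply: UP.
Qed.

Section HilbertFunction.
Variables (K : fieldType) (l : nat).
Local Notation S := {mpoly K[l.+1]}.
Local Notation V d := (dhomog l.+1 K d).
Local Notation pi d f := (pihomog (@mdeg l.+1) d f).
Implicit Types (I : set S) (f g p : S) (d e k : nat).

Lemma idealZ I : ideal I -> forall (c : K) f, I f -> I (c *: f).
Proof. by move=> hI c f If; rewrite -mul_mpolyC; apply: (idealMr hI). Qed.

Lemma dhB d (u v : V d) : val (u - v) = val u - val v. Proof. by []. Qed.
Lemma dhD d (u v : V d) : val (u + v) = val u + val v. Proof. by []. Qed.
Lemma dhZ d a (u : V d) : val (a *: u) = a *: val u. Proof. by []. Qed.
Lemma dh_sum d m (F : 'I_m -> V d) : val (\sum_i F i) = \sum_i val (F i).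
Proof. exact: (raddf_sum (@mpoly_of_dhomog l.+1 K d)). Qed.

(** A total linear map, so that vectors of [V d] can be written down before the homogeneity of their
    expression is known. *)
Definition hproj d f : V d := DHomog (pihomogP (@mdeg l.+1) d f).

Lemma hproj_val d (v : V d) : hproj d (val v) = v.
Proof. by apply: val_inj => /=; apply: pihomog_dE; case: v. Qed.

Lemma hprojK d f : f \is d.-homog -> val (hproj d f) = f.
Proof. exact: pihomog_dE. Qed.

Lemma hproj_linear d : linear (hproj d).
Proof. by move=> a f g; apply: val_inj; rewrite /= linearP. Qed.

HB.instance Definition _ d :=
  GRing.isLinear.Build K S (V d) *:%R (hproj d) (hproj_linear d).

(* The zero space if [I] is not stable under linear combinations. *)
Definition hpart I d : {vspace V d} :=
  xget 0%VS (fun U : {vspace V d} => forall v : V d, v \in U <-> I (val v)).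

Lemma hpartP I d (v : V d) : ideal I -> v \in hpart I d <-> I (val v).
Proof.
move=> hI; rewrite /hpart; case: xgetP => [U _ /= -> //|none].
case: (@subspace_vspace K (V d) (fun v => I (val v))).
- by rewrite linear0; apply: ideal0.
- by move=> a u w Iu Iw; rewrite dhD dhZ; apply: idealD => //; apply: idealZ.
by move=> U hU; case: (none U).
Qed.

Definition hf I d : nat := (\dim {:V d} - \dim (hpart I d))%N.

Lemma hf_dim I d : (hf I d + \dim (hpart I d) = \dim {:V d})%N.
Proof. by rewrite subnK // dimvS ?subvf. Qed.

(** Such a family is a basis of a complement of the degree [d] part of [I]: existence of
    coefficients gives spanning, uniqueness gives independence. *)
Lemma quotient_has_dimP I d m : ideal I -> quotient_has_dim I d m <-> m = hf I d.
Proof.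
move=> hI; split.
  case=> b [bh buniq]; pose X := [tuple hproj d (b i) | i < m].
  have valX (k : 'I_m -> K) : val (\sum_i k i *: X`_i) = \sum_i k i *: b i.
    rewrite dh_sum; apply: eq_bigr => i _.
    by rewrite dhZ -tnth_nth tnth_mktuple hprojK.
  (* The zero form has both the coefficients [0] and [k]; uniqueness identifies them. *)
  have kzero (k : 'I_m -> K) : \sum_i k i *: X`_i \in hpart I d -> forall i, k i = 0.
    move=> /(hpartP _ hI); rewrite valX => Ik.
    have [c [_ cu]] := buniq 0 (dhomog0 _ _ _).
    have c0 : c = 0.
      by apply: cu; rewrite big1 ?subr0; [exact: ideal0 | move=> i _; rewrite mxE scale0r].
    have ck : c = \row_i (k i).
      apply: cu; rewrite sub0r; apply: idealN => //.
      by under eq_bigr => i _ do rewrite mxE.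
    by move=> i; have := congr1 (fun M : 'rV_m => M 0 i) ck; rewrite c0 !mxE.
  have Xfree : free X.
    by apply/freeP => k k0; apply: kzero; rewrite k0 mem0v.
  have disj : (hpart I d :&: <<X>> = 0)%VS.
    apply/eqP; rewrite -subv0; apply/subvP => v /memv_capP[vI /coord_span vX].
    rewrite vX in vI *; have k0 := kzero _ vI.
    by rewrite big1 ?mem0v // => i _; rewrite k0 scale0r.
  have full : (hpart I d + <<X>> = fullv)%VS.
    apply/eqP; rewrite eqEsubv subvf /=; apply/subvP => v _.
    have [c [Ic _]] := buniq (val v) (valP v).
    rewrite -[v](subrK (\sum_i c 0 i *: X`_i)); apply: memv_add.
      by apply/(hpartP _ hI); rewrite dhB valX.
    apply: rpred_sum => i _; apply/rpredZ/memv_span; apply: mem_nth.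
    by rewrite size_tuple.
  have := dimv_disjoint_sum disj; rewrite full => e.
  by rewrite /hf e addKn; move: Xfree; rewrite /free size_tuple => /eqP ->.
move=> ->; set W := (hpart I d)^C%VS.
have dW : \dim W = hf I d by rewrite dimv_compl.
rewrite -dW; exists (fun i => val (vbasis W)`_i); split; first by move=> i; apply: valP.
move=> f fh; pose v := hproj d f.
have vf : val v = f by apply: hprojK.
have valB (c : 'I_(\dim W) -> K) :
    \sum_i c i *: val (vbasis W)`_i = val (\sum_i c i *: (vbasis W)`_i).
  by rewrite dh_sum; apply: eq_bigr => i _; rewrite dhZ.
have : v \in (hpart I d + W)%VS by rewrite addv_complf memvf.
case/memv_addP => u uI [w wW vE].
have wE := coord_vbasis wW.
exists (\row_i coord (vbasis W) i w); split.
  under eq_bigr => i _ do rewrite mxE.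
  rewrite (valB (fun i => coord (vbasis W) i w)) -wE -vf vE dhD addrK.
  exact/(hpartP _ hI).
move=> c Ic; apply/rowP => i; rewrite mxE.
rewrite (valB (fun i => c 0 i)) in Ic; set w' := \sum_(j < _) _ in Ic.
have w'W : w' \in W.
  apply: rpred_sum => j _; apply: rpredZ; apply: vbasis_mem.
  by apply: mem_nth; rewrite size_tuple.
have : w - w' \in (hpart I d :&: W)%VS.
  rewrite memv_cap; apply/andP; split; last exact: rpredB.
  have -> : w - w' = (v - w') - u by rewrite vE addrAC [u + w]addrC addrK.
  by apply: rpredB => //; apply/(hpartP _ hI); rewrite dhB vf.
rewrite (_ : _ :&: _ = 0)%VS; last first.
  by apply/eqP; rewrite -dimv_eq0 -(eqn_add2l (\dim (hpart I d + W)))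
     dimv_sum_cap addn0 addv_complf dW addnC hf_dim.
rewrite memv0 subr_eq0 => /eqP ->.
by rewrite coord_sum_free // (basis_free (vbasisP W)).
Qed.

Lemma quotient_dimE I d : ideal I -> quotient_dim I d = hf I d.
Proof.
move=> hI; rewrite /quotient_dim; case: xgetP => [m _ /= /(quotient_has_dimP _ _ hI) //|none].
by case: (none (hf I d)); apply/quotient_has_dimP.
Qed.

Lemma hf_eq0 I d : ideal I -> hf I d = 0%N <-> (forall f, f \is d.-homog -> I f).
Proof.
move=> hI; split=> [e f fh|h].
  have : hproj d f \in hpart I d.
    have/eqP-> : hpart I d == fullv.
      by rewrite -(eq_leqif (dimv_leqif_eq (subvf _))) -(hf_dim I d) e.
    exact: memvf.
  by move/(hpartP _ hI); rewrite hprojK.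
rewrite /hf (_ : hpart I d = fullv) ?subnn //.
apply/eqP; rewrite eqEsubv subvf /=; apply/subvP => v _.
by apply/(hpartP _ hI)/h/valP.
Qed.

Lemma hpartS I I' d : ideal I -> ideal I' ->
  (forall f, f \is d.-homog -> I f -> I' f) -> (hpart I d <= hpart I' d)%VS.
Proof.
move=> hI hI' II'; apply/subvP => v /(hpartP _ hI) Iv.
by apply/(hpartP _ hI')/II' => //; apply: valP.
Qed.

Lemma hfS I I' d : ideal I -> ideal I' ->
  (forall f, f \is d.-homog -> I f -> I' f) -> (hf I' d <= hf I d)%N.
Proof. by move=> hI hI' II'; rewrite leq_sub2l // dimvS // hpartS. Qed.

Lemma hf_eq I I' d : ideal I -> ideal I' ->
  (forall f, f \is d.-homog -> I f -> I' f) -> hf I d = hf I' d ->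
  forall f, f \is d.-homog -> I' f -> I f.
Proof.
move=> hI hI' II' e f fh I'f.
have/eqP E : hpart I d == hpart I' d.
  rewrite -(eq_leqif (dimv_leqif_eq (hpartS hI hI' II'))).
  by rewrite -(eqn_add2l (hf I d)) hf_dim e hf_dim.
have : hproj d f \in hpart I' d by apply/(hpartP _ hI'); rewrite hprojK.
by rewrite -E => /(hpartP _ hI); rewrite hprojK.
Qed.

Definition colon I p : set S := fun f => I (f * p).

Lemma colon_ideal I p : ideal I -> ideal (colon I p).
Proof.
move=> hI; split; rewrite /colon.
- by rewrite mul0r; apply: ideal0.
- by move=> f g If Ig; rewrite mulrDl; apply: idealD.
- by move=> g f If; rewrite -mulrA; apply: idealMr.
Qed.

Lemma sub_colon I p f : ideal I -> I f -> colon I p f.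
Proof. by move=> hI If; apply: idealMl. Qed.

Definition dmul d e p (v : V d) : V e := hproj e (val v * p).

Lemma dmul_linear d e p : linear (@dmul d e p).
Proof. by move=> a u v; rewrite /dmul dhD dhZ mulrDl -scalerAl linearP. Qed.

HB.instance Definition _ d e p :=
  GRing.isLinear.Build K (V d) (V e) *:%R (@dmul d e p) (@dmul_linear d e p).

(** Exactness of [0 -> S/(I : p) -> S/I -> S/(I + (p)) -> 0], where the first map is multiplication
    by [p] and raises degrees by [k]. *)
Lemma hf_adjoin I p k d : ideal I -> graded I -> p \is k.-homog ->
  hf I (d + k) = (hf (adjoin I p) (d + k) + hf (colon I p) d)%N.
Proof.
(* Multiplication by [p = 0] is not injective on forms; in this case the colon ideal is all of
   [S]. *)
move=> hI gI hp; have [->|p0] := eqVneq p 0.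
  have -> : adjoin I 0 = I.
    by apply/seteqP; split=> f; [apply: adjoin_sub => //; exact: ideal0 | exact: adjoinW].
  suff -> : hf (colon I 0) d = 0%N by rewrite addn0.
  apply/hf_eq0 => [|f _]; first exact: (colon_ideal 0 hI).
  by rewrite /colon mulr0; apply: ideal0.
have hIp := adjoin_ideal p hI; have hC := colon_ideal p hI.
pose phi_ := @dmul d (d + k) p.
have phiE v : val (phi_ v) = val v * p by apply: hprojK; apply: dhomogM => //; apply: valP.
pose phi := linfun (@dmul d (d + k) p).
have phiE' v : phi v = phi_ v by rewrite lfunE.
have ker0 : lker phi == 0%VS.
  apply/lker0P => u v; rewrite !phiE' => /(congr1 val); rewrite !phiE.
  by move/(mulIf p0)/val_inj.
have E1 : hpart (adjoin I p) (d + k) = (hpart I (d + k) + limg phi)%VS.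
  apply/eqP; rewrite eqEsubv; apply/andP; split; apply/subvP => v.
    move/(hpartP _ hIp) => /(adjoin_homog hI gI hp (valP v))[g gh Ig].
    have vE : v = hproj (d + k) (val v - g * p) + phi (hproj d g).
      have gph : g * p \is (d + k).-homog := dhomogM gh hp.
      rewrite phiE'; apply: val_inj; rewrite dhD phiE (hprojK gh).
      by rewrite hprojK ?subrK //; apply: rpredB => //; apply: valP.
    rewrite vE memv_add ?memv_img ?memvf //.
    apply/(hpartP _ hI); have gph : g * p \is (d + k).-homog := dhomogM gh hp.
    by rewrite hprojK //; apply: rpredB => //; apply: valP.
  case/memv_addP => u /(hpartP _ hI) Iu [_ /memv_imgP[w _ ->] ->].
  apply/(hpartP _ hIp); rewrite dhD; apply: idealD => //; first exact: adjoinW.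
  by rewrite phiE' phiE; apply: adjoin_gen.
have E2 : (hpart I (d + k) :&: limg phi)%VS = (phi @: hpart (colon I p) d)%VS.
  apply/eqP; rewrite eqEsubv; apply/andP; split; apply/subvP => v.
    case/memv_capP => /(hpartP _ hI) Iv /memv_imgP[w _ vE].
    rewrite vE; apply: memv_img; apply/(hpartP _ hC).
    by move: Iv; rewrite vE phiE' phiE.
  case/memv_imgP => w /(hpartP _ hC) Iw ->; rewrite memv_cap memv_img ?memvf // andbT.
  by apply/(hpartP _ hI); rewrite phiE' phiE.
have dimphi U : \dim (phi @: U) = \dim U by apply: limg_dim_eq; rewrite (eqP ker0) capv0.
have arith a a' b b' c c' n m :
  (a + a' = n -> b + b' = n -> c + c' = m -> b' + c' = a' + m -> a = b + c)%N.
  by lia.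
apply: arith (hf_dim I (d + k)) (hf_dim _ (d + k)) (hf_dim (colon I p) d) _.
by have := dimv_sum_cap (hpart I (d + k)) (limg phi); rewrite -E1 E2 !dimphi.
Qed.

Lemma hf_adjoin_low I p k d : ideal I -> graded I -> p \is k.-homog -> (d < k)%N ->
  hf (adjoin I p) d = hf I d.
Proof.
move=> hI gI hp ltdk; have hIp := adjoin_ideal p hI.
apply/eqP; rewrite eqn_leq !hfS // => f fh; last exact: adjoinW.
exact: (adjoin_low hI gI hp fh ltdk).
Qed.

Definition regular I p := forall f, I (f * p) -> I f.

Lemma regular_homog I p k : ideal I -> graded I -> p \is k.-homog ->
  (forall d f, f \is d.-homog -> I (f * p) -> I f) -> regular I p.
Proof.
move=> hI gI hp h f Ifp; apply: ideal_pieces => // d; apply: (h d).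
  exact: pihomogP.
have := gI _ (d + k)%N Ifp.
by rewrite (pihomogM_homog _ _ hp) leq_addl addnK.
Qed.

Lemma colon_regular I p : ideal I -> regular I p -> colon I p = I.
Proof.
by move=> hI reg; apply/seteqP; split=> f; [apply: reg | apply: sub_colon].
Qed.

End HilbertFunction.

(** * Generic linear forms and sectional matrices *)

Import VectorInternalTheory.

Section ParametricRank.
Variable K : fieldType.

(** A right inverse [B] at one specialisation replaces all minors by the single determinant of
    [A B]: wherever it does not vanish, [A] still has a right inverse. The ring [R] is abstract
    because it will be both [{mpoly K[n]}] and [{poly K}]. *)
Lemma row_free_open (R : comNzRingType) (c : {rmorphism K -> R}) m n
    (A : 'M[R]_(m, n)) (ev0 : {rmorphism R -> K}) :
  cancel c ev0 -> row_free (map_mx ev0 A) ->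
  exists2 p : R, ev0 p != 0 & forall ev : {rmorphism R -> K}, cancel c ev ->
    ev p != 0 -> row_free (map_mx ev A).
Proof.
move=> c0 /row_freeP[B AB]; exists (\det (A *m map_mx c B)).
  rewrite -det_map_mx map_mxM -map_mx_comp map_mx_id ?AB ?det1 ?oner_eq0 //.
move=> ev cev; rewrite -det_map_mx map_mxM -map_mx_comp map_mx_id // => d0.
have u : map_mx ev A *m B \in unitmx by rewrite unitmxE unitfE.
by apply/row_freeP; exists (B *m invmx (map_mx ev A *m B)); rewrite mulmxA mulmxV.
Qed.

Lemma free_row_free (V : vectType K) m (X : m.-tuple V) :
  free X = row_free (\matrix_(i < m) v2r X`_i).
Proof.
set M := \matrix_(i < m) _.
have E (k : 'I_m -> K) : v2r (\sum_i k i *: X`_i) = (\row_i k i) *m M.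
  rewrite linear_sum mulmx_sum_row; apply: eq_bigr => i _.
  by rewrite linearZ mxE rowK.
apply/freeP/idP => [h|/row_free_inj inj k k0 i].
  rewrite -kermx_eq0; apply/eqP/row_matrixP => j; rewrite row0.
  set u := row j _; have uM : u *m M = 0 by rewrite -row_mul mulmx_ker row0.
  have uE : u = \row_i u 0 i by apply/rowP => i; rewrite mxE.
  apply/rowP => i; rewrite [RHS]mxE; apply: h.
  by apply: (can_inj (@v2rK _ _)); rewrite E -uE uM linear0.
have : \row_i k i = 0.
  by apply: inj; rewrite -E k0 linear0 mul0mx.
by move/rowP/(_ i); rewrite !mxE.
Qed.

Lemma free_affine_open (V : vectType K) m n (G : 'I_m -> V)
    (H : 'I_m -> 'rV[K]_n -> V) (x0 : 'rV[K]_n) : (forall s, linear (H s)) ->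
  free [tuple G s + H s x0 | s < m] ->
  exists2 p : {mpoly K[n]}, p.@[x0 0] != 0 &
    forall x : 'rV[K]_n, p.@[x 0] != 0 -> free [tuple G s + H s x | s < m].
Proof.
move=> linH.
pose A := \matrix_(s < m, j < dim V) ((v2r (G s) 0 j)%:MP_[n] +
  \sum_q v2r (H s (delta_mx 0 q)) 0 j *: 'X_q).
have HE s x : H s x = \sum_q x 0 q *: H s (delta_mx 0 q).
  pose Hl : {linear 'rV[K]_n -> V} :=
    HB.pack (H s) (GRing.isLinear.Build K _ _ _ (H s) (linH s)).
  rewrite {1}[x]row_sum_delta -[H s]/(Hl : _ -> _) linear_sum.
  by apply: eq_bigr => q _; rewrite linearZ.
have AE (x : 'rV[K]_n) : free [tuple G s + H s x | s < m] = row_free (map_mx (meval (x 0)) A).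
  rewrite free_row_free; congr (row_free _); apply/matrixP => s j.
  rewrite !mxE -tnth_nth tnth_mktuple linearD HE linear_sum !mxE mevalD mevalC.
  congr (_ + _); rewrite summxE linear_sum; apply: eq_bigr => q _ /=.
  by rewrite linearZ mxE mevalZ mevalXU mulrC.
rewrite AE => /(row_free_open (c := @mpolyC n K)) [x|p p0 hp].
  by rewrite /= mevalC.
exists p => // x px; rewrite AE; apply: hp => // y; exact: mevalC.
Qed.

Lemma free_poly_open (V : vectType K) m n (c : 'I_m -> 'I_n.+1 -> V) :
  free [tuple c s ord0 | s < m] ->
  exists2 q : {poly K}, q != 0 & forall t, q.[t] != 0 ->
    free [tuple \sum_(j < n.+1) t ^+ j *: c s j | s < m].
Proof.
pose A := \matrix_(s < m, i < dim V) \sum_(j < n.+1) (v2r (c s j) 0 i) *: 'X^j.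
have AE t : free [tuple \sum_(j < n.+1) t ^+ j *: c s j | s < m] =
            row_free (map_mx (horner_eval t) A).
  rewrite free_row_free; congr (row_free _); apply/matrixP => s i.
  rewrite !mxE -tnth_nth tnth_mktuple linear_sum summxE /horner_eval horner_sum.
  by apply: eq_bigr => j _; rewrite linearZ mxE hornerZ hornerXn mulrC.
have -> : [tuple c s ord0 | s < m] = [tuple \sum_(j < n.+1) 0 ^+ j *: c s j | s < m].
  apply: eq_from_tnth => s; rewrite !tnth_mktuple big_ord_recl expr0 scale1r.
  by rewrite big1 ?addr0 // => j _; rewrite expr0n scale0r.
rewrite AE => /(row_free_open (c := @polyC K)) [x|q q0 hq].
  exact: hornerC.
exists q; first by apply: contraNneq q0 => ->; rewrite rmorph0.
by move=> t qt; rewrite AE; apply: hq => // y; apply: hornerC.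
Qed.

End ParametricRank.

(** * Genericity tested along lines *)

Section LineGeneric.
Variable K : fieldType.
Hypothesis charK : [pchar K] =i pred0.

Lemma natr_inj_pchar0 : injective (fun n : nat => n%:R : K).
Proof.
have h m n : (m <= n)%N -> m%:R = n%:R :> K -> m = n.
  move=> le /esym/eqP; rewrite -subr_eq0 -natrB //.
  move/pcharf0P: charK => -> /eqP /eqP; rewrite subn_eq0 => ge.
  by apply/eqP; rewrite eqn_leq le.
by move=> m n; case/orP: (leq_total m n) => le /=; [|move/esym]; move/(h _ _ le).
Qed.

Lemma poly_nonroot (q : {poly K}) : q != 0 -> exists t, q.[t] != 0.
Proof.
move=> q0; pose rs : seq K := [seq n%:R | n <- iota 0 (size q)].
have : ~~ all (root q) rs.
  apply/negP => /(max_poly_roots q0).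
  rewrite size_map size_iota ltnn map_inj_uniq ?iota_uniq //; last exact: natr_inj_pchar0.
  by move=> /(_ isT).
by case/allPn => t _ qt; exists t.
Qed.

(* A weakening of "open and dense" which only looks at lines.  It passes to
   finite intersections and to preimages under linear surjections without any
   manipulation of polynomials. *)
Definition linegen (V : lmodType K) (U : V -> Prop) : Prop :=
  (exists a, U a) /\ forall a b, U a ->
    exists2 q : {poly K}, q != 0 & forall t, q.[t] != 0 -> U (a + t *: b).

(** On the line through a point [a] of [U] and a point [b] of [U'], each set misses only roots of a
    nonzero polynomial; seen from [b] the parameter is [1 - t]. In characteristic zero some [t]
    avoids both. *)
Lemma linegenI (V : lmodType K) (U U' : V -> Prop) : linegen U -> linegen U' ->
  linegen (fun a => U a /\ U' a).
Proof.
move=> [[a Ua] hU] [[b U'b] hU']; split.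
  have [q q0 hq] := hU a (b - a) Ua; have [r r0 hr] := hU' b (a - b) U'b.
  have s0 : q * (r \Po (1 - 'X)) != 0.
    rewrite mulf_neq0 // comp_poly2_eq0 // addrC size_polyDl ?size_polyN ?size_polyX //.
    by rewrite size_poly1.
  have [t] := poly_nonroot s0.
  rewrite hornerM mulf_eq0 negb_or horner_comp !hornerE => /andP[qt rt].
  exists (a + t *: (b - a)); split; first exact: hq.
  suff -> : a + t *: (b - a) = b + (1 - t) *: (a - b) by apply: hr.
  rewrite scalerBl scale1r addrA addrCA subrr addr0; congr (_ + _).
  by rewrite -scalerN opprB.
move=> a' b' [/hU h /hU' h'].
have [q q0 hq] := h b'; have [r r0 hr] := h' b'.
exists (q * r); first exact: mulf_neq0.
by move=> t; rewrite hornerM mulf_eq0 negb_or => /andP[/hq ? /hr].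
Qed.

Lemma linegenT (V : lmodType K) : linegen (fun _ : V => True).
Proof.
by split; [exists 0 | move=> a b _; exists 1 => //; apply: oner_neq0].
Qed.

Lemma linegenW (V : lmodType K) (U U' : V -> Prop) :
  (forall a, U a <-> U' a) -> linegen U -> linegen U'.
Proof.
move=> UU' [[a Ua] h]; split; first by exists a; apply/UU'.
move=> b c /UU' /h hb; have [q q0 hq] := hb c.
by exists q => // t /hq /UU'.
Qed.

Lemma linegen_ltn (V : lmodType K) (U : nat -> V -> Prop) n :
  (forall i, linegen (U i)) -> linegen (fun a => forall i, (i < n)%N -> U i a).
Proof.
move=> h; elim: n => [|n IH].
  by apply: linegenW (linegenT V) => a; split.
apply: linegenW (linegenI (h n) IH) => a; split.
  by move=> [Ua IHa] i; rewrite ltnS leq_eqVlt => /predU1P[-> //|]; apply: IHa.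
by move=> Ha; split; [apply: Ha | move=> i lt; apply: Ha; rewrite ltnS ltnW].
Qed.

Lemma linegen_fin (V : lmodType K) (T : finType) (U : T -> V -> Prop) :
  (forall i, linegen (U i)) -> linegen (fun a => forall i, U i a).
Proof.
move=> h.
have hs (s : seq T) : linegen (fun a => forall i, i \in s -> U i a).
  elim: s => [|i s IH]; first by apply: linegenW (linegenT V) => a; split.
  apply: linegenW (linegenI (h i) IH) => a; split.
    by move=> [Ua IHa] j; rewrite inE => /predU1P[-> //|]; apply: IHa.
  move=> Ha; split; first by apply: Ha; rewrite mem_head.
  by move=> j js; apply: Ha; rewrite inE js orbT.
apply: linegenW (hs (enum T)) => a; split => Ha i; last by move=> _.
by apply: Ha; rewrite mem_enum.
Qed.

Lemma linegen_comp (V W : lmodType K) (f : {linear V -> W}) (g : W -> V)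
    (U : W -> Prop) : cancel g f -> linegen U -> linegen (fun a => U (f a)).
Proof.
move=> gK [[a Ua] h]; split; first by exists (g a); rewrite gK.
move=> b c Ub; have [q q0 hq] := h _ (f c) Ub.
by exists q => // t /hq; rewrite linearD linearZ.
Qed.

Lemma mpoly_line n (p : {mpoly K[n]}) (a b : 'rV[K]_n) : exists q : {poly K},
  forall t, q.[t] = p.@[(a + t *: b) 0].
Proof.
exists (mmap polyC (fun i => (a 0 i)%:P + (b 0 i) *: 'X) p) => t.
rewrite /mmap /meval /mmap horner_sum; apply: eq_bigr => m _.
rewrite hornerM hornerC; congr (_ * _); rewrite /mmap1 horner_prod.
by apply: eq_bigr => i _; rewrite horner_exp !hornerE !mxE mulrC.
Qed.

Lemma zariski_linegen n (U : set 'rV[K]_n) : zariski_open U -> (exists a, U a) ->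
  linegen U.
Proof.
move=> [E ->] neU; split=> // a b [p Ep pa].
have [q hq] := mpoly_line p a b; exists q.
  apply: contraNneq pa => q0; have := hq 0.
  by rewrite scale0r addr0 q0 horner0 => <-.
by move=> t; rewrite hq => pt; exists p.
Qed.

End LineGeneric.

(** * Sectional matrices as minima of Hilbert functions *)

Section SectionalMatrixValue.
Variables (K : fieldType) (l : nat).
Hypothesis charK : [pchar K] =i pred0.
Local Notation S := {mpoly K[l.+1]}.
Implicit Types (I : set S) (d k : nat).

Definition forms k (L : 'M[K]_(k, l.+1)) : seq S :=
  [seq linear_form (row j L) | j : 'I_k].

Lemma linear_form_linear : linear (@linear_form K l.+1).
Proof.
move=> a u v; rewrite /linear_form scaler_sumr -big_split.
by apply: eq_bigr => j _; rewrite !mxE scalerDl scalerA.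
Qed.

HB.instance Definition _ := GRing.isLinear.Build K 'rV[K]_l.+1 S *:%R
  (@linear_form K l.+1) linear_form_linear.

Lemma linear_form_homog (a : 'rV[K]_l.+1) : linear_form a \is 1.-homog.
Proof.
by apply: rpred_sum => j _; apply: rpredZ; rewrite dhomogX /= mdeg1.
Qed.

Lemma forms_homogeneous k (L : 'M[K]_(k, l.+1)) p : p \in forms L -> homogeneous p.
Proof. by move=> /mapP[j _ ->]; exists 1%N; apply: linear_form_homog. Qed.

Lemma size_forms k (L : 'M[K]_(k, l.+1)) : size (forms L) = k.
Proof. by rewrite size_map size_enum_ord. Qed.

Lemma nth_forms k (L : 'M[K]_(k, l.+1)) (j : 'I_k) :
  (forms L)`_j = linear_form (row j L).
Proof. by rewrite (nth_map j) ?size_enum_ord // nth_ord_enum. Qed.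

Lemma ideal_gen_forms k (L : 'M[K]_(k, l.+1)) f : ideal_gen (forms L) f <->
  exists h : 'I_k -> S, f = \sum_j h j * linear_form (row j L).
Proof.
have e := size_forms L; split=> [[c ->]|[h ->]]; last first.
  apply: ideal_sum (ideal_gen_ideal _) _ => j _.
  by apply: (idealMr (ideal_gen_ideal _)); apply: mem_ideal_gen; apply: map_f; rewrite mem_enum.
exists (fun j => c (cast_ord (esym e) j)).
rewrite (reindex (cast_ord (esym e))) /=; last first.
  by exists (cast_ord e) => j _; rewrite ?cast_ordK ?cast_ordKV.
by apply: eq_bigr => j _; rewrite -nth_forms.
Qed.

(** Upper semicontinuity. A basis of the degree [d] part at [L0] is written with coefficients in
    front of the linear forms; keeping the coefficients and moving the forms gives vectors of the
    ideal at [L] that depend affinely on [L], hence stay independent on an open set. *)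
Lemma hf_forms_upper I k (L0 : 'M[K]_(k, l.+1)) d : ideal I -> graded I ->
  exists2 p : {mpoly K[k * l.+1]}, p.@[mxvec L0 0] != 0 &
    forall L : 'M[K]_(k, l.+1), p.@[mxvec L 0] != 0 ->
      (hf (addgen I (forms L)) d <= hf (addgen I (forms L0)) d)%N.
Proof.
move=> hI gI; have hIL (L : 'M[K]_(k, l.+1)) := addgen_ideal (forms L) hI.
set U := hpart (addgen I (forms L0)) d.
have /choice [gh hgh] (s : 'I_(\dim U)) : exists gh : S * ('I_k -> S), I gh.1 /\
    (vbasis U)`_s = hproj d (gh.1 + \sum_j gh.2 j * linear_form (row j L0)).
  have : (vbasis U)`_s \in U by apply/vbasis_mem/mem_nth; rewrite size_tuple.
  move/(hpartP _ (hIL L0)) => [g [h [Ig /ideal_gen_forms[c hc] vE]]].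
  by exists (g, c); split=> //=; rewrite -hc -vE hproj_val.
pose G s := hproj d (gh s).1.
pose H s (x : 'rV[K]_(k * l.+1)) :=
  hproj d (\sum_j (gh s).2 j * linear_form (row j (vec_mx x))).
have linH s : linear (H s).
  move=> a u v; rewrite /H -linearP; congr hproj.
  rewrite scaler_sumr -big_split; apply: eq_bigr => j _ /=.
  by rewrite !linearP /= mulrDr scalerAr.
have fr : free [tuple G s + H s (mxvec L0) | s < \dim U].
  suff -> : [tuple G s + H s (mxvec L0) | s < \dim U] = vbasis U.
    exact: basis_free (vbasisP U).
  apply: eq_from_tnth => s; rewrite tnth_mktuple (tnth_nth 0) (hgh s).2.
  by rewrite /G /H mxvecK linearD.
have [p p0 hp] := free_affine_open linH fr.
exists p => // L /hp; set X := [tuple _ | s < _]; rewrite /free size_tuple => /eqP dX.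
rewrite leq_sub2l // -/U -dX dimvS //; apply/span_subvP => v /tnthP[s ->].
rewrite tnth_mktuple; apply/(hpartP _ (hIL L)).
rewrite /G /H mxvecK -linearD.
apply: addgen_graded => //; first exact: forms_homogeneous.
exists (gh s).1, (\sum_j (gh s).2 j * linear_form (row j L)).
by split=> //; [case: (hgh s) | apply/ideal_gen_forms; exists (gh s).2].
Qed.

Lemma for_generic_formsI k (P P' : 'M[K]_(k, l.+1) -> Prop) :
  for_generic_forms P -> for_generic_forms P' -> exists L, P L /\ P' L.
Proof.
move=> [U [oU neU UP]] [U' [oU' neU' UP']].
have [[x [Ux U'x]] _] := linegenI charK (zariski_linegen oU neU) (zariski_linegen oU' neU').
by exists (vec_mx x); split; [apply: UP | apply: UP']; rewrite vec_mxK.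
Qed.

Section Value.
Variables (I : set S) (i d : nat).
Hypotheses (hI : ideal I) (gI : graded I).
Local Notation hL L := (hf (addgen I (forms L)) d).

(** By semicontinuity the minimum over all [L] is attained on a nonempty open set. Two such sets
    meet, so it is the only value that [xget] can return. *)
Lemma sectional_matrix_min :
  (exists L : 'M[K]_(l.+1 - i, l.+1), hL L = sectional_matrix I i d) /\
  (forall L : 'M[K]_(l.+1 - i, l.+1), (sectional_matrix I i d <= hL L)%N).
Proof.
set k := (l.+1 - i)%N.
pose small m := `[< exists L : 'M[K]_(k, l.+1), hL L = m >].
have s0 : exists m, small m by exists (hL (0 : 'M_(k, l.+1))); apply/asboolP; exists 0.
case: (ex_minnP s0) => m /asboolP[L0 L0m] mmin.
have hmin (L : 'M[K]_(k, l.+1)) : (m <= hL L)%N by apply: mmin; apply/asboolP; exists L.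
have gen : for_generic_forms (fun L : 'M[K]_(k, l.+1) =>
    quotient_dim (ideal_add I (linear_ideal L)) d = m).
  pose E (p : {mpoly K[k * l.+1]}) :=
    forall L : 'M[K]_(k, l.+1), p.@[mxvec L 0] != 0 -> hL L = m.
  exists (fun v => exists2 p, E p & p.@[v 0] != 0); split; first by exists E.
    have [p p0 hp] := hf_forms_upper L0 d hI gI.
    exists (mxvec L0), p => // L /hp; rewrite L0m => le.
    by apply/eqP; rewrite eqn_leq le hmin.
  move=> L [p Ep pL]; rewrite quotient_dimE; first exact: Ep.
  exact: addgen_ideal.
suff -> : sectional_matrix I i d = m by split=> //; exists L0.
rewrite /sectional_matrix; case: xgetP => [m' _ /= gen'|none].
  by have [L [<- <-]] := for_generic_formsI gen' gen.
by case: (none m).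
Qed.

Lemma sectional_matrix_linegen :
  linegen (fun L : 'M[K]_(l.+1 - i, l.+1) => hL L = sectional_matrix I i d).
Proof.
have [[L0 L0m] hmin] := sectional_matrix_min; split; first by exists L0.
move=> a b am; have [p p0 hp] := hf_forms_upper a d hI gI.
have [q hq] := mpoly_line p (mxvec a) (mxvec b); exists q.
  apply: contraNneq p0 => q0; have := hq 0.
  by rewrite scale0r addr0 q0 horner0 => <-.
move=> t; rewrite hq -linearZ -linearD => /hp; rewrite am => le.
by apply/eqP; rewrite eqn_leq le hmin.
Qed.

End Value.

End SectionalMatrixValue.

(** * Regularity along a pencil of linear forms *)

Section Deformation.
Variables (K : fieldType) (l : nat).
Hypothesis charK : [pchar K] =i pred0.
Local Notation S := {mpoly K[l.+1]}.
Implicit Types (I : set S) (f g L z : S) (d k : nat) (t : K).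

Lemma homogX1 L k : L \is 1.-homog -> L ^+ k \is k.-homog.
Proof. by move/(dhomogMn k); rewrite mul1n. Qed.

(* If the derivative at [t = 0] of [f * (L + t z)^k] were not in
   [I + (L^k)], it would be one more independent vector of [I + ((L + t z)^k)]
   for general [t], against the bound on the Hilbert function. *)
Lemma deform_derivative I L z e k f (T : K -> Prop) : ideal I -> graded I ->
  L \is 1.-homog -> z \is 1.-homog -> f \is e.-homog ->
  (forall q : {poly K}, q != 0 -> exists2 t, T t & q.[t] != 0) ->
  (forall t, T t ->
    (hf (adjoin I (L ^+ k)) (e + k) <= hf (adjoin I ((L + t *: z) ^+ k)) (e + k))%N) ->
  I (f * L ^+ k) -> adjoin I (L ^+ k) (f * (L ^+ k.-1 * z *+ k)).
Proof.
move=> hI gI hL hz hf_ Tinf hfle IfL; set d := (e + k)%N in hfle *.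
(* The coefficient of [t^j] in [(L + t z)^k]; [b 1] is the derivative at [t = 0]. *)
pose b j : S := L ^+ (k - j) * z ^+ j *+ 'C(k, j).
have bhom j : b j \is k.-homog.
  rewrite /b; have [le|lt] := leqP j k; last by rewrite bin_small // mulr0n dhomog0.
  apply: rpredMn; rewrite -{2}(subnK le).
  by apply: dhomogM; apply: homogX1.
have expE t : (L + t *: z) ^+ k = \sum_(j < k.+1) t ^+ j *: b j.
  rewrite exprDn; apply: eq_bigr => j _.
  by rewrite exprZn -scalerAr scalerMnr.
have b0 : b 0%N = L ^+ k by rewrite /b subn0 expr0 mulr1 bin0.
have b1 : b 1%N = L ^+ k.-1 * z *+ k by rewrite /b expr1 bin1 subn1.
have bk : b k.+1 = 0 by rewrite /b bin_small.
set I0 := adjoin I (L ^+ k); have hI0 : ideal I0 by apply: adjoin_ideal.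
have hIt t := adjoin_ideal ((L + t *: z) ^+ k) hI.
have gIt t : graded (adjoin I ((L + t *: z) ^+ k)).
  apply: adjoin_graded => //; exists k.
  by apply: homogX1; apply: rpredD => //; apply: rpredZ.
apply: contrapT => notin; set U := hpart I0 d.
have /choice [gh hgh] (s : 'I_(\dim U)) : exists gh : S * S, I gh.1 /\
    (vbasis U)`_s = hproj d (gh.1 + gh.2 * L ^+ k).
  have : (vbasis U)`_s \in U by apply/vbasis_mem/mem_nth; rewrite size_tuple.
  move/(hpartP _ hI0) => [h Ih]; exists (val (vbasis U)`_s - h * L ^+ k, h).
  by split=> //=; rewrite subrK hproj_val.
(* Coefficients in [t] of a family of vectors. Index 0 carries the difference quotient
   [(f (L + t z)^k - f L^k) / t]; the others deform a basis of the degree [d] part of [I0] by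
   replacing [L] with [L + t z]. *)
pose c (s : 'I_(\dim U).+1) (j : 'I_k.+1) : dhomog l.+1 K d :=
  if unlift ord0 s is Some s'
  then hproj d ((j == ord0)%:R *: (gh s').1 + (gh s').2 * b j)
  else hproj d (f * b j.+1).
have fr : free [tuple c s ord0 | s < (\dim U).+1].
  suff -> : [tuple c s ord0 | s < (\dim U).+1] =
      [tuple of hproj d (f * b 1%N) :: vbasis U].
    rewrite free_cons (basis_free (vbasisP U)) andbT (span_basis (vbasisP U)).
    apply/negP => /(hpartP _ hI0); rewrite hprojK ?b1 //; rewrite -b1.
    exact: dhomogM.
  apply: eq_from_tnth => s; rewrite tnth_mktuple /c.
  case: unliftP => [s' ->|->].
    rewrite tnthS eqxx scale1r b0 -(hgh s').2; symmetry; exact: tnth_nth.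
  by rewrite tnth0.
have [q q0 hq] := free_poly_open fr.
(* The factor ['X] makes [t] nonzero, so that the difference quotient can be divided by [t]. *)
have [t Tt] : exists2 t, T t & (q * 'X).[t] != 0.
  by apply: Tinf; rewrite mulf_neq0 // polyX_eq0.
rewrite hornerM hornerX mulf_eq0 negb_or => /andP[/hq Xfree t0].
have := hfle t Tt; apply/negP; rewrite -ltnNge.
set Ut := hpart (adjoin I ((L + t *: z) ^+ k)) d.
suff ltU : (\dim U < \dim Ut)%N.
  have := hf_dim I0 d; have := hf_dim (adjoin I ((L + t *: z) ^+ k)) d.
  have arith x y u v n : (x + v = n -> y + u = n -> u < v -> x < y)%N by lia.
  by move=> e1 e2; apply: arith e1 e2 ltU.
move: Xfree; rewrite /free size_tuple => /eqP <-.
apply: dimvS; apply/span_subvP => v /tnthP[s ->]; rewrite tnth_mktuple /c.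
case: unliftP => [s' _|_].
  have -> : \sum_(j < k.+1) t ^+ j *:
      hproj d ((j == ord0)%:R *: (gh s').1 + (gh s').2 * b j) =
      hproj d ((gh s').1 + (gh s').2 * (L + t *: z) ^+ k).
    under eq_bigr => j _ do rewrite -linearZ.
    rewrite -linear_sum; congr hproj.
    under eq_bigr => j _ do rewrite scalerDr scalerA scalerAr.
    rewrite big_split /= -mulr_sumr -expE; congr (_ + _).
    rewrite (bigD1 ord0) //= mulr1 expr0 scale1r big1 ?addr0 // => j /negPf ->.
    by rewrite mulr0 scale0r.
  apply/(hpartP _ (hIt t)); apply: gIt; apply: idealD => //.
    by apply: adjoinW; case: (hgh s').
  exact: adjoin_gen.
under eq_bigr => j _ do rewrite -linearZ.
rewrite -linear_sum; apply/(hpartP _ (hIt t)); apply: gIt.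
set w := \sum_(j < k.+1) _.
have tw : t *: w = f * (L + t *: z) ^+ k - f * L ^+ k.
  rewrite expE -b0 -mulrBr big_ord_recl expr0 scale1r addrAC subrr add0r.
  rewrite /w scaler_sumr mulr_sumr big_ord_recr /= bk mulr0 !scaler0 addr0.
  by apply: eq_bigr => j _; rewrite scalerA -exprS scalerAr.
rewrite -[w](scalerK t0); apply: (idealZ (hIt t)); rewrite tw.
apply: (idealB (hIt t)); first exact: adjoin_gen.
exact: adjoinW.
Qed.

(* The Hilbert function of [I + ((L + t z)^k)] does not depend on [t], so
   [deform_derivative] applies: [f L^k] in [I] forces [f] in [I + (L)], for
   every [k], and a descent on the degree of [f] concludes. *)
Lemma regular_of_pencil I L z (T : K -> Prop) : ideal I -> graded I ->
  L \is 1.-homog -> z \is 1.-homog -> T 0 ->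
  (forall q : {poly K}, q != 0 -> exists2 t, T t & q.[t] != 0) ->
  (forall t, T t -> regular (adjoin I (L + t *: z)) z) -> regular I L.
Proof.
move=> hI gI hL hz T0 Tinf reg_.
have [m mE] : {m : K -> S | forall t, m t = L + t *: z} by exists (fun t => L + t *: z).
have {reg_} reg t : T t -> regular (adjoin I (m t)) z by rewrite mE; apply: reg_.
have [pw pwE] : {pw : K -> nat -> S | forall t k, pw t k = m t ^+ k}.
  by exists (fun t k => m t ^+ k).
have pw0 t : pw t 0%N = 1 by rewrite pwE expr0.
have pwS t k : pw t k.+1 = m t * pw t k by rewrite !pwE exprS.
have hm t k : pw t k \is k.-homog.
  by rewrite pwE mE; apply: homogX1; apply: rpredD => //; apply: rpredZ.
have hm1 t : m t \is 1.-homog by rewrite -[m t]mulr1 -(pw0 t) -pwS hm.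
have hIm t k : ideal (adjoin I (pw t k)) by apply: adjoin_ideal.
have hIm1 t : ideal (adjoin I (m t)) by apply: adjoin_ideal.
have gIm t k : graded (adjoin I (pw t k)) by apply: adjoin_graded => //; exists k.
have gIm1 t : graded (adjoin I (m t)) by apply: adjoin_graded => //; exists 1%N.
(* Two members of the pencil differ by a multiple of [z]. *)
have adj2 s t : adjoin (adjoin I (m t)) z = adjoin (adjoin I (m s)) z.
  suff sub u v f : adjoin (adjoin I (m u)) z f -> adjoin (adjoin I (m v)) z f.
    by apply/seteqP; split=> f; apply: sub.
  have hv : ideal (adjoin (adjoin I (m v)) z) by apply: adjoin_ideal.
  apply: adjoin_sub => //; last exact: adjoin_id.
  apply: adjoin_sub => //; first by move=> g Ig; do 2!apply: adjoinW.
  have -> : m u = m v + (u - v)%:MP * z.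
    by rewrite mul_mpolyC !mE scalerBl; ring.
  apply: idealD => //; last exact: adjoin_gen.
  by apply: adjoinW; apply: adjoin_id.
(* Regularity of [z] determines the Hilbert function of [I + (m t)] recursively from that of
   [I + (m t, z)], which is the same for all [t]. *)
have constA s t d : T s -> T t -> hf (adjoin I (m s)) d = hf (adjoin I (m t)) d.
  move=> Ts Tt; elim: d => [|d IH].
    have := hf_adjoin_low (hIm1 s) (gIm1 s) hz (ltn0Sn 0).
    have := hf_adjoin_low (hIm1 t) (gIm1 t) hz (ltn0Sn 0).
    by rewrite (adj2 t s) => <- <-.
  have := hf_adjoin d (hIm1 s) (gIm1 s) hz; have := hf_adjoin d (hIm1 t) (gIm1 t) hz.
  rewrite addn1 (colon_regular (hIm1 s) (reg _ Ts)) (colon_regular (hIm1 t) (reg _ Tt)).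
  by rewrite (adj2 t s) IH => -> ->.
pose claim k := forall t f, T t -> I (f * pw t k) -> adjoin I (m t) f.
(* Multiply by [m^j] on [S/(I + (m^(j+1)))]: the cokernel is [S/(I + (m^j))] and, by [claim j], the
   colon ideal is [I + (m)]. The Hilbert function is thus a sum of two that are already constant in
   [t]. *)
have constB k : (forall j, (j < k)%N -> claim j) -> forall s t d, T s -> T t ->
    hf (adjoin I (pw s k)) d = hf (adjoin I (pw t k)) d.
  elim: k => [|j IH] hcl s t d Ts Tt; first by rewrite !pw0.
  have {}IH := IH (fun i ij => hcl i (ltnW ij)).
  have E1 u : adjoin (adjoin I (pw u j.+1)) (pw u j) = adjoin I (pw u j).
    apply/seteqP; split=> f.
      apply: adjoin_sub => //; last exact: adjoin_id.
      apply: adjoin_sub => //; first exact: adjoinW.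
      by rewrite pwS; apply: adjoin_gen.
    apply: adjoin_sub; first exact: adjoin_ideal.
      by move=> g Ig; do 2!apply: adjoinW.
    by apply: adjoin_id.
  have E2 u : T u -> colon (adjoin I (pw u j.+1)) (pw u j) = adjoin I (m u).
    move=> Tu; apply/seteqP; split=> f.
      move=> [g]; rewrite pwS mulrA -mulrBl => /(hcl _ (ltnSn j) _ _ Tu) h.
      by apply: (idealBK (hIm1 u) h); apply: adjoin_gen.
    apply: adjoin_sub; first exact: colon_ideal.
      by move=> g Ig; apply: adjoinW; apply: (idealMl hI).
    by rewrite /colon -pwS; apply: adjoin_id.
  have [lt|ge] := ltnP d j.
    have low u : hf (adjoin I (pw u j.+1)) d = hf (adjoin I (pw u j)) d.
      by have := hf_adjoin_low (hIm u j.+1) (gIm u j.+1) (hm u j) lt; rewrite E1 => ->.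
    by rewrite (low s) (low t); apply: IH.
  have high u : T u -> hf (adjoin I (pw u j.+1)) d =
      (hf (adjoin I (pw u j)) d + hf (adjoin I (m u)) (d - j))%N.
    move=> Tu; have := hf_adjoin (d - j) (hIm u j.+1) (gIm u j.+1) (hm u j).
    by rewrite (subnK ge) E1 (E2 u Tu).
  by rewrite (high s Ts) (high t Tt) (IH s t d Ts Tt) (constA s t _ Ts Tt).
have claims k : claim k.
  elim/ltn_ind: k => -[_|k IH] t f Tt; first by rewrite pw0 mulr1; apply: adjoinW.
  move=> Ifm; suff homog_case e g : g \is e.-homog -> I (g * pw t k.+1) ->
      adjoin I (m t) g.
    apply: ideal_pieces => // e; apply: (homog_case e); first exact: pihomogP.
    have := gI _ (e + k.+1)%N Ifm.
    by rewrite (pihomogM_homog _ _ (hm t k.+1)) leq_addl addnK.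
  move=> hg Igm.
  have : adjoin I (pw t k.+1) (g * (pw t k * z *+ k.+1)).
    rewrite !pwE; apply: (@deform_derivative I (m t) z e k.+1 g (fun u => T (t + u)));
      [exact: hI | exact: gI | exact: hm1 | exact: hz | exact: hg | | | by rewrite -pwE].
      move=> q q0; have [|u Tu] := Tinf (q \Po ('X - t%:P)).
        by rewrite comp_poly2_eq0 // size_XsubC.
      rewrite horner_comp !hornerE => qu; exists (u - t) => //.
      by rewrite addrC subrK.
    move=> u Tu; have -> : m t + u *: z = m (t + u) by rewrite !mE -addrA -scalerDl.
    by rewrite -!pwE (constB k.+1 IH t (t + u) _ Tt Tu).
  (* Factoring out [m^k] brings in the claim for [k], which puts [(k+1) g z] in [I + (m)]; then
     [k+1] is inverted and [z] cancelled. *)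
  move=> [h]; have -> : g * (pw t k * z *+ k.+1) - h * pw t k.+1 =
      (k.+1%:R *: (g * z) - h * m t) * pw t k.
    rewrite pwS mulrBl !mulrA; congr (_ - _).
    by rewrite -mulrnAr -scaler_nat -!scalerAl -!scalerAr mulrAC mulrA.
  move/(IH k (ltnSn k) _ _ Tt) => Ih.
  have {}Ih : adjoin I (m t) (k.+1%:R *: (g * z)).
    by apply: (idealBK (hIm1 t) Ih); apply: adjoin_gen.
  apply: reg => //; have k0 : k.+1%:R != 0 :> K by move/pcharf0P: charK => ->.
  by rewrite -[g * z](scalerK k0); apply: (idealZ (hIm1 t)).
have m0 : m 0 = L by rewrite mE scale0r addr0.
apply: (regular_homog hI gI hL) => d f hf_ IfL.
suff : forall k g, g \is d.-homog -> I (g * L ^+ k) -> I g.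
  by move=> /(_ 1%N f hf_); apply; rewrite expr1.
(* The exponent grows while the degree drops: [g = h L] modulo [I] turns [g L^k] into
   [h L^(k+1)]. *)
elim: d {f hf_ IfL} => [|d IH] k g hg Ig; rewrite -m0 -pwE in Ig.
  by apply: (adjoin_low hI gI hL hg) => //; rewrite -m0; apply: claims Ig.
have := claims k 0 g T0 Ig; rewrite pwE m0 in Ig * => Ag.
have [|h hh Ih] := adjoin_homog (d := d) hI gI hL _ Ag; first by rewrite addn1.
apply: (idealBK hI Ih); apply: (idealMl hI); apply: (IH k.+1) => //.
rewrite exprS mulrA; apply: (idealBKl hI (f := g * L ^+ k)) => //.
by rewrite -mulrBl; apply: (idealMl hI).
Qed.

End Deformation.

(** * Ideals of linear forms and the Bayer-Stillman criterion *)

Section LinearForms.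
Variables (K : fieldType) (l : nat).
Local Notation S := {mpoly K[l.+1]}.
Implicit Types (I : set S) (f g : S) (s : seq 'rV[K]_l.+1) (a v : 'rV[K]_l.+1).

Definition lfs s : seq S := [seq linear_form a | a <- s].

Definition lin s := ideal_gen (lfs s).

Lemma lin_ideal s : ideal (lin s). Proof. exact: ideal_gen_ideal. Qed.

Lemma lfs_homogeneous s p : p \in lfs s -> homogeneous p.
Proof. by case/mapP => a _ ->; exists 1%N; apply: linear_form_homog. Qed.

Lemma lin_graded s : graded (lin s).
Proof. by apply: ideal_gen_graded; apply: lfs_homogeneous. Qed.

Lemma lin_mem s a : a \in s -> lin s (linear_form a).
Proof. by move=> h; apply/mem_ideal_gen/map_f. Qed.

Lemma lin_rcons s a : lin (rcons s a) = adjoin (lin s) (linear_form a).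
Proof.
have h0 : ideal (fun f : S => f = 0).
  by split=> // [f g -> ->|g f ->]; rewrite ?addr0 ?mulr0.
have E t : lin t = addgen (fun f : S => f = 0) (lfs t).
  apply/seteqP; split=> f; first exact: addgenr.
  by move=> [g [h [-> th ->]]]; rewrite add0r.
by rewrite !E /lfs map_rcons addgen_rcons.
Qed.

Lemma meval_linear_form a v : (linear_form a).@[v 0] = \sum_j a 0 j * v 0 j.
Proof.
by rewrite /linear_form raddf_sum; apply: eq_bigr => j _ /=; rewrite mevalZ mevalXU.
Qed.

Lemma linear_form_mulmx m (B : 'M[K]_(m, l.+1)) (u : 'rV[K]_m) :
  linear_form (u *m B) = \sum_j u 0 j *: linear_form (row j B).
Proof. by rewrite mulmx_sum_row linear_sum; apply: eq_bigr => j _; rewrite linearZ. Qed.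

Lemma linear_form_delta j : linear_form (delta_mx 0 j) = 'X_j :> S.
Proof.
rewrite /linear_form (bigD1 j) //= mxE !eqxx scale1r big1 ?addr0 // => k /negPf kj.
by rewrite mxE kj andbF scale0r.
Qed.

(** The substitution of the projector [pr = 1 - B^+ B], with [B^+] a pseudo-inverse. It kills the
    rows of [B] since [B B^+ B = B], and moves each variable by a row combination of [B]. The ideal
    is thus a kernel of a map into a domain, hence prime. *)
Lemma lin_substitution s : exists2 psi : {rmorphism S -> S},
  (forall f, lin s f <-> psi f = 0) & forall f, lin s (f - psi f).
Proof.
pose B := \matrix_(i < size s) s`_i.
have BP (w : 'rV[K]_(size s)) : lin s (linear_form (w *m B)).
  rewrite linear_form_mulmx; apply: ideal_sum (lin_ideal s) _ => j _.
  by apply: (idealZ (lin_ideal s)); rewrite rowK; apply/lin_mem/mem_nth.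
pose pr := 1%:M - pinvmx B *m B.
pose psi : {rmorphism S -> S} :=
  comp_mpoly [tuple linear_form (row i pr) | i < l.+1].
have psiX i : psi 'X_i = linear_form (row i pr).
  by rewrite /psi /= comp_mpolyXU -tnth_nth tnth_mktuple.
have psiC c : psi c%:MP = c%:MP by rewrite /psi /= comp_mpolyC.
have psiL a : psi (linear_form a) = linear_form (a *m pr).
  rewrite linear_form_mulmx /linear_form rmorph_sum; apply: eq_bigr => j _ /=.
  by rewrite -!mul_mpolyC rmorphM psiC psiX.
have Bpr : B *m pr = 0 by rewrite mulmxBr mulmx1 mulmxA mulmxKpV ?subrr.
have sub f : lin s (f - psi f).
  have hl := lin_ideal s.
  have subM p q : lin s (p - psi p) -> lin s (q - psi q) ->
      lin s (p * q - psi (p * q)).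
    move=> hp hq; rewrite rmorphM.
    have -> : p * q - psi p * psi q = (p - psi p) * q + psi p * (q - psi q) by ring.
    by apply: idealD => //; [apply: idealMl | apply: idealMr].
  have sub1 : lin s (1 - psi 1) by rewrite rmorph1 subrr; apply: ideal0.
  have subX i : lin s ('X_i - psi 'X_i).
    rewrite psiX -linear_form_delta -linearB.
    have -> : delta_mx 0 i - row i pr = row i (pinvmx B) *m B.
      by rewrite -row1 -linearB /= subKr row_mul.
    exact: BP.
  rewrite [f]mpolyE rmorph_sum -sumrB; apply: ideal_sum (lin_ideal s) _ => m _.
  rewrite -mul_mpolyC; apply: (subM).
    by rewrite psiC subrr; apply: (ideal0 hl).
  rewrite mpolyXE_id; apply: (big_ind (fun p => lin s (p - psi p)) sub1 subM) => i _.
  elim: (m i) => [|k IH]; first by rewrite expr0; exact: sub1.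
  by rewrite exprS; apply: (subM _ _ (subX i) IH).
exists psi => // f; split=> [[c ->]|f0]; last by have := sub f; rewrite f0 subr0.
rewrite rmorph_sum big1 // => i _; rewrite rmorphM.
have is_ : (i < size s)%N by rewrite -[X in (_ < X)%N](size_map (@linear_form K l.+1)); apply: ltn_ord.
rewrite (nth_map 0) // psiL -[s`_i](rowK (fun i : 'I_(size s) => s`_i) (Ordinal is_)).
by rewrite -row_mul Bpr row0 linear0 mulr0.
Qed.

Lemma lin_prime s f g : lin s (f * g) -> lin s f \/ lin s g.
Proof.
have [psi psiP _] := lin_substitution s.
move/psiP; rewrite rmorphM => /eqP; rewrite mulf_eq0.
by case/orP => /eqP e; [left | right]; apply/psiP.
Qed.

(** Linear independence of the forms of [s], witnessed by points: evaluation at [w i] kills every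
    form but the one of index [i]. *)
Definition dual_basis s (w : nat -> 'rV[K]_l.+1) := forall i j,
  (i < size s)%N -> (j < size s)%N -> (linear_form s`_j).@[w i 0] = (i == j)%:R.

Lemma lin_take_nmem s w i : dual_basis s w -> (i < size s)%N ->
  ~ lin (take i s) (linear_form s`_i).
Proof.
move=> dw lti; have ev f : lin (take i s) f -> f.@[w i 0] = 0.
  move=> [c ->]; rewrite rmorph_sum big1 // => j _ /=; rewrite mevalM.
  have ltj : (j < i)%N.
    have := ltn_ord j; rewrite [X in (_ < X)%N](_ : _ = i) //.
    by rewrite size_map size_take lti.
  rewrite (nth_map 0) ?size_take ?lti // nth_take // dw ?(ltn_trans ltj) //.
  by rewrite gtn_eqF ?mulr0.
by move/ev => e; have := dw i i lti lti; rewrite e eqxx => /esym/eqP; rewrite oner_eq0.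
Qed.

Lemma lin_take_regular s w i : dual_basis s w -> (i < size s)%N ->
  regular (lin (take i s)) (linear_form s`_i).
Proof. by move=> dw lti f /lin_prime[//|/(lin_take_nmem dw lti)]. Qed.

Lemma lin_takeS s i : (i < size s)%N ->
  lin (take i.+1 s) = adjoin (lin (take i s)) (linear_form s`_i).
Proof. by move=> lti; rewrite (take_nth 0) // lin_rcons. Qed.

(** A one-sided inverse of a square matrix is two-sided, so a full independent family spans. *)
Lemma dual_basis_span s w j : dual_basis s w -> size s = l.+1 ->
  exists c : nat -> K, 'X_j = \sum_(i < l.+1) c i *: linear_form s`_i :> S.
Proof.
move=> dw ss; pose B := \matrix_(i < l.+1) s`_i; pose C := \matrix_(i < l.+1) w i.
have BC : B *m C^T = 1%:M.
  apply/matrixP => i k; rewrite !mxE.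
  rewrite eq_sym -(dw k i) ?ss // meval_linear_form.
  by apply: eq_bigr => q _; rewrite !mxE.
have CB : C^T *m B = 1%:M by apply: mulmx1C.
exists (fun i => C^T j (inord i)); rewrite -linear_form_delta -row1 -CB row_mul.
rewrite linear_form_mulmx; apply: eq_bigr => i _.
by rewrite rowK mxE inord_val.
Qed.

End LinearForms.

Section BayerStillman.
Variables (K : fieldType) (l : nat).
Local Notation S := {mpoly K[l.+1]}.
Implicit Types (I : set S) (f g : S).

(** In degrees below that of [p] the coefficient is taken to be 0, which keeps the difference
    homogeneous. *)
Lemma adjoin_homogr I p k f d : ideal I -> graded I -> p \is k.-homog ->
  f \is d.-homog -> adjoin I p f ->
  exists2 g, (f - g * p) \is d.-homog & I (f - g * p).
Proof.
move=> hI gI hp hf_ [g /(gI _ d)].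
rewrite linearB /= (pihomogM_homog _ _ hp) (pihomog_dE hf_); case: ifP => led h.
  exists (pihomog (@mdeg l.+1) (d - k) g) => //; apply: rpredB => //.
  by rewrite -{2}(subnK led); apply: dhomogM => //; apply: pihomogP.
by exists 0; rewrite mul0r // subr0.
Qed.

Lemma homog_X_decomp d f : f \is d.+1.-homog ->
  exists2 F : 'I_l.+1 -> S, (forall j, F j \is d.-homog) & f = \sum_j F j * 'X_j.
Proof.
move=> fh; have Q0 : exists2 F : 'I_l.+1 -> S, (forall j, F j \is d.-homog) &
    0 = \sum_j F j * 'X_j.
  exists (fun=> 0); first by move=> j; apply: rpred0.
  by rewrite big1 // => j _; rewrite mul0r.
rewrite [f]mpolyE big_seq; elim/big_ind: _ => //.
  move=> p q [F hF ->] [G hG ->]; exists (fun j => F j + G j).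
    by move=> j; apply: rpredD.
  by rewrite -big_split; apply: eq_bigr => j _ /=; rewrite mulrDl.
move=> n /(dhomogP _ _ _ fh) /= nd.
have [i ni] : exists i, (0 < n i)%N.
  apply/existsP; apply: contraTT (eqxx (mdeg n)) => /existsPn h.
  rewrite {2}mdegE big1; last by move=> i _; apply/eqP; have := h i; rewrite -leqNgt leqn0.
  by rewrite nd.
have nE : n = ((n - U_(i)) + U_(i))%MM by rewrite submK // lep1mP -lt0n.
exists (fun j => (j == i)%:R *: (f@_n *: 'X_[n - U_(i)])) => [j|].
  apply/rpredZ/rpredZ; rewrite dhomogX; apply/eqP.
  by have := congr1 (@mdeg _) nE; rewrite mdegD mdeg1 nd /=; lia.
rewrite (bigD1 i) //= eqxx scale1r big1 ?addr0; last first.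
  by move=> j /negPf ->; rewrite scale0r mul0r.
by rewrite -scalerAl -mpolyXD -nE.
Qed.

(** For a graded ideal this is generation in degrees at most [m], stated without naming
    generators. *)
Definition generated_above I m := forall d f, (m <= d)%N -> f \is d.+1.-homog -> I f ->
  exists2 F : 'I_l.+1 -> S, (forall j, F j \is d.-homog /\ I (F j)) &
    f = \sum_j F j * 'X_j.

Variables (I Lam : set S) (x y z : S) (m : nat).
Hypotheses (hI : ideal I) (gI : graded I) (hLam : ideal Lam) (gLam : graded Lam).
Hypotheses (LamI : forall f, Lam f -> I f).
Hypotheses (hx : x \is 1.-homog) (hy : y \is 1.-homog) (hz : z \is 1.-homog).
Hypotheses (regz : regular Lam z) (regx : regular (adjoin Lam z) x).
Hypothesis regy : regular (adjoin (adjoin Lam z) x) y.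
Hypothesis span : forall j, exists c1 c2 c3 : K,
  Lam ('X_j - c1 *: x - c2 *: y - c3 *: z).
Hypothesis genI : generated_above I m.+1.
Hypothesis full : forall f, f \is m.-homog -> adjoin I z f.
Hypothesis inj : forall f, f \is m.-homog -> I (f * z) -> I f.

(** If [f z] is in [I], generation in lower degree gives [f z = e0 z + a x + b y] modulo [Lam] with
    [a], [b], [e0] in [I]. As [z, x, y] is regular modulo [Lam], this is a Koszul relation:
    [b = e' x + b' z], [a = - e' y + a' z], so [f = e0 + a' x + b' y]. Once [e'] is in [I],
    injectivity one degree lower puts [a'] and [b'] in [I]. *)
Lemma bayer_stillman d : (m <= d)%N ->
  (forall f, f \is d.-homog -> adjoin I z f) /\
  (forall f, f \is d.-homog -> I (f * z) -> I f).
Proof.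
move/subnKC <-; elim: (d - m)%N => [|k]; first by rewrite addn0.
rewrite addnS; move: (leq_addr k m); move: {d k}(m + k)%N => d led [fulld injd].
have hLz : ideal (adjoin Lam z) by apply: adjoin_ideal.
have hLzx : ideal (adjoin (adjoin Lam z) x) by apply: adjoin_ideal.
have gLz : graded (adjoin Lam z) by apply: adjoin_graded => //; exists 1%N.
split=> f fh.
  have [F hF ->] := homog_X_decomp fh.
  have hIz := adjoin_ideal z hI.
  by apply: ideal_sum => // j _; apply: idealMl => //; apply: fulld.
move=> Ifz.
have fzh : f * z \is d.+2.-homog by rewrite -(addn1 d.+1); apply: dhomogM.
have [F hF fzE] := genI (led : (m < d.+1)%N) fzh Ifz.
have /choice [c hc] (j : 'I_l.+1) : exists c : K * K * K,
    Lam ('X_j - c.1.1 *: x - c.1.2 *: y - c.2 *: z).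
  by have [c1 [c2 [c3 h]]] := span j; exists (c1, c2, c3).
pose a := \sum_j (c j).1.1 *: F j; pose b := \sum_j (c j).1.2 *: F j.
pose e0 := \sum_j (c j).2 *: F j.
have homI (u : 'I_l.+1 -> K) : (\sum_j u j *: F j) \is d.+1.-homog /\
    I (\sum_j u j *: F j).
  split; first by apply: rpred_sum => j _; apply: rpredZ; case: (hF j).
  by apply: ideal_sum => // j _; apply: idealZ => //; case: (hF j).
have [ah Ia] : a \is d.+1.-homog /\ I a by apply: homI.
have [bh Ib] : b \is d.+1.-homog /\ I b by apply: homI.
have [_ Ie0] : e0 \is d.+1.-homog /\ I e0 by apply: homI.
have lam0 : Lam (f * z - e0 * z - a * x - b * y).
  suff -> : f * z - e0 * z - a * x - b * y =
      \sum_j F j * ('X_j - (c j).1.1 *: x - (c j).1.2 *: y - (c j).2 *: z).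
    by apply: ideal_sum => // j _; apply: idealMr.
  rewrite fzE /e0 /a /b !mulr_suml -!sumrB; apply: eq_bigr => j _.
  by rewrite -!mul_mpolyC; ring.
have Lb : adjoin (adjoin Lam z) x b.
  apply: regy; exists (- a); exists (f - e0).
  have -> : b * y - - a * x - (f - e0) * z = - (f * z - e0 * z - a * x - b * y).
    by ring.
  exact: (idealN hLam lam0).
have [|e eh Lbe] := adjoin_homog (d := d) hLz gLz hx _ Lb; first by rewrite (addn1 d).
(* Fullness moves the Koszul coefficient [e] into [I] by a multiple of [z], which is invisible
   modulo [Lam + (z)]. *)
have [g e'h Ie'] := adjoin_homogr hI gI hz eh (fulld e eh).
set e' := e - g * z in e'h Ie'.
have Lbe' : adjoin Lam z (b - e' * x).
  have -> : b - e' * x = (b - e * x) + g * x * z by rewrite /e'; ring.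
  by apply: idealD => //; apply: adjoin_gen.
have Lae' : adjoin Lam z (a + e' * y).
  apply: regx; have -> : (a + e' * y) * x = (f - e0) * z - (b - e' * x) * y -
      (f * z - e0 * z - a * x - b * y) by ring.
  apply: idealB => //; last exact: adjoinW.
  by apply: idealB => //; [apply: adjoin_gen | apply: idealMl].
have e'xh : e' * x \is (d + 1).-homog by apply: dhomogM.
have e'yh : e' * y \is (d + 1).-homog by apply: dhomogM.
have [|a' a'h La'] := adjoin_homog (d := d) hLam gLam hz _ Lae'.
  by rewrite -(addn1 d) in ah; apply: rpredD.
have [|b' b'h Lb'] := adjoin_homog (d := d) hLam gLam hz _ Lbe'.
  by rewrite -(addn1 d) in bh; apply: rpredB.
have Ia' : I a'.
  apply: injd => //; apply: (idealBKl hI (LamI La')); apply: idealD => //.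
  exact: idealMl.
have Ib' : I b'.
  apply: injd => //; apply: (idealBKl hI (LamI Lb')); apply: idealB => //.
  exact: idealMl.
apply: (idealBK hI (g := e0 + a' * x + b' * y)); last first.
  by apply: idealD; [| apply: idealD|]; rewrite //; apply: idealMl.
apply: LamI; apply: regz.
have -> : (f - (e0 + a' * x + b' * y)) * z = (f * z - e0 * z - a * x - b * y) +
    (a + e' * y - a' * z) * x + (b - e' * x - b' * z) * y by ring.
by apply: idealD => //; [apply: idealD => //|]; apply: idealMl.
Qed.

End BayerStillman.

(** * Derivations and Jacobian ideals of arrangements *)

Section Derivations.
Variables (K : fieldType) (l : nat).
Local Notation S := {mpoly K[l.+1]}.
Implicit Types (f g p : S) (v u : 'rV[S]_l.+1).
Local Notation der := derivation_apply.

Lemma derD u v g : der (u + v) g = der u g + der v g.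
Proof.
by rewrite /der -big_split; apply: eq_bigr => i _; rewrite mxE mulrDl.
Qed.

Lemma derZ f v g : der (f *: v) g = f * der v g.
Proof. by rewrite /der mulr_sumr; apply: eq_bigr => i _; rewrite mxE mulrA. Qed.

Lemma derN v g : der (- v) g = - der v g.
Proof. by rewrite -scaleN1r derZ mulN1r. Qed.

Lemma derB u v g : der (u - v) g = der u g - der v g.
Proof. by rewrite derD derN. Qed.

Lemma der0 g : der 0 g = 0 :> S.
Proof. by rewrite -(scale0r 0) derZ mul0r. Qed.

Lemma der_sum (T : Type) (r : seq T) (P : pred T) (F : T -> 'rV[S]_l.+1) g :
  der (\sum_(i <- r | P i) F i) g = \sum_(i <- r | P i) der (F i) g.
Proof.
exact: (big_morph (fun v => der v g) (fun u v => derD u v g) (der0 g)).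
Qed.

Lemma der_mul v f g : der v (f * g) = der v f * g + f * der v g.
Proof.
rewrite /der mulr_suml mulr_sumr -big_split; apply: eq_bigr => i _ /=.
by rewrite mderivM; ring.
Qed.

Lemma der_1 v : der v 1 = 0 :> S.
Proof. by rewrite /der big1 // => i _; rewrite -mpolyC1 mderivC mulr0. Qed.

Lemma der_delta i g : der (delta_mx 0 i) g = g^`M(i).
Proof.
rewrite /der (bigD1 i) //= mxE !eqxx mul1r big1 ?addr0 // => j /negPf ji.
by rewrite mxE ji andbF mul0r.
Qed.

Lemma der_prod (T : finType) v (F : T -> S) :
  der v (\prod_i F i) = \sum_i der v (F i) * \prod_(k | k != i) F k.
Proof.
have gen (r : seq T) : uniq r -> der v (\prod_(i <- r) F i) =
    \sum_(i <- r) der v (F i) * \prod_(k <- r | k != i) F k.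
  elim: r => [|i r IH] /=; first by rewrite !big_nil der_1.
  move=> /andP[ir ur]; rewrite !big_cons der_mul eqxx /= IH //.
  congr (_ + _).
    congr (_ * _); rewrite big_seq [RHS]big_seq_cond; apply: eq_bigl => k.
    by case: (boolP (k \in r)) => //= kr; apply/esym/eqP => ki; rewrite -ki kr in ir.
  rewrite mulr_sumr big_seq [RHS]big_seq; apply: eq_bigr => k kr.
  rewrite big_cons; case: eqP => [ik|_]; first by rewrite ik kr in ir.
  by rewrite mulrCA.
by have := gen _ (enum_uniq T); rewrite !big_enum => ->; under eq_bigr do rewrite big_enum_cond.
Qed.

Definition euler : 'rV[S]_l.+1 := \row_i 'X_i.

Lemma der_euler d p : p \is d.-homog -> der euler p = d%:R * p.
Proof.
move=> /dhomogP hp; rewrite /der.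
have -> : \sum_i euler 0 i * p^`M(i) =
    \sum_(m <- msupp p) \sum_i p@_m *: ('X_i * ('X_[m])^`M(i)).
  rewrite exchange_big; apply: eq_bigr => i _ /=.
  rewrite mxE {1}[p]mpolyE linear_sum mulr_sumr; apply: eq_bigr => m _ /=.
  by rewrite mderivZ scalerAr.
rewrite [in RHS](mpolyE p) mulr_sumr big_seq [RHS]big_seq.
apply: eq_bigr => m /hp /= md.
rewrite -scaler_sumr -scalerAr; congr (_ *: _).
have E i : 'X_i * ('X_[m])^`M(i) = (m i)%:R * 'X_[m] :> S.
  rewrite mderivX -scalerAr scaler_nat mulr_natl; case: (posnP (m i)) => [->|mi].
    by rewrite !mulr0n.
  by rewrite -mpolyXD addmC submK // lep1mP -lt0n.
rewrite (eq_bigr _ (fun i _ => E i)) -mulr_suml; congr (_ * _).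
by rewrite -md mdegE natr_sum.
Qed.

Lemma mderiv_homog d p i : p \is d.+1.-homog -> p^`M(i) \is d.-homog.
Proof.
move=> hp; apply/dhomogP => m; rewrite mcoeff_msupp mcoeff_deriv => h.
have : (m + U_(i))%MM \in msupp p.
  by rewrite mcoeff_msupp; apply: contraNneq h => ->; rewrite mul0rn.
by move/(dhomogP _ _ _ hp) => /=; rewrite mdegD mdeg1 addn1 => -[].
Qed.

Lemma homog0_const p : p \is 0.-homog -> p = (p@_0%MM)%:MP.
Proof.
move=> hp; apply/mpolyP => m; rewrite mcoeffC.
have [->|m0] := eqVneq m 0%MM; first by rewrite mulr1.
by rewrite mulr0 (dhomog_nemf_coeff hp) // mdeg_eq0.
Qed.

Lemma homog1_linear_form p : p \is 1.-homog -> p = linear_form (\row_j p@_U_(j)).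
Proof.
move=> hp; apply/mpolyP => m; rewrite /linear_form linear_sum /=.
under eq_bigr => j _ do rewrite mcoeffZ mxE mcoeffX.
have [/eqP m1|m1] := eqVneq (mdeg m) 1%N.
  have /existsP[i /eqP ->] : [exists i, m == U_(i)%MM] by rewrite -mdeg_eq1.
  rewrite (bigD1 i) //= eqxx mulr1 big1 ?addr0 // => j /negPf ji.
  by rewrite eq_mnm1 ji mulr0.
rewrite (dhomog_nemf_coeff hp) // big1 // => j _.
have [jm|] := eqVneq U_(j)%MM m; last by rewrite mulr0.
by rewrite -jm mdeg1 eqxx in m1.
Qed.

End Derivations.

Section FullDegree.
Variables (K : fieldType) (l : nat).
Local Notation S := {mpoly K[l.+1]}.
Implicit Types (I : set S) (f g p : S).

Definition full I d := forall f, f \is d.-homog -> I f.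

Lemma full_mulX I d : ideal I ->
  (forall j f, f \is d.-homog -> I (f * 'X_j)) -> full I d.+1.
Proof.
move=> hI h f /homog_X_decomp [F hF ->].
by apply: ideal_sum => // j _; apply: h.
Qed.

Lemma fullS I d : ideal I -> full I d -> full I d.+1.
Proof.
move=> hI h; apply: full_mulX => // j f fh.
by apply: idealMl => //; apply: h.
Qed.

Lemma full_leq I d e : ideal I -> (d <= e)%N -> full I d -> full I e.
Proof.
move=> hI /subnKC <- h; elim: (e - d)%N => [|k IH]; first by rewrite addn0.
by rewrite addnS; apply: fullS.
Qed.

(** One variable is absorbed into a colon ideal at a time, which lowers [e]. *)
Lemma full_mul I d e : ideal I ->
  (forall f g, f \is d.-homog -> g \is e.-homog -> I (f * g)) -> full I (d + e).
Proof.
elim: e I => [|e IH] I hI h.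
  by rewrite addn0 => f fh; rewrite -[f]mulr1; apply: h => //; apply: dhomog1.
rewrite addnS; apply: full_mulX => // j f fh.
apply: (IH (colon I 'X_j)) => //; first exact: colon_ideal.
move=> p q ph qh; rewrite /colon -mulrA; apply: h => //.
by rewrite -(addn1 e); apply: dhomogM => //; rewrite dhomogX /= mdeg1.
Qed.

Lemma full_const I d : ideal I -> I 1 -> full I d.
Proof. by move=> hI I1 f _; rewrite -[f]mulr1; apply: idealMr. Qed.

End FullDegree.

(** * The Jacobian ideal and the derivations of an arrangement *)

Section Arrangement.
Variables (K : fieldType) (l : nat) (A : arrangement K l.+1).
Hypothesis charK : [pchar K] =i pred0.
Local Notation S := {mpoly K[l.+1]}.
Local Notation n := (arr_size A).
Local Notation al := (arr_form (a := A)).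
Local Notation Q := (defining_poly A).
Local Notation J := (jacobian_ideal A).
Local Notation der := (@derivation_apply K l.+1).
Implicit Types (f g : S) (v : 'rV[S]_l.+1) (s : seq 'rV[K]_l.+1).

Definition normal i : 'rV[K]_l.+1 := \row_j (al i)@_U_(j).

Lemma arr_formE i : al i = linear_form (normal i).
Proof. by apply: homog1_linear_form; apply: arr_form_homog. Qed.

Lemma defining_homog : Q \is n.-homog.
Proof.
have gen (r : seq 'I_n) : \prod_(i <- r) al i \is (size r).-homog.
  elim: r => [|i r IH]; first by rewrite big_nil dhomog1.
  by rewrite big_cons /= -(add1n (size r)); apply: dhomogM => //; apply: arr_form_homog.
by have := gen (enum 'I_n); rewrite big_enum size_enum_ord.
Qed.

Lemma defining_neq0 : Q != 0.
Proof. by apply/prodf_neq0 => i _; apply: arr_form_neq0. Qed.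

Lemma jacobian_is_ideal : ideal J. Proof. exact: ideal_gen_ideal. Qed.

Lemma jacobian_mem_partial j : J Q^`M(j).
Proof.
by apply: mem_ideal_gen; rewrite inE; apply/orP; right; apply: map_f; rewrite mem_enum.
Qed.

Lemma jacobian_mem_Q : J Q.
Proof. by apply: mem_ideal_gen; rewrite mem_head. Qed.

Lemma jacobian_mem_der v : J (der v Q).
Proof.
apply: ideal_sum jacobian_is_ideal _ => j _.
exact: (idealMr jacobian_is_ideal _ (jacobian_mem_partial j)).
Qed.

Lemma natr_neq0 m : (0 < m)%N -> m%:R != 0 :> K.
Proof. by move/pcharf0P: charK => -> ; rewrite -lt0n. Qed.

Lemma natr_mpoly m : m%:R = (m%:R)%:MP :> S.
Proof. by rewrite mpolyC_nat. Qed.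

Lemma der_euler_Q : der (@euler K l) Q = n%:R * Q.
Proof. exact: der_euler defining_homog. Qed.

(** Euler's identity with [n] invertible makes [Q] a combination of its partial derivatives. *)
Lemma jacobian_der f : (0 < n)%N -> J f -> exists v, f = der v Q.
Proof.
move=> n0; have hE : ideal (fun f => exists v, f = der v Q).
  split; first by exists 0; rewrite der0.
    by move=> _ _ [u ->] [v ->]; exists (u + v); rewrite derD.
  by move=> g _ [v ->]; exists (g *: v); rewrite derZ.
apply: (ideal_gen_sub hE) => p; rewrite inE => /predU1P[->|/mapP[j _ ->]].
  exists ((n%:R^-1)%:MP *: @euler K l); rewrite derZ der_euler_Q natr_mpoly mulrA.
  by rewrite -mpolyCM mulVf ?natr_neq0 // mpolyC1 mul1r.
by exists (delta_mx 0 j); rewrite der_delta.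
Qed.

Lemma jacobian_graded : graded J.
Proof.
apply: ideal_gen_graded => p; rewrite inE => /predU1P[->|/mapP[j _ ->]].
  by exists n; apply: defining_homog.
have := defining_homog; case: (n) => [h|m h]; last by exists m; apply: mderiv_homog.
by exists 0%N; rewrite (homog0_const h) mderivC; apply: dhomog0.
Qed.

Lemma jacobian_low f d : f \is d.-homog -> (d.+1 < n)%N -> J f -> f = 0.
Proof.
move=> fh ltd /jacobian_der[|v fE]; first by lia.
rewrite -(pihomog_dE fh) fE linear_sum big1 // => j _.
have hQ : Q^`M(j) \is n.-1.-homog.
  by apply: mderiv_homog; rewrite prednK ?defining_homog //; lia.
by rewrite /= (pihomogM_homog _ _ hQ) ifN // -ltnNge; lia.
Qed.

Definition cofactor_form i : S := \prod_(k | k != i) al k.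

Lemma defining_cofactor i : Q = al i * cofactor_form i.
Proof. by rewrite /defining_poly (bigD1 i). Qed.

Lemma mderiv_linear_form (a : 'rV[K]_l.+1) j : (linear_form a)^`M(j) = (a 0 j)%:MP.
Proof.
rewrite /linear_form linear_sum (bigD1 j) //= mderivZ mderivX mnm1E eqxx scale1r.
have -> : (U_(j) - U_(j) = 0 :> 'X_{1..l.+1})%MM.
  by apply/mnmP => i; rewrite mnmBE subnn mnm0E.
rewrite mpolyX0 alg_mpolyC big1 ?addr0 // => k /negPf kj.
by rewrite mderivZ mderivX mnm1E kj scale0r scaler0.
Qed.

Lemma partial_defining j : Q^`M(j) = \sum_i (normal i 0 j)%:MP * cofactor_form i.
Proof.
rewrite -der_delta der_prod; apply: eq_bigr => i _.
by rewrite der_delta arr_formE mderiv_linear_form.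
Qed.

Lemma normal_neq0 i : normal i != 0.
Proof.
apply: contraNneq (arr_form_neq0 (a := A) i) => e.
by rewrite arr_formE e linear0.
Qed.

(* [Q] divides the product for [i != j]; the squares follow from the partial
   derivatives of [Q], which are combinations of the cofactors. *)
Lemma cofactor_mul_mem i j : J (cofactor_form i * cofactor_form j).
Proof.
have hJ := jacobian_is_ideal.
have off i' j' : i' != j' -> J (cofactor_form i' * cofactor_form j').
  move=> ij; rewrite {1}/cofactor_form (bigD1 j') 1?eq_sym //=.
  rewrite mulrAC -defining_cofactor mulrC.
  exact: (idealMr hJ _ jacobian_mem_Q).
have [<-|ij] := eqVneq i j; last exact: off.
have /rV0Pn[q nq] := normal_neq0 i.
have : J (cofactor_form i * Q^`M(q)).
  exact: (idealMr hJ _ (jacobian_mem_partial q)).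
rewrite partial_defining (bigD1 i) //= mulrDr => h.
have {h} : J (cofactor_form i * ((normal i 0 q)%:MP * cofactor_form i)).
  rewrite -[X in J X](addrK (cofactor_form i * \sum_(k | k != i) (normal k 0 q)%:MP * cofactor_form k)).
  apply: (idealB hJ h); rewrite mulr_sumr; apply: ideal_sum hJ _ => k ki.
  rewrite mulrCA; apply: (idealMr jacobian_is_ideal).
  by apply: off; rewrite eq_sym.
move=> h; have := idealZ hJ (normal i 0 q)^-1 h.
by rewrite mulrCA mul_mpolyC scalerA mulVf // scale1r.
Qed.

Lemma normal_indep i j : i != j -> ~ exists c : K, normal i = c *: normal j.
Proof.
move=> /eqP ij [c ic]; apply: ij; apply: (arr_hyperplane_inj (a := A)).
have c0 : c != 0.
  by apply: contraNneq (normal_neq0 i) => c0; rewrite ic c0 scale0r.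
apply/seteqP; split=> v /=; rewrite /hyperplane /= !arr_formE ic linearZ mevalZ.
  by move/eqP; rewrite mulf_eq0 (negPf c0) => /eqP.
by move=> ->; rewrite mulr0.
Qed.

Lemma arr_form_nmem i j : i != j -> ~ lin [:: normal j] (al i).
Proof.
move=> ij; rewrite /lin /= => /ideal_gen1[g gE].
have hj : linear_form (normal j) \is 1.-homog by apply: linear_form_homog.
have h1 : adjoin (fun f : S => f = 0) (linear_form (normal j)) (al i).
  by exists g; rewrite gE subrr.
have z0 : ideal (fun f : S => f = 0).
  by split=> // [f h -> ->|h f ->]; rewrite ?addr0 ?mulr0.
have gz : graded (fun f : S => f = 0) by move=> f d ->; apply: linear0.
have [|c ch /eqP] := adjoin_homog (d := 0) z0 gz hj _ h1; first exact: arr_form_homog.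
rewrite subr_eq0 (homog0_const ch) mul_mpolyC arr_formE -linearZ => /eqP e.
apply: (normal_indep ij); exists (c@_0); apply/rowP => k.
have := congr1 (mderiv k) e; rewrite !mderiv_linear_form => /eqP.
by rewrite mpolyC_eq => /eqP.
Qed.

Lemma arr_gen1 j f : ideal_gen [:: al j] f = lin [:: normal j] f.
Proof. by rewrite /lin /= -arr_formE. Qed.

Lemma cofactor_nmem j : ~ lin [:: normal j] (cofactor_form j).
Proof.
have h1 : ~ lin [:: normal j] 1.
  move=> /ideal_gen1[g] /(congr1 (meval ((0 : 'rV[K]_l.+1) 0))).
  rewrite meval1 mevalM meval_linear_form [X in _ * X]big1 ?mulr0.
    by move/eqP; rewrite oner_eq0.
  by move=> i _; rewrite [X in _ * X]mxE mulr0.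
rewrite /cofactor_form; elim/big_ind: _ => // [f g hf hg|i ij].
  by case/lin_prime.
exact: arr_form_nmem.
Qed.

(** The product rule for [al j] times its cofactor shows that [al j] divides [der v (al j)] times
    the cofactor; [al j] is prime and does not divide the cofactor. *)
Lemma kernel_in_derivations v : der v Q = 0 -> derivation_module A v.
Proof.
move=> v0 j /=; rewrite arr_gen1.
have : lin [:: normal j] (der v (al j) * cofactor_form j).
  have -> : der v (al j) * cofactor_form j = - (der v (cofactor_form j) * al j).
    apply/eqP; rewrite -addr_eq0 [der v (cofactor_form j) * _]mulrC -der_mul.
    by rewrite -defining_cofactor v0.
  apply: (idealN (lin_ideal _)); apply: (idealMr (lin_ideal _)).
  by rewrite arr_formE; apply: lin_mem; rewrite mem_head.
by case/lin_prime => // /cofactor_nmem.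
Qed.

Lemma derivations_log v : derivation_module A v -> exists g, der v Q = g * Q.
Proof.
move=> hv; have /choice[c hc] i : exists c, der v (al i) = c * al i.
  by have /ideal_gen1 := hv i.
exists (\sum_i c i); rewrite /defining_poly der_prod mulr_suml.
by apply: eq_bigr => i _; rewrite hc -mulrA -defining_cofactor.
Qed.

Lemma derivation_moduleD u v : derivation_module A u -> derivation_module A v ->
  derivation_module A (u + v).
Proof. by move=> hu hv j; rewrite derD; apply: (idealD (ideal_gen_ideal _)). Qed.

Lemma derivation_moduleZ f v : derivation_module A v -> derivation_module A (f *: v).
Proof. by move=> hv j; rewrite derZ; apply: (idealMr (ideal_gen_ideal _)). Qed.

Lemma derivation_module_sum (T : Type) (r : seq T) (P : pred T) (F : T -> 'rV[S]_l.+1) :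
  (forall i, P i -> derivation_module A (F i)) ->
  derivation_module A (\sum_(i <- r | P i) F i).
Proof.
move=> h; elim/big_ind: _ => //; last exact: derivation_moduleD.
by move=> j; rewrite der0; apply: (ideal0 (ideal_gen_ideal _)).
Qed.

Lemma euler_in_derivations : derivation_module A (@euler K l).
Proof.
move=> j; rewrite (der_euler (arr_form_homog (a := A) j)) mul1r.
by apply/ideal_gen1; exists 1; rewrite mul1r.
Qed.

Lemma Q_in_derivations v : derivation_module A (Q *: v).
Proof.
move=> j; rewrite derZ (defining_cofactor j) -mulrA mulrC.
by apply/ideal_gen1; exists (cofactor_form j * der v (al j)).
Qed.

(** The subspace cut out by [s] meets the intersection of any two hyperplanes in the origin only,
    phrased through the variables. *)
Definition pairwise_transversal s := forall i j : 'I_n, i != j -> forall q,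
  adjoin (adjoin (lin s) (al i)) (al j) 'X_q.

(** * Finite colength of the Jacobian ideal modulo linear forms *)

Section FiniteColength.
Variable s : seq 'rV[K]_l.+1.
Hypothesis trans : pairwise_transversal s.

(** Modulo [(s, al k)] each variable is a multiple of each other [al i], so the factors of a
    monomial can be traded one by one for those of the product. *)
Lemma prod_others_full k (r : seq 'I_n) : k \notin r ->
  full (adjoin (adjoin (lin s) (al k)) (\prod_(i <- r) al i)) (size r).
Proof.
have hk : ideal (adjoin (lin s) (al k)) by apply/adjoin_ideal/lin_ideal.
elim: r => [|i r IH] kr.
  by apply: full_const; [apply: adjoin_ideal | rewrite big_nil; apply: adjoin_id].
move: kr; rewrite inE negb_or => /andP[ki /IH {}IH].
have hI := adjoin_ideal (\prod_(i <- i :: r) al i) hk.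
apply: (full_mulX hI) => q f /IH[h Ih]; have [c Ic] := trans ki q.
rewrite big_cons in hI *; exists (h * c).
set P := \prod_(i <- r) al i in Ih *.
have -> : f * 'X_q - h * c * (al i * P) = (f - h * P) * 'X_q + ('X_q - c * al i) * (h * P).
  by ring.
by apply: (idealD hk); apply: (idealMl hk).
Qed.

Lemma cofactors_full (r : seq 'I_n) : uniq r -> r != [::] -> exists N,
  full (addgen (lin s) [seq \prod_(k <- r | k != i) al k | i <- r]) N.
Proof.
have hs := lin_ideal s.
elim: r => [//|k r IH] /= /andP[kr ur] _.
have [->|r0] := eqVneq r [::].
  exists 0%N; apply: full_const; first exact: addgen_ideal.
  by apply: addgen_mem; rewrite //= big_cons big_nil eqxx mem_head.
have [N IHN] := IH ur r0; exists (N + size r)%N => f fh.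
set B := addgen _ _; have hB : ideal B by apply: addgen_ideal.
have Pk : \prod_(i <- k :: r | i != k) al i = \prod_(i <- r) al i.
  rewrite big_cons eqxx /= big_seq_cond [RHS]big_seq; apply: eq_bigl => i.
  by case: (boolP (i \in r)) => //= ir; apply: contraNneq kr => <-.
have BP : B (\prod_(i <- r) al i).
  by apply: addgen_mem => //=; rewrite Pk mem_head.
have Bk g : addgen (lin s) [seq \prod_(k <- r | k != i) al k | i <- r] g -> B (al k * g).
  move=> Ig; have hC : ideal (colon B (al k)) by apply: colon_ideal.
  rewrite mulrC; apply: (addgen_sub hC) Ig => [h hh|p /mapP[i ir ->]].
    by rewrite /colon mulrC; apply: (idealMr hB); apply: addgenl.
  rewrite /colon; apply: addgen_mem => //; rewrite inE; apply/orP; right.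
  apply/mapP; exists i => //; rewrite big_cons ifT 1?mulrC //.
  by apply: contraNneq kr => ->.
have hadj : ideal (adjoin (lin s) (al k)) by apply: adjoin_ideal.
have gadj : graded (adjoin (lin s) (al k)).
  by apply: adjoin_graded => //; [apply: lin_graded | exists 1%N; apply: arr_form_homog].
have Ph : \prod_(i <- r) al i \is (size r).-homog.
  elim: (r) => [|i t IHt]; first by rewrite big_nil dhomog1.
  by rewrite big_cons /= -(add1n (size t)); apply: dhomogM => //; apply: arr_form_homog.
have fullk : full (adjoin (adjoin (lin s) (al k)) (\prod_(i <- r) al i)) (N + size r).
  by apply: (full_leq (adjoin_ideal _ hadj) (leq_addl N (size r))); apply: prod_others_full.
have [g gh Ig] := adjoin_homogr hadj gadj Ph fh (fullk f fh).
set f' := f - _ in gh Ig.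
have szr : (0 < size r)%N by rewrite lt0n size_eq0.
have eN : (N + (size r).-1 + 1 = N + size r)%N by lia.
have [|c ch Ic] := adjoin_homog (d := (N + (size r).-1)%N) hs (lin_graded (s := s))
    (arr_form_homog (a := A) k) _ Ig; first by rewrite eN.
apply: (idealBK hB (g := g * \prod_(i <- r) al i)); last exact: (idealMr hB).
apply: (idealBK hB (g := al k * c)).
  by apply: addgenl; rewrite [al k * c]mulrC.
apply: Bk; have hG := addgen_ideal [seq \prod_(k <- r | k != i) al k | i <- r] hs.
exact: (full_leq hG (leq_addr _ _) IHN ch).
Qed.

(** If the cofactors and [s] fill degree [N], then [J] and [s] fill degree [2N], because [J]
    contains all products of two cofactors. *)
Lemma jacobian_finite_colength : (0 < n)%N -> exists N, full (addgen J (lfs s)) N.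
Proof.
move=> n0; have [||N hN] := @cofactors_full (enum 'I_n); first exact: enum_uniq.
  by rewrite -size_eq0 size_enum_ord -lt0n.
exists (N + N)%N; have hJ := jacobian_is_ideal; have hI := addgen_ideal (lfs s) hJ.
apply: (full_mul hI) => f g /hN If /hN Ig {hN}.
have sub p : lin s p -> addgen J (lfs s) p by apply: addgenr.
have cof p : p \in [seq \prod_(k <- enum 'I_n | k != i) al k | i <- enum 'I_n] ->
    exists i, p = cofactor_form i.
  by case/mapP => i _ ->; exists i; rewrite big_enum_cond.
have hC p : ideal (colon (addgen J (lfs s)) p) by apply: colon_ideal.
apply: (addgen_sub (hC g)) If => [p /sub Ip|p /cof[i ->]].
  by apply: (idealMl hI).
rewrite /colon mulrC.
apply: (addgen_sub (hC (cofactor_form i))) Ig => [q /sub Iq|q /cof[j ->]].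
  by apply: (idealMl hI).
by apply: addgenl; apply: cofactor_mul_mem.
Qed.

End FiniteColength.

End Arrangement.

(** * Free arrangements have a regular generic section *)

Lemma subrBB (V : zmodType) (p q t : V) : p - q - (p - t) = t - q.
Proof. by rewrite opprB addrC addrA subrK. Qed.

Section FreeImpliesRegular.
Variables (K : fieldType) (l : nat) (A : arrangement K l.+1).
Hypothesis charK : [pchar K] =i pred0.
Local Notation S := {mpoly K[l.+1]}.
Local Notation n := (arr_size A).
Local Notation al := (arr_form (a := A)).
Local Notation Q := (defining_poly A).
Local Notation J := (jacobian_ideal A).
Local Notation der := (@derivation_apply K l.+1).
Implicit Types (f g : S) (v w d : 'rV[S]_l.+1).

Definition vlin (s : seq 'rV[K]_l.+1) v := forall k, lin s (v 0 k).

Lemma vlinD s v w : vlin s v -> vlin s w -> vlin s (v + w).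
Proof. by move=> hv hw k; rewrite mxE; apply: (idealD (lin_ideal s)). Qed.

Lemma vlinB s v w : vlin s v -> vlin s w -> vlin s (v - w).
Proof. by move=> hv hw k; rewrite !mxE; apply: (idealB (lin_ideal s)). Qed.

Lemma vlinZ s f v : vlin s v -> vlin s (f *: v).
Proof. by move=> hv k; rewrite mxE; apply: (idealMr (lin_ideal s)). Qed.

Lemma vlinZl s f v : lin s f -> vlin s (f *: v).
Proof. by move=> hf k; rewrite mxE; apply: (idealMl (lin_ideal s)). Qed.

Lemma vlin_sum s m (F : 'I_m -> 'rV[S]_l.+1) :
  (forall i, vlin s (F i)) -> vlin s (\sum_i F i).
Proof.
by move=> h k; rewrite summxE; apply: ideal_sum (lin_ideal s) _ => i _; apply: h.
Qed.

Lemma vlin_der s v : vlin s v -> lin s (der v Q).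
Proof.
by move=> hv; apply: ideal_sum (lin_ideal s) _ => i _; apply: (idealMl (lin_ideal s)).
Qed.

Lemma vlin_regular s p v : regular (lin s) p -> vlin s (p *: v) -> vlin s v.
Proof. by move=> hp hv k; apply: hp; have := hv k; rewrite mxE mulrC. Qed.

Variables (s : seq 'rV[K]_l.+1) (i1 i2 : 'I_n).
Hypothesis trans : pairwise_transversal A s.
Hypothesis al_notin : forall i, ~ lin s (al i).
Hypothesis al2_notin : ~ lin (rcons s (normal i1)) (al i2).

Lemma Q_notin : ~ lin s Q.
Proof.
suff prime_prod (r : seq 'I_n) : ~ lin s (\prod_(i <- r) al i).
  by have := prime_prod (enum 'I_n); rewrite big_enum.
elim: r => [|i r IH]; last by rewrite big_cons => /lin_prime[/al_notin|].
rewrite big_nil => h1; apply: (al_notin (i := i1)); rewrite -[al i1]mulr1.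
exact: (idealMr (lin_ideal s)).
Qed.

Variables (r : nat) (b : 'I_r -> 'rV[S]_l.+1).
Hypothesis bD : forall i, derivation_module A (b i).
Hypothesis bfree : forall v, derivation_module A v ->
  exists! c : 'rV[S]_r, v = \sum_i c 0 i *: b i.

(** A basis of [D(A)] stays independent modulo [(s)]. Since [D(A)] contains [Q S^l], uniqueness of
    coordinates yields a matrix [C] whose product with the basis is [Q] times the identity, and [Q]
    is a nonzerodivisor modulo the prime [(s)]. *)
Lemma basis_mod_linear_inj (u : 'I_r -> S) :
  vlin s (\sum_i u i *: b i) -> forall i, lin s (u i).
Proof.
have /choice[C hC] (k : 'I_l.+1) : exists c : 'rV[S]_r,
    Q *: delta_mx 0 k = \sum_i c 0 i *: b i.
  by have [c [e _]] := bfree (Q_in_derivations (delta_mx 0 k)); exists c.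
have QC i j : \sum_k b i 0 k * C k 0 j = (i == j)%:R * Q.
  have bi : derivation_module A (Q *: b i) by apply: derivation_moduleZ.
  have [c [_ cu]] := bfree bi.
  have e1 : c = \row_j \sum_k b i 0 k * C k 0 j.
    apply: cu; rewrite {1}[b i]row_sum_delta scaler_sumr.
    under [RHS]eq_bigr => q _ do rewrite mxE scaler_suml.
    rewrite exchange_big; apply: eq_bigr => k _ /=.
    rewrite scalerA mulrC -scalerA hC scaler_sumr; apply: eq_bigr => q _.
    by rewrite scalerA.
  have e2 : c = \row_j ((i == j)%:R * Q).
    apply: cu; rewrite (bigD1 i) //= mxE eqxx mul1r big1 ?addr0 // => q qi.
    by rewrite mxE eq_sym (negPf qi) mul0r scale0r.
  by have /rowP/(_ j) : \row_j \sum_k b i 0 k * C k 0 j = \row_j ((i == j)%:R * Q);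
    [rewrite -e1 | rewrite !mxE].
move=> hu j; have : lin s (u j * Q).
  have -> : u j * Q = \sum_k (\sum_i u i *: b i) 0 k * C k 0 j.
    under eq_bigr => k _ do rewrite summxE mulr_suml.
    rewrite exchange_big (bigD1 j) //= [X in _ + X]big1 ?addr0.
      under eq_bigr => k _ do rewrite mxE -mulrA.
      by rewrite -mulr_sumr QC eqxx mul1r.
    move=> i ij; under eq_bigr => k _ do rewrite mxE -mulrA.
    by rewrite -mulr_sumr QC (negPf ij) mul0r mulr0.
  by apply: ideal_sum (lin_ideal s) _ => k _; apply: (idealMl (lin_ideal s)).
by case/lin_prime => // /Q_notin.
Qed.

(** Membership in [D0 + (s) S^l]. *)
Definition near_kernel v := exists2 d, der d Q = 0 & vlin s (v - d).

(** In coordinates, [al i1 v = d] and [al i2 v = d'] modulo [(s)] give [al i2 w = al i1 w']. As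
    [al i2] is a nonzerodivisor modulo [(s, al i1)], each [w] is [al i1] times some [w''], and these
    are the coordinates of [v] modulo [(s)]. *)
Lemma near_kernel_colon v :
  near_kernel (al i1 *: v) -> near_kernel (al i2 *: v) -> near_kernel v.
Proof.
move=> [d dQ hd] [d' d'Q hd'].
have n0 : (0 < n)%N by apply: leq_trans (ltn_ord i1).
have [w [dE _]] := bfree (kernel_in_derivations dQ).
have [w' [d'E _]] := bfree (kernel_in_derivations d'Q).
have hw i : lin s (al i2 * w 0 i - al i1 * w' 0 i).
  apply: (basis_mod_linear_inj (u := fun i => al i2 * w 0 i - al i1 * w' 0 i)).
  have -> : \sum_i (al i2 * w 0 i - al i1 * w' 0 i) *: b i =
      al i1 *: (al i2 *: v - d') - al i2 *: (al i1 *: v - d).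
    rewrite !scalerBr !scalerA [al i1 * al i2]mulrC subrBB dE d'E.
    under eq_bigr => j _ do rewrite scalerBl -!scalerA.
    by rewrite sumrB -!scaler_sumr.
  by apply: vlinB; apply: vlinZ.
have /choice[w'' hw''] i : exists c, lin s (w 0 i - c * al i1).
  have : lin (rcons s (normal i1)) (w 0 i * al i2).
    rewrite lin_rcons -arr_formE; exists (w' 0 i).
    by rewrite mulrC [w' 0 i * _]mulrC.
  case/lin_prime => [|/al2_notin //].
  by rewrite lin_rcons -arr_formE.
pose d2 := \sum_i w'' i *: b i.
have hd2 : vlin s (v - d2).
  apply: (@vlin_regular s (al i1)).
    by move=> f /lin_prime[//|/al_notin].
  have -> : al i1 *: (v - d2) = (al i1 *: v - d) +
      \sum_i (w 0 i - w'' i * al i1) *: b i.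
    under eq_bigr => i _ do rewrite scalerBl.
    rewrite sumrB -dE addrA subrK scalerBr; congr (_ - _).
    by rewrite scaler_sumr; apply: eq_bigr => i _; rewrite scalerA mulrC.
  by apply: vlinD => //; apply: vlin_sum => i; apply: vlinZl.
have Dd2 : derivation_module A d2.
  by apply: derivation_module_sum => i _; apply: derivation_moduleZ.
(* So far [d2] is in [D(A)] only. Its multiplier [g] turns out to be in [(s)], so correcting by
   [g / n] times the Euler derivation reaches [D0] without leaving the class modulo [(s)]. *)
have [g gE] := derivations_log Dd2.
have lg : lin s g.
  have : lin s (al i1 * (g * Q)).
    have -> : al i1 * (g * Q) = der (al i1 *: d2 - d) Q.
      by rewrite derB derZ gE dQ subr0.
    apply: vlin_der.
    have -> : al i1 *: d2 - d = (al i1 *: v - d) - al i1 *: (v - d2).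
      by rewrite scalerBr subrBB.
    by apply: vlinB => //; apply: vlinZ.
  by case/lin_prime => [/al_notin //|/lin_prime[//|/Q_notin]].
have nK := natr_neq0 charK n0.
exists (d2 - ((n%:R^-1)%:MP * g) *: @euler K l).
  rewrite derB gE derZ der_euler_Q natr_mpoly mulrA [_ * g * _]mulrAC -mpolyCM mulVf //.
  by rewrite mpolyC1 mul1r subrr.
rewrite opprB addrA addrAC; apply: vlinD => //; apply: vlinZl.
exact: (idealMr (lin_ideal s)).
Qed.

Lemma near_kernel0 v : vlin s v -> near_kernel v.
Proof. by move=> hv; exists 0; rewrite ?der0 ?subr0. Qed.

Lemma near_kernelD v w : near_kernel v -> near_kernel w -> near_kernel (v + w).
Proof.
move=> [d dQ hd] [d' d'Q hd']; exists (d + d'); first by rewrite derD dQ d'Q addr0.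
by rewrite opprD addrACA; apply: vlinD.
Qed.

Lemma kernel_lift v : lin s (der v Q) -> near_kernel v.
Proof.
move=> hv; have n0 : (0 < n)%N by apply: leq_trans (ltn_ord i1).
have [N hN] := jacobian_finite_colength trans n0.
have : forall f, f \is N.-homog -> near_kernel (f *: v).
  move=> f /hN [g [h [/(jacobian_der charK n0) [c gE] lh ->]]].
  rewrite scalerDl; apply: near_kernelD; last by apply/near_kernel0/vlinZl.
  (* The Koszul syzygy of [v] and [c]. *)
  exists (der c Q *: v - der v Q *: c); first by rewrite derB !derZ mulrC subrr.
  by rewrite -gE opprB addrC subrK; apply: vlinZl.
(* A form of degree [N] times either linear form has degree [N+1]; each division thus lowers the
   degree, down to [f = 1]. *)
elim: N {hN} => [|N IH] hN; first by rewrite -[v]scale1r; apply: hN; apply: dhomog1.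
apply: (IH) => f fh; apply: near_kernel_colon; rewrite scalerA mulrC;
  apply: hN; rewrite -(addn1 N); apply: dhomogM => //; exact: arr_form_homog.
Qed.

End FreeImpliesRegular.

(** If [f z = der v Q] modulo [(s)], then [v] lifts to [D0] modulo [(s, z)], that is, [v = d + z w]
    modulo [(s)] with [d] killing [Q]. Hence [f z = z (der w Q)] modulo [(s)], and [z] cancels. *)
Lemma free_regular (K : fieldType) (l : nat) (A : arrangement K l.+1)
    (charK : [pchar K] =i pred0) (s : seq 'rV[K]_l.+1) (z : 'rV[K]_l.+1)
    (i1 i2 : 'I_(arr_size A)) :
  free_arrangement A -> pairwise_transversal A (rcons s z) ->
  (forall i, ~ lin (rcons s z) (arr_form (a := A) i)) ->
  ~ lin (rcons (rcons s z) (normal i1)) (arr_form (a := A) i2) ->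
  regular (lin s) (linear_form z) ->
  regular (addgen (jacobian_ideal A) (lfs s)) (linear_form z).
Proof.
move=> [r [b [bD bfree]]] trans nin nin2 regz f [g [h [Jg lh fzE]]].
set Q := defining_poly A.
have n0 : (0 < arr_size A)%N by apply: leq_trans (ltn_ord i1).
have [v gE] := jacobian_der charK n0 Jg.
have hs := lin_ideal s.
have lv : lin (rcons s z) (derivation_apply v Q).
  rewrite lin_rcons; exists f; rewrite -gE fzE opprD addrA subrr sub0r.
  exact: (idealN hs).
have [d dQ hd] := kernel_lift charK trans nin nin2 bD bfree lv.
have /choice[w' hw'] k : exists c, lin s ((v - d) 0 k - c * linear_form z).
  by have := hd k; rewrite lin_rcons.
pose w := \row_k w' k.
have hw : vlin s (v - d - linear_form z *: w).
  by move=> k; have := hw' k; rewrite !mxE [w' k * _]mulrC.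
have lfw : lin s (f - derivation_apply w Q).
  apply: regz; have -> : (f - derivation_apply w Q) * linear_form z =
      h + derivation_apply (v - d - linear_form z *: w) Q.
    by rewrite !derB derZ dQ subr0 -gE mulrBl fzE; ring.
  by apply: (idealD hs) => //; apply: vlin_der.
exists (derivation_apply w Q), (f - derivation_apply w Q); split=> //.
  exact: jacobian_mem_der.
by rewrite addrC subrK.
Qed.

(** * Regular sequences and freeness *)

(** Fraction-free elimination: a pivot in the first column clears that column at the price of
    scaling the other rows. *)
Lemma dependent_rows (R : idomainType) m r (B : 'I_r -> 'I_m -> R) : (m < r)%N ->
  exists2 c : 'I_r -> R, (exists j, c j != 0) & forall k, \sum_j c j * B j k = 0.
Proof.
elim: m r B => [|m IH] [//|r] B ltmr.
  by exists (fun=> 1); [exists ord0; apply: oner_neq0 | case].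
have [[p pn0]|none] := pselect (exists p, B p ord0 != 0).
  have [c' [j' cj'] c'0] := IH r (fun j k => B p ord0 * B (lift p j) (lift ord0 k) -
    B (lift p j) ord0 * B p (lift ord0 k)) ltmr.
  exists (fun j => if unlift p j is Some i then c' i * B p ord0
                   else - \sum_i c' i * B (lift p i) ord0).
    by exists (lift p j'); rewrite liftK mulf_neq0.
  move=> k; rewrite (bigD1_ord p) //= unlift_none.
  rewrite [X in _ + X](eq_bigr (fun i => c' i * B p ord0 * B (lift p i) k)); last first.
    by move=> i _; rewrite liftK.
  rewrite mulNr mulr_suml addrC -sumrB; case: (unliftP ord0 k) => [k' ->|->].
    by rewrite -[RHS](c'0 k'); apply: eq_bigr => j _; ring.
  by rewrite big1 // => j _; ring.
have [|c cn0 hc] := IH r.+1 (fun j k => B j (lift ord0 k)); first exact: ltnW.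
exists c => // k; case: (unliftP ord0 k) => [k' ->|->]; first exact: hc.
rewrite big1 // => j _; have [->|bj] := eqVneq (B j ord0) 0; first by rewrite mulr0.
by case: none; exists j.
Qed.

Section RegularImpliesFree.
Variables (K : fieldType) (l : nat) (A : arrangement K l.+1).
Hypothesis charK : [pchar K] =i pred0.
Hypothesis n0 : (0 < arr_size A)%N.
Local Notation S := {mpoly K[l.+1]}.
Local Notation n := (arr_size A).
Local Notation Q := (defining_poly A).
Local Notation J := (jacobian_ideal A).
Local Notation der := (@derivation_apply K l.+1).
Implicit Types (f g : S) (v : 'rV[S]_l.+1).

Variables (s : seq 'rV[K]_l.+1) (w : nat -> 'rV[K]_l.+1).
Hypothesis sizes : size s = l.+1.
Hypothesis dual : dual_basis s w.
Local Notation z i := (linear_form s`_i).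
Local Notation L i := (lin (take i s)).
Hypothesis reg : forall i, (i < l.-1)%N -> regular (addgen J (lfs (take i s))) (z i).

Let hJ := jacobian_is_ideal A.
Let hL i := lin_ideal (take i s).

(** [J] meets [(z_0, ..., z_(j-1))] in the product of the two ideals, that is, the first Tor of
    [S/J] vanishes. There are [l+1] variables, so [l.-1] is the length of the regular sequence, two
    less than their number. *)
Lemma jacobian_cap_lin j f : (j <= l.-1)%N -> J f -> L j f ->
  exists2 g : nat -> S, (forall a, J (g a)) & f = \sum_(a < j) g a * z a.
Proof.
elim: j f => [|j IH] f lej Jf.
  rewrite take0 => -[c ->]; exists (fun=> 0); first by move=> _; apply: (ideal0 hJ).
  by rewrite !big_ord0.
have ltj : (j < size s)%N by rewrite sizes; lia.
rewrite lin_takeS // => -[r Lr].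
have [g [h [Jg Lh rE]]] : addgen J (lfs (take j s)) r.
  apply: reg => //; have hI := addgen_ideal (lfs (take j s)) hJ.
  apply: (idealBKl hI (f := f)); last exact: addgenl.
  exact: addgenr.
have [|||g' Jg' fE] := IH (f - g * z j); first exact: ltnW.
- by apply: (idealB hJ) => //; apply: (idealMl hJ).
- have -> : f - g * z j = (f - r * z j) + h * z j by rewrite rE; ring.
  by apply: (idealD (hL j)) => //; apply: (idealMl (hL j)).
exists (fun a => if a == j then g else g' a); first by move=> a; case: ifP.
rewrite big_ord_recr /= eqxx -[LHS](subrK (g * z j)) fE; congr (_ + _).
by apply: eq_bigr => a _; rewrite ltn_eqF.
Qed.

(** The submodule [(z_0, ..., z_(i-1)) D0]. *)
Definition kernel_multiple i v := exists2 V : nat -> 'rV[S]_l.+1,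
  (forall a, der (V a) Q = 0) & v = \sum_(a < i) z a *: V a.

(* Vanishing of the first Tor of [J] and [S/(z_0, ..., z_(i-1))]. *)
Lemma kernel_cap_vlin i v : (i <= l)%N -> der v Q = 0 -> vlin (take i s) v ->
  kernel_multiple i v.
Proof.
elim: i v => [|i IH] v lei vQ vL.
  exists (fun=> 0); first by move=> a; apply: der0.
  rewrite big_ord0; apply/rowP => k; rewrite mxE; have := vL k.
  by rewrite take0 => -[c ->]; rewrite big_ord0.
have lti : (i < size s)%N by rewrite sizes; lia.
have /choice[u_ hu] k : exists c, L i (v 0 k - c * z i).
  by have := vL k; rewrite lin_takeS.
pose u := \row_k u_ k.
have hv' : vlin (take i s) (v - z i *: u).
  by move=> k; rewrite !mxE [z i * _]mulrC.
have Lp : L i (der u Q).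
  apply: (lin_take_regular dual lti).
  have -> : der u Q * z i = - der (v - z i *: u) Q by rewrite derB derZ vQ; ring.
  by apply: (idealN (hL i)); apply: vlin_der.
have [|g Jg gE] := jacobian_cap_lin (j := i) _ (jacobian_mem_der A u) Lp; first by lia.
have /choice[W hW] a := jacobian_der charK n0 (Jg a).
(* The value of [u] on [Q] is a combination of earlier [z a] with coefficients in [J], so
   subtracting preimages of these coefficients lands in [D0]. *)
pose u' := u - \sum_(a < i) z a *: W a.
have u'Q : der u' Q = 0.
  rewrite derB gE der_sum -sumrB big1 // => a _.
  by rewrite derZ -hW mulrC subrr.
have [|||V VQ VE] := IH (v - z i *: u'); first exact: ltnW.
- by rewrite derB derZ vQ u'Q mulr0 subrr.
- have -> : v - z i *: u' = (v - z i *: u) + z i *: \sum_(a < i) z a *: W a.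
    by rewrite /u' scalerBr opprB addrA addrAC.
  apply: vlinD => //; apply: vlinZ; apply: vlin_sum => a; apply: vlinZl.
  apply: lin_mem; rewrite -(nth_take 0 (ltn_ord a)); apply: mem_nth.
  by rewrite size_take lti.
exists (fun a => if a == i then u' else V a); first by move=> a; case: ifP.
rewrite big_ord_recr /= eqxx -[LHS](subrK (z i *: u')) VE; congr (_ + _).
by apply: eq_bigr => a _; rewrite ltn_eqF.
Qed.

Lemma kernel_multiple_vlin i v : kernel_multiple i v -> vlin (take i s) v.
Proof.
move=> [V VQ ->]; have [lei|gti] := leqP i (size s).
  apply: vlin_sum => a; apply: vlinZl.
  apply: lin_mem; rewrite -(nth_take 0 (ltn_ord a)); apply: mem_nth.
  by rewrite size_takel.
apply: vlin_sum => a; apply: vlinZl; have [lta|gea] := ltnP a (size s).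
  by apply: lin_mem; rewrite take_oversize ?mem_nth // ltnW.
by rewrite nth_default // linear0; apply: (ideal0 (hL i)).
Qed.

Lemma kernel_multipleD i u v : kernel_multiple i u -> kernel_multiple i v ->
  kernel_multiple i (u + v).
Proof.
move=> [U UQ ->] [V VQ ->]; exists (fun a => U a + V a).
  by move=> a; rewrite derD UQ VQ addr0.
by rewrite -big_split; apply: eq_bigr => a _; rewrite scalerDr.
Qed.

Lemma kernel_multipleZ i f v : kernel_multiple i v -> kernel_multiple i (f *: v).
Proof.
move=> [V VQ ->]; exists (fun a => f *: V a); first by move=> a; rewrite derZ VQ mulr0.
by rewrite scaler_sumr; apply: eq_bigr => a _; rewrite !scalerA mulrC.
Qed.

Lemma kernel_multipleB i u v : kernel_multiple i u -> kernel_multiple i v ->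
  kernel_multiple i (u - v).
Proof.
by move=> hu hv; rewrite -scaleN1r; apply: kernel_multipleD => //; apply: kernel_multipleZ.
Qed.

Lemma kernel_multiple_sum i m (F : 'I_m -> 'rV[S]_l.+1) :
  (forall j, kernel_multiple i (F j)) -> kernel_multiple i (\sum_j F j).
Proof.
move=> h; elim/big_ind: _ => //; last exact: kernel_multipleD.
exists (fun=> 0); first by move=> a; apply: der0.
by rewrite big1 // => a _; rewrite scaler0.
Qed.

Lemma kernel_multipleZl i e v : (i <= l.+1)%N -> L i e -> der v Q = 0 ->
  kernel_multiple i (e *: v).
Proof.
move=> lei [c ->] vQ; have si : size (lfs (take i s)) = i.
  by rewrite size_map size_takel // sizes.
rewrite scaler_suml; apply: kernel_multiple_sum => j.
have ltj : (j < i)%N by have := ltn_ord j; rewrite [X in (_ < X)%N]si.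
exists (fun a : nat => (a == j :> nat)%:R *: (c j *: v)).
  by move=> a; rewrite !derZ vQ !mulr0.
rewrite (bigD1 (Ordinal ltj)) //= eqxx scale1r big1 ?addr0; last first.
  move=> a; rewrite -(inj_eq val_inj) /= => /negPf ->.
  by rewrite scale0r scaler0.
rewrite scalerA mulrC (nth_map 0) ?nth_take //.
by rewrite size_takel ?sizes.
Qed.

Lemma kernel_multipleW i v : kernel_multiple i v -> kernel_multiple i.+1 v.
Proof.
move=> [V VQ ->]; exists (fun a => if (a < i)%N then V a else 0).
  by move=> a; case: ifP => // _; apply: der0.
rewrite big_ord_recr /= ltnn scaler0 addr0.
by apply: eq_bigr => a _; rewrite ltn_ord.
Qed.

(** All [l+1] forms are a regular sequence on [D0]: passing from [S/J] to its second syzygy module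
    gains the two missing ones. *)
Lemma kernel_multiple_cancel i v : (i <= l)%N -> der v Q = 0 ->
  kernel_multiple i (z i *: v) -> kernel_multiple i v.
Proof.
move=> lei vQ /kernel_multiple_vlin zv; apply: kernel_cap_vlin => //.
by apply: vlin_regular zv; apply: (lin_take_regular dual); rewrite sizes.
Qed.

Lemma lin_full1 : full (lin s) 1.
Proof.
apply: full_mulX; first exact: lin_ideal.
move=> j f _; apply: (idealMr (lin_ideal s)).
have [c ->] := dual_basis_span j dual sizes.
apply: ideal_sum (lin_ideal s) _ => i _; apply: (idealZ (lin_ideal s)).
by apply/lin_mem/mem_nth; rewrite sizes.
Qed.

Lemma lin_const f : lin s (f - (f@_0%MM)%:MP).
Proof.
have hs := lin_ideal s.
have -> : f - (f@_0%MM)%:MP =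
    \sum_(m <- msupp f) f@_m *: ('X_[m] - (('X_[m] : S)@_0%MM)%:MP).
  under eq_bigr => m _ do rewrite scalerBr -[X in _ - X]mul_mpolyC -mpolyCM -mcoeffZ.
  by rewrite sumrB -mpolyE -!raddf_sum -mpolyE.
apply: ideal_sum (lin_ideal s) _ => m _; apply: (idealZ hs); rewrite mcoeffX.
have [->|m0] := eqVneq m 0%MM; first by rewrite mpolyX0 subrr; apply: (ideal0 hs).
rewrite mpolyC0 subr0; apply: (full_leq hs (d := 1) (e := mdeg m)).
- by rewrite lt0n mdeg_eq0.
- exact: lin_full1.
- by rewrite dhomogX.
Qed.

(** Independence over [K] of the classes in the quotient of [D0] by all the variables, as for a
    minimal set of generators. *)
Definition kernel_indep r (b : 'I_r -> 'rV[S]_l.+1) := forall c : 'I_r -> K,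
  kernel_multiple l.+1 (\sum_j (c j)%:MP *: b j) -> forall j, c j = 0.

Section Independent.
Variables (r : nat) (b : 'I_r -> 'rV[S]_l.+1).
Hypothesis bQ : forall j, der (b j) Q = 0.
Hypothesis bindep : kernel_indep b.

Lemma sum_kernel (c : 'I_r -> S) : der (\sum_j c j *: b j) Q = 0.
Proof. by rewrite der_sum big1 // => j _; rewrite derZ bQ mulr0. Qed.

(** Descending induction on [i], from independence at [l+1] to honest relations at 0. Knowing the
    coefficients modulo [z_i], one writes [c = c' z_i], cancels [z_i] and repeats with [c']; so [c]
    is divisible by every power of [z_i] modulo [L i]. *)
Lemma kernel_indep_mod i (c : 'I_r -> S) : (i <= l.+1)%N ->
  kernel_multiple i (\sum_j c j *: b j) -> forall j, L i (c j).
Proof.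
move=> lei; rewrite -(subKn lei); move: {i lei}(l.+1 - i)%N (leq_subr i l.+1) c.
elim=> [_|k IH lek] c.
  have tk : take l.+1 s = s by rewrite take_oversize // sizes.
  rewrite subn0 tk => hc j.
  have c0 : c j = ((c j)@_0%MM)%:MP + (c j - ((c j)@_0%MM)%:MP) by rewrite addrC subrK.
  suff c00 : (c j)@_0%MM = 0 by have := lin_const (c j); rewrite c00 mpolyC0 subr0.
  apply: (bindep (c := fun j => (c j)@_0%MM)).
  have -> : \sum_j ((c j)@_0%MM)%:MP *: b j =
      \sum_j c j *: b j - \sum_j (c j - ((c j)@_0%MM)%:MP) *: b j.
    by rewrite -sumrB; apply: eq_bigr => q _; rewrite -scalerBl subKr.
  apply: kernel_multipleB => //; apply: kernel_multiple_sum => q.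
  by apply: kernel_multipleZl => //; rewrite tk; apply: lin_const.
set i := (l.+1 - k.+1)%N; have iS : (l.+1 - k = i.+1)%N by rewrite /i; lia.
have lei : (i <= l)%N by rewrite /i; lia.
have lti : (i < size s)%N by rewrite sizes.
have {}IH := IH (ltnW lek); rewrite iS in IH.
have step N : forall c : 'I_r -> S, kernel_multiple i (\sum_j c j *: b j) ->
    forall j, exists g, L i (c j - g * z i ^+ N).
  elim: N => [|N IHN] {}c hc j.
    by exists (c j); rewrite expr0 mulr1 subrr; apply: (ideal0 (hL i)).
  have := IH c (kernel_multipleW hc); rewrite lin_takeS // => /choice[c' hc'].
  have [|g hg] := IHN c' _ j.
    apply: kernel_multiple_cancel => //; first exact: sum_kernel.
    have -> : z i *: (\sum_j c' j *: b j) =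
        \sum_j c j *: b j - \sum_j (c j - c' j * z i) *: b j.
      rewrite -sumrB scaler_sumr; apply: eq_bigr => q _.
      by rewrite -scalerBl subKr scalerA mulrC.
    apply: kernel_multipleB => //; apply: kernel_multiple_sum => q.
    by apply: kernel_multipleZl => //; apply: ltnW.
  exists g; rewrite exprSr mulrA.
  have -> : c j - g * z i ^+ N * z i = (c j - c' j * z i) + (c' j - g * z i ^+ N) * z i.
    by ring.
  by apply: (idealD (hL i)) => //; apply: (idealMl (hL i)).
move=> hc j; apply: (ideal_pieces (hL i)) => d.
(* A multiple of [z_i^(d+1)] has no component in degree [d]. *)
have [g /(lin_graded d)] := step d.+1 c hc j.
have hz : z i ^+ d.+1 \is d.+1.-homog by apply/homogX1/linear_form_homog.
by rewrite linearB /= (pihomogM_homog _ _ hz) ltnn subr0.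
Qed.

Lemma kernel_indep_free (c : 'I_r -> S) : \sum_j c j *: b j = 0 -> forall j, c j = 0.
Proof.
move=> c0 j; have := kernel_indep_mod (i := 0) (c := c) (leq0n _).
rewrite c0 take0 => /(_ _ j) [|d ->]; last by rewrite big_ord0.
by exists (fun=> 0); rewrite ?big_ord0 // => a; apply: der0.
Qed.

Lemma kernel_indep_size : (r <= l.+1)%N.
Proof.
rewrite leqNgt; apply/negP => ltr.
have [c [j cj] hc] := dependent_rows (fun j k => b j 0 k) ltr.
case/eqP: cj; apply: kernel_indep_free; apply/rowP => k.
by rewrite summxE mxE -[RHS](hc k); apply: eq_bigr => q _; rewrite mxE.
Qed.

End Independent.

(** * Homogeneous generators of the kernel *)

Definition vhomog d v := forall k, v 0 k \is d.-homog.

Definition vpi d v : 'rV[S]_l.+1 := \row_k pihomog (@mdeg l.+1) d (v 0 k).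

Lemma vpi_homog d v : vhomog d (vpi d v).
Proof. by move=> k; rewrite mxE; apply: pihomogP. Qed.

Lemma vpiE d v : vhomog d v -> vpi d v = v.
Proof. by move=> h; apply/rowP => k; rewrite mxE pihomog_dE. Qed.

Lemma vpi_linear d (a : K) u v : vpi d (a%:MP *: u + v) = a%:MP *: vpi d u + vpi d v.
Proof. by apply/rowP => k; rewrite !mxE !mul_mpolyC linearP. Qed.

Lemma vpiD d u v : vpi d (u + v) = vpi d u + vpi d v.
Proof. by have := vpi_linear d 1 u v; rewrite mpolyC1 !scale1r. Qed.

Lemma vpi0 d : vpi d 0 = 0.
Proof. by apply/rowP => k; rewrite !mxE linear0. Qed.

Lemma vpi_sum d m (F : 'I_m -> 'rV[S]_l.+1) : vpi d (\sum_j F j) = \sum_j vpi d (F j).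
Proof. exact: (big_morph (vpi d) (vpiD d) (vpi0 d)). Qed.

Lemma vpiC d (a : K) v : vpi d (a%:MP *: v) = a%:MP *: vpi d v.
Proof. by have := vpi_linear d a v 0; rewrite vpi0 !addr0. Qed.

Lemma vpi_off d e v : d != e -> vhomog e v -> vpi d v = 0.
Proof.
by move=> de h; apply/rowP => k; rewrite !mxE (pihomog_ne0 _ (h k)) // eq_sym.
Qed.

Lemma vpi_mul d p v : p \is 1.-homog ->
  vpi d (p *: v) = if d is e.+1 then p *: vpi e v else 0.
Proof.
move=> hp; apply/rowP => k; rewrite mxE mxE mulrC (pihomogM_homog _ _ hp).
by case: d => [|e]; rewrite !mxE //= subn1 mulrC.
Qed.

Lemma vpi_partition v : exists N, v = \sum_(d < N) vpi d v.
Proof.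
exists (\max_(k < l.+1) (msize (v 0%R k)))%N; apply/rowP => k; rewrite summxE.
under eq_bigr => d _ do rewrite mxE.
by apply: pihomog_partitionE; apply: (leq_bigmax (F := fun k => msize (v 0 k)) k).
Qed.

Lemma der_vpi d v : der v Q = 0 -> der (vpi d v) Q = 0.
Proof.
move=> vQ; have hQ j : Q^`M(j) \is n.-1.-homog.
  by apply: mderiv_homog; rewrite prednK // defining_homog.
have <- : pihomog (@mdeg l.+1) (d + n.-1) (der v Q) = der (vpi d v) Q.
  rewrite linear_sum; apply: eq_bigr => j _ /=.
  by rewrite (pihomogM_homog _ _ (hQ j)) leq_addl addnK mxE.
by rewrite vQ linear0.
Qed.

(** A maximal homogeneous family independent modulo the variables exists because its freeness bounds
    its size by [l+1]. Maximality makes it generate modulo the variables, and a graded Nakayama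
    argument does the rest. *)
Lemma kernel_basis : exists r (b : 'I_r -> 'rV[S]_l.+1),
  [/\ forall j, der (b j) Q = 0,
      forall c : 'I_r -> S, \sum_j c j *: b j = 0 -> forall j, c j = 0 &
      forall v, der v Q = 0 -> exists c : 'I_r -> S, v = \sum_j c j *: b j].
Proof.
pose good r := `[< exists b : 'I_r -> 'rV[S]_l.+1,
  [/\ forall j, der (b j) Q = 0, kernel_indep b & forall j, exists d, vhomog d (b j)] >].
have g0 : exists r, good r by exists 0%N; apply/asboolP; exists (fun=> 0); split; [case | move=> c _ [] | case].
have gle r : good r -> (r <= l.+1)%N.
  by move/asboolP => [b [bQ bi _]]; apply: kernel_indep_size bQ bi.
case: (ex_maxnP g0 gle) => r /asboolP[b [bQ bi bh]] rmax.
exists r, b; split=> //; first exact: kernel_indep_free.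
have decomp d v : der v Q = 0 -> vhomog d v ->
    exists c : 'I_r -> K, kernel_multiple l.+1 (v - \sum_j (c j)%:MP *: b j).
  move=> vQ vh; apply: contrapT => none.
  suff /rmax : good r.+1 by rewrite ltnn.
  apply/asboolP; exists (fun j => if unlift ord0 j is Some i then b i else v).
  split=> [j|c|j].
  - by case: (unlift ord0 j) => [i|] //; apply: bQ.
  - rewrite big_ord_recl unlift_none; under eq_bigr => j _ do rewrite liftK.
    move=> hc.
    have [c0|cn0] := eqVneq (c ord0) 0.
      rewrite c0 mpolyC0 scale0r add0r in hc => j.
      by case: (unliftP ord0 j) => [i ->|->] //; apply: (bi _ hc i).
    case: none; exists (fun j => - (c ord0)^-1 * c (lift ord0 j)).
    have -> : v - \sum_j (- (c ord0)^-1 * c (lift ord0 j))%:MP *: b j =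
        ((c ord0)^-1)%:MP *: ((c ord0)%:MP *: v + \sum_j (c (lift ord0 j))%:MP *: b j).
      rewrite scalerDr scalerA -mpolyCM mulVf // mpolyC1 scale1r; congr (_ + _).
      rewrite scaler_sumr -sumrN; apply: eq_bigr => j _.
      by rewrite scalerA -mpolyCM mulNr mpolyCN scaleNr opprK.
    exact: kernel_multipleZ.
  - by case: (unlift ord0 j) => [i|]; [apply: bh | exists d].
pose sp v := exists c : 'I_r -> S, v = \sum_j c j *: b j.
have spD u v : sp u -> sp v -> sp (u + v).
  move=> [c ->] [d ->]; exists (fun j => c j + d j).
  by rewrite -big_split; apply: eq_bigr => j _; rewrite scalerDl.
have spZ f v : sp v -> sp (f *: v).
  move=> [c ->]; exists (fun j => f * c j).
  by rewrite scaler_sumr; apply: eq_bigr => j _; rewrite scalerA.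
have sp0 : sp 0 by exists (fun=> 0); rewrite big1 // => j _; rewrite scale0r.
have spb j : sp (b j).
  exists (fun i => (i == j)%:R); rewrite (bigD1 j) //= eqxx scale1r big1 ?addr0 //.
  by move=> i /negPf ->; rewrite scale0r.
have sp_sum m (F : 'I_m -> 'rV[S]_l.+1) : (forall i, sp (F i)) -> sp (\sum_i F i).
  by move=> h; apply: big_ind.
have sp_hom d : forall v, der v Q = 0 -> vhomog d v -> sp v.
  elim/ltn_ind: d => d IH v vQ vh.
  have [c [V VQ vE]] := decomp d v vQ vh.
  (* In degree [d] only the components of [V a] of degree [d-1] count, and the induction hypothesis
     covers them. *)
  rewrite -(vpiE vh) -[v](subrK (\sum_j (c j)%:MP *: b j)) vE vpiD !vpi_sum.
  apply: spD; apply: sp_sum => i.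
    rewrite vpi_mul ?linear_form_homog //; case: d IH vh vE => [//|d] IH _ _.
    by apply: spZ; apply: (IH d) => //; [apply: der_vpi | apply: vpi_homog].
  rewrite vpiC; apply: spZ; have [e be] := bh i.
  by have [->|de] := eqVneq d e; [rewrite vpiE | rewrite (vpi_off de be)].
move=> v vQ; have [N ->] := vpi_partition v; apply: sp_sum => d.
by apply: (sp_hom d); [apply: der_vpi | apply: vpi_homog].
Qed.

Lemma regular_free : free_arrangement A.
Proof.
have [r [b [bQ bfree bgen]]] := kernel_basis.
have nK := natr_neq0 charK n0.
exists r.+1, (fun j => if unlift ord0 j is Some i then b i else @euler K l).
split.
  move=> j; case: unliftP => [i _|_]; first exact: kernel_in_derivations.
  exact: euler_in_derivations.
have sumE (c : 'rV[S]_r.+1) : \sum_j c 0 j *: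
    (if unlift ord0 j is Some i then b i else @euler K l) =
    c 0 ord0 *: @euler K l + \sum_j c 0 (lift ord0 j) *: b j.
  rewrite big_ord_recl unlift_none; congr (_ + _).
  by apply: eq_bigr => j _; rewrite liftK.
have zero (c : 'rV[S]_r.+1) : c 0 ord0 *: @euler K l +
    \sum_j c 0 (lift ord0 j) *: b j = 0 -> c = 0.
  move=> c0; have e0 : c 0 ord0 = 0.
    have := congr1 (fun v => der v Q) c0.
    rewrite derD derZ der_euler_Q der_sum big1 ?addr0; last first.
      by move=> j _; rewrite derZ bQ mulr0.
    rewrite der0 natr_mpoly => /eqP; rewrite !mulf_eq0 mpolyC_eq0 (negPf nK).
    by rewrite (negPf (defining_neq0 A)) !orbF => /eqP.
  rewrite e0 scale0r add0r in c0; apply/rowP => j; rewrite mxE.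
  case: (unliftP ord0 j) => [i ->|-> //].
  exact: (bfree (fun j => c 0 (lift ord0 j)) c0 i).
move=> v /derivations_log[g gE].
have [|c cE] := bgen (v - ((n%:R^-1)%:MP * g) *: @euler K l).
  rewrite derB gE derZ der_euler_Q natr_mpoly mulrA [_ * g * _]mulrAC -mpolyCM mulVf //.
  by rewrite mpolyC1 mul1r subrr.
exists (\row_j if unlift ord0 j is Some i then c i else (n%:R^-1)%:MP * g); split.
  rewrite sumE mxE unlift_none; under eq_bigr => j _ do rewrite mxE liftK.
  by rewrite -cE addrC subrK.
move=> c' c'E; apply/eqP; rewrite -subr_eq0; apply/eqP; apply: zero.
rewrite !mxE unlift_none; under eq_bigr => j _ do rewrite !mxE liftK scalerBl.
rewrite sumrB scalerBl addrACA -opprD -sumE -c'E -cE.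
by rewrite [X in X - v]addrC subrK subrr.
Qed.

End RegularImpliesFree.

(** * Rows of a generic matrix *)

Section Rows.
Variables (K : fieldType) (l : nat).

Definition rows k (L : 'M[K]_(k, l)) : seq 'rV[K]_l := [seq row j L | j : 'I_k].

Lemma size_rows k (L : 'M[K]_(k, l)) : size (rows L) = k.
Proof. by rewrite size_map size_enum_ord. Qed.

Lemma nth_rows k (L : 'M[K]_(k, l)) (j : 'I_k) : (rows L)`_j = row j L.
Proof. by rewrite (nth_map j) ?size_enum_ord // nth_ord_enum. Qed.

Lemma rows_take k k' (h : (k <= k')%N) (L : 'M[K]_(k', l)) :
  rows (rowsub (widen_ord h) L) = take k (rows L).
Proof.
apply: (@eq_from_nth _ 0) => [|i]; first by rewrite size_takel !size_rows.
rewrite size_rows => lti; rewrite nth_take // (nth_rows _ (Ordinal lti)).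
rewrite (nth_rows L (widen_ord h (Ordinal lti))).
by apply/rowP => j; rewrite !mxE.
Qed.

Lemma rows_col_mx k k' (L : 'M[K]_(k, l)) (L' : 'M[K]_(k', l)) :
  rows (col_mx L L') = rows L ++ rows L'.
Proof.
apply: (@eq_from_nth _ 0) => [|i]; first by rewrite size_cat !size_rows.
rewrite size_rows => lti; rewrite (nth_rows _ (Ordinal lti)) nth_cat size_rows.
case: ltnP => [ltk|gek].
  rewrite (nth_rows L (Ordinal ltk)).
  have -> : Ordinal lti = lshift k' (Ordinal ltk) by apply: val_inj.
  by rewrite rowKu.
have ltk' : (i - k < k')%N by rewrite ltn_subLR.
rewrite (nth_rows L' (Ordinal ltk')).
have -> : Ordinal lti = rshift k (Ordinal ltk') by apply: val_inj; rewrite /= subnKC.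
by rewrite rowKd.
Qed.

Lemma rows_rv (a : 'rV[K]_l) : rows a = [:: a].
Proof.
apply: (@eq_from_nth _ 0) => [|i]; first by rewrite size_rows.
rewrite size_rows ltnS leqn0 => /eqP -> /=; rewrite (nth_rows a ord0).
by apply/rowP => j; rewrite mxE.
Qed.

End Rows.

Lemma forms_rows (K : fieldType) l k (L : 'M[K]_(k, l.+1)) : forms L = lfs (rows L).
Proof. by rewrite /lfs /rows /forms /image_mem -map_comp. Qed.

Lemma row_free_dual_basis (K : fieldType) l k (B : 'M[K]_(k, l.+1)) :
  row_free B -> exists w, dual_basis (rows B) w.
Proof.
case/row_freeP => C BC; exists (fun i => if insub i is Some i' then (col i' C)^T else 0).
move=> i j; rewrite !size_rows => lti ltj.
rewrite insubT /= (nth_rows B (Ordinal ltj)) meval_linear_form.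
have := congr1 (fun M : 'M_k => M (Ordinal ltj) (Ordinal lti)) BC; rewrite !mxE.
rewrite -(inj_eq val_inj) /= eq_sym => <-.
by apply: eq_bigr => q _; rewrite !mxE.
Qed.

Section RowFreeGeneric.
Variables (K : fieldType) (l : nat).
Hypothesis charK : [pchar K] =i pred0.

Lemma row_free_line k k' (L D : 'M[K]_(k, l)) (E : 'M[K]_(k', l)) :
  row_free (col_mx L E) -> exists2 q : {poly K}, q != 0 &
    forall t, q.[t] != 0 -> row_free (col_mx (L + t *: D) E).
Proof.
pose B := map_mx polyC (col_mx L E) + 'X *: map_mx polyC (col_mx D 0).
have BE t : map_mx (horner_eval t) B = col_mx (L + t *: D) E.
  rewrite -[E in RHS]addr0 -[in RHS](scaler0 _ t) -add_col_mx -scale_col_mx.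
  by apply/matrixP => i j; rewrite !mxE /horner_eval !hornerE.
move=> fr; have fr0 : row_free (map_mx (horner_eval 0) B).
  by rewrite BE scale0r addr0.
have [x|q q0 hq] := row_free_open (c := @polyC K) _ fr0; first exact: hornerC.
exists q; first by apply: contraNneq q0 => ->; rewrite rmorph0.
by move=> t qt; rewrite -BE; apply: hq => // y; apply: hornerC.
Qed.

Lemma eqmx_of_rank k (W : 'M[K]_l) : \rank W = k ->
  exists L : 'M[K]_(k, l), (L :=: W)%MS.
Proof. by move=> <-; exists (row_base W); apply: eq_row_base. Qed.

Lemma row_free_complement k k' (E : 'M[K]_(k', l)) : (k + k' = l)%N ->
  row_free E -> exists L : 'M[K]_(k, l), row_free (col_mx L E).
Proof.
move=> kl /eqP rE; have [|L LE] := @eqmx_of_rank k E^C%MS.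
  by rewrite mxrank_compl rE -kl addnK.
have := addsmx_compl_full E; rewrite /row_full addsmxC -(adds_eqmx LE (eqmx_refl E)).
by exists L; rewrite /row_free -addsmxE kl.
Qed.

Lemma row_free_pair (a b : 'rV[K]_l) : b != 0 -> ~ (exists c, a = c *: b) ->
  row_free (col_mx a b).
Proof.
move=> b0 ab; apply: inj_row_free => v.
rewrite -[v]hsubmxK mul_row_col [lsubmx v]mx11_scalar [rsubmx v]mx11_scalar.
rewrite !mul_scalar_mx; set x := lsubmx v 0 0; set y := rsubmx v 0 0 => e.
have x0 : x = 0.
  apply/eqP; apply: contrapT => /negP xn0; apply: ab; exists (- x^-1 * y).
  rewrite -scalerA -[a](scalerK xn0) scaleNr -scalerN; congr (_ *: _).
  by apply/eqP; rewrite -addr_eq0 e.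
move: e; rewrite x0 scale0r add0r => /eqP; rewrite scaler_eq0 (negPf b0) orbF => /eqP ->.
by rewrite !raddf0 row_mx0.
Qed.

End RowFreeGeneric.

(** Every step is an inequality in the same direction, so the sums agree only if no step is
    strict. *)
Lemma telescope_sum (a b : nat -> nat) N : a 0%N = b 0%N ->
  (forall d, a d.+1 <= b d.+1 + a d)%N ->
  (a N = \sum_(0 <= d < N.+1) b d)%N <->
  (forall d, (d < N)%N -> a d.+1 = b d.+1 + a d)%N.
Proof.
move=> ab0 le; have leS M : (a M <= \sum_(0 <= d < M.+1) b d)%N.
  elim: M => [|M IH]; first by rewrite big_nat1 ab0.
  by rewrite big_nat_recr //=; have := le M; lia.
elim: N => [|N IH]; first by rewrite big_nat1; split.
rewrite big_nat_recr //=; split=> [e d|h].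
  have aN : a N = (\sum_(0 <= d < N.+1) b d)%N by have := le N; have := leS N; lia.
  rewrite ltnS leq_eqVlt => /predU1P[->|]; first by lia.
  by move/IH: aN; apply.
have /IH : forall d, (d < N)%N -> (a d.+1 = b d.+1 + a d)%N.
  by move=> d lt; apply: h; apply: ltnW.
by have := h N (ltnSn N); lia.
Qed.

Section GeneratedAbove.
Variables (K : fieldType) (l : nat).
Local Notation S := {mpoly K[l.+1]}.

(** In degree above [m] every generator carries a coefficient of positive degree, from which a
    variable is split off. *)
Lemma ideal_gen_generated_above (I : set S) (G G' : seq S) m :
  I = addgen (ideal_gen G) G' ->
  (forall p, p \in G ++ G' -> exists2 e, (e <= m)%N & p \is e.-homog) ->
  generated_above I m.
Proof.
move=> -> hG d f led fh.
have hI := addgen_ideal G' (ideal_gen_ideal G).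
set I0 := addgen _ _ in hI *.
pose P g := exists2 F : 'I_l.+1 -> S, (forall j, F j \is d.-homog /\ I0 (F j)) &
  g = \sum_j F j * 'X_j.
have P0 : P 0.
  exists (fun=> 0); last by rewrite big1 // => j _; rewrite mul0r.
  by move=> j; split; [apply: rpred0 | apply: (ideal0 hI)].
have PD g h : P g -> P h -> P (g + h).
  move=> [F hF ->] [H hH ->]; exists (fun j => F j + H j).
    move=> j; have [Fh IF] := hF j; have [Hh IH] := hH j.
    by split; [apply: rpredD | apply: (idealD hI)].
  by rewrite -big_split; apply: eq_bigr => j _ /=; rewrite mulrDl.
have Pgen p c : p \in G ++ G' -> P (pihomog (@mdeg l.+1) d.+1 (c * p)).
  move=> pG; have [e lee ph] := hG p pG.
  have Ip : I0 p.
    move: pG; rewrite mem_cat => /orP[h|h]; last by apply: addgen_mem => //; apply: ideal_gen_ideal.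
    by apply: addgenl; apply: mem_ideal_gen.
  have led' : (e <= d)%N by apply: leq_trans led.
  rewrite (pihomogM_homog _ _ ph) (leqW led').
  have : pihomog (@mdeg l.+1) (d.+1 - e) c \is (d - e).+1.-homog.
    by rewrite -subSn //; apply: pihomogP.
  case/homog_X_decomp => H hH ->.
  exists (fun j => H j * p) => [j|].
    split; last exact: (idealMr hI).
    by rewrite -(subnK led'); apply: dhomogM.
  by rewrite mulr_suml; apply: eq_bigr => j _; rewrite mulrAC.
move=> [g [h [[c ->] [c' ->] fE]]]; rewrite -/(P f) -(pihomog_dE fh) fE.
rewrite linearD !linear_sum; apply: (PD).
  by apply: (big_ind P P0 PD) => i _; apply: Pgen; rewrite mem_cat mem_nth.
by apply: (big_ind P P0 PD) => i _; apply: Pgen; rewrite mem_cat [_ \in G']mem_nth ?orbT.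
Qed.

End GeneratedAbove.

(** * Proof of the theorem *)

Section SmallArrangement.
Variables (K : fieldType) (l : nat) (A : arrangement K l.+1).
Hypothesis charK : [pchar K] =i pred0.
Hypothesis small : (arr_size A <= 1)%N.
Local Notation n := (arr_size A).
Local Notation Q := (defining_poly A).
Local Notation J := (jacobian_ideal A).

(** Either [Q = 1], or [Q] is one linear form and has a nonzero constant partial derivative. *)
Lemma small_jacobian : J 1.
Proof.
have [n0|n0] := posnP n.
  have -> : 1 = Q; last exact: jacobian_mem_Q.
  by rewrite /defining_poly big1 // => i; have := ltn_ord i; rewrite [X in (_ < X)%N]n0.
pose i0 : 'I_n := Ordinal n0.
have i0E i : i = i0 by apply: val_inj; have := ltn_ord i; rewrite /=; lia.
have /rV0Pn[q nq] := normal_neq0 i0.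
have := jacobian_mem_partial A q; rewrite partial_defining.
rewrite (bigD1 i0) //= big1 => [|i]; last by rewrite (i0E i) eqxx.
rewrite /cofactor_form big_pred0 => [|i]; last by rewrite (i0E i) eqxx.
rewrite mulr1 addr0 => /(idealZ (jacobian_is_ideal A) (normal i0 0 q)^-1).
by rewrite -mul_mpolyC -mpolyCM mulVf // mpolyC1.
Qed.

Lemma small_free : free_arrangement A.
Proof.
have [n0|n0] := posnP n.
  exists l.+1, (fun i => delta_mx 0 i); split.
    by move=> i j; have := ltn_ord j; rewrite [X in (_ < X)%N]n0.
  move=> v _; exists v; split=> [|c vE]; first exact: row_sum_delta.
  by rewrite vE -row_sum_delta.
have fr : row_free (1%:M : 'M[K]_l.+1) by rewrite row_free_unit unitmx1.
have [w dw] := row_free_dual_basis fr.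
(* As [J = S], regularity modulo [J] holds for any forms; the coordinate forms are used. *)
apply: (regular_free charK n0 (size_rows _) dw) => i _ f _.
have hJ := jacobian_is_ideal A; have hI := addgen_ideal (lfs (take i (rows 1%:M))) hJ.
by rewrite -[f]mulr1; apply: (idealMr hI); apply: addgenl; apply: small_jacobian.
Qed.

End SmallArrangement.

(** * Arrangements with at least two hyperplanes *)

Section Main.
Variables (K : fieldType) (l : nat) (A : arrangement K l.+3).
Hypothesis charK : [pchar K] =i pred0.
Hypothesis big : (1 < arr_size A)%N.
Local Notation S := {mpoly K[l.+3]}.
Local Notation n := (arr_size A).
Local Notation al := (arr_form (a := A)).
Local Notation Q := (defining_poly A).
Local Notation J := (jacobian_ideal A).
Local Notation M := (sectional_matrix J).
Local Notation m := (l.+3 - 2)%N.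
Local Notation k := (l.+3 - 3)%N.
Local Notation d0 := (reduction_number J (l.+3 - 2)).
Implicit Types (L : 'M[K]_(m, l.+3)) (i j : 'I_n).

Let hJ : ideal J := jacobian_is_ideal A.
Let gJ : graded J := @jacobian_graded _ _ A.

Let mE : m = l.+1. Proof. by rewrite !subSS subn0. Qed.
Let kE : k = l. Proof. by rewrite !subSS subn0. Qed.
Let km : (k <= m)%N. Proof. by rewrite mE kE. Qed.

Let i1 : 'I_n := Ordinal (ltnW big).
Let i2 : 'I_n := Ordinal big.
Let i12 : i1 != i2. Proof. by []. Qed.

(** Row 3 uses the first [k] of the [m = k + 1] forms of row 2, so that one generic matrix serves
    both rows. *)
Definition top_rows L : 'M[K]_(k, l.+3) := rowsub (widen_ord km) L.

Definition extend_rows (L : 'M[K]_(k, l.+3)) : 'M[K]_(m, l.+3) :=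
  \matrix_(i, j) if insub (val i) is Some i' then L i' j else 0.

Lemma extend_rowsK : cancel extend_rows top_rows.
Proof.
move=> L; apply/matrixP => i j; rewrite !mxE insubT //= => h.
by congr (L _ _); apply: val_inj.
Qed.

Lemma top_rows_linear : linear top_rows.
Proof. by move=> a L L'; apply/matrixP => i j; rewrite !mxE. Qed.

HB.instance Definition _ := GRing.isLinear.Build K 'M[K]_(m, l.+3) 'M[K]_(k, l.+3)
  *:%R top_rows top_rows_linear.

(** The forms of [L] and any two normals are a coordinate system. *)
Definition transversal L := forall p : 'I_n * 'I_n, p.1 != p.2 ->
  row_free (col_mx L (col_mx (normal p.1) (normal p.2))).

(** A bound [D] on the degrees keeps this a finite intersection of generic conditions. *)
Definition generic_below D L :=
  (forall d, (d < D)%N -> hf (addgen J (forms L)) d = M 2 d) /\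
  (forall d, (d < D)%N -> hf (addgen J (forms (top_rows L))) d = M 3 d).

Lemma transversal_linegen : linegen transversal.
Proof.
apply: linegen_fin => // -[i j]; have [ij|ij] := eqVneq i j.
  by apply: linegenW (linegenT _) => L; split=> // _; rewrite ij /= eqxx.
have fr : row_free (col_mx (normal i) (normal j)).
  by apply: row_free_pair; [apply: normal_neq0 | apply: normal_indep].
split.
  have [|L hL] := row_free_complement (k := m) _ fr; first by rewrite mE addn2.
  by exists L.
move=> L D hL /=; have [q q0 hq] := row_free_line D (hL isT).
by exists q => // t qt _; apply: hq.
Qed.

Definition generic D L := transversal L /\ generic_below D L.

Lemma generic_linegen D : linegen (generic D).
Proof.
apply: linegenI => //; first exact: transversal_linegen.
apply: linegenI => //; apply: linegen_ltn => // d.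
  exact: sectional_matrix_linegen.
exact: (linegen_comp (f := top_rows) extend_rowsK
  (sectional_matrix_linegen charK 3 d hJ gJ)).
Qed.

Section GenericTuple.
Variable L : 'M[K]_(m, l.+3).
Hypothesis tL : transversal L.
Local Notation s := (rows L).
Local Notation s' := (take k (rows L)).
Local Notation z := (linear_form s`_k).
Local Notation I3 := (addgen J (lfs s')).
Local Notation I2 := (addgen J (lfs s)).

Lemma rows_rcons : s = rcons s' s`_k.
Proof. by rewrite -take_nth ?size_rows ?mE ?kE // take_oversize // size_rows mE. Qed.

Lemma frame_dual i j : i != j ->
  exists w, dual_basis (s ++ [:: normal i; normal j]) w.
Proof.
move=> ij; have [w dw] := row_free_dual_basis (tL (p := (i, j)) ij); exists w.
by move: dw; rewrite !rows_col_mx !rows_rv.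
Qed.

Lemma frame_size i j : size (s ++ [:: normal i; normal j]) = l.+3.
Proof. by rewrite size_cat size_rows mE addn2. Qed.

Lemma frame_take i j t : (t <= m)%N ->
  take t (s ++ [:: normal i; normal j]) = take t s.
Proof.
by move=> le; rewrite takel_cat // size_rows.
Qed.

Lemma frame_nth i j t : (t < m)%N -> (s ++ [:: normal i; normal j])`_t = s`_t.
Proof. by move=> lt; rewrite nth_cat size_rows lt. Qed.

Lemma rows_regular t : (t < m)%N -> regular (lin (take t s)) (linear_form s`_t).
Proof.
move=> lt; have [w dw] := frame_dual i12.
have := lin_take_regular dw (i := t); rewrite frame_take ?frame_nth //; last exact: ltnW.
by apply; rewrite frame_size; rewrite mE in lt; lia.
Qed.

Lemma lin_frame i j : lin (s ++ [:: normal i; normal j]) =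
  adjoin (adjoin (lin s) (al i)) (al j).
Proof.
have -> : s ++ [:: normal i; normal j] = rcons (rcons s (normal i)) (normal j).
  by rewrite -!cats1 -catA.
by rewrite !lin_rcons -!arr_formE.
Qed.

Lemma transversal_pairwise : pairwise_transversal A s.
Proof.
move=> i j ij q; rewrite -lin_frame; have [w dw] := frame_dual ij.
have [c ->] := dual_basis_span q dw (frame_size i j).
apply: ideal_sum (lin_ideal _) _ => t _; apply: (idealZ (lin_ideal _)).
by apply/lin_mem/mem_nth; rewrite frame_size.
Qed.

Lemma second_normal_nmem i j : i != j -> ~ lin (rcons s (normal i)) (al j).
Proof.
move=> ij; have [w dw] := frame_dual ij.
have := @lin_take_nmem _ _ _ w l.+2 dw; rewrite frame_size ltnSn => /(_ isT).
have -> : s ++ [:: normal i; normal j] = rcons s (normal i) ++ [:: normal j].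
  by rewrite cat_rcons.
have sz : size (rcons s (normal i)) = l.+2 by rewrite size_rcons size_rows mE.
by rewrite (take_size_cat _ sz) nth_cat sz ltnn subnn /= -arr_formE.
Qed.

Lemma first_normal_nmem j : ~ lin s (al j).
Proof.
have [i ij] : exists i, i != j.
  by have [<-|ne] := eqVneq i1 j; [exists i2 | exists i1].
move=> h; apply: (second_normal_nmem ij); rewrite lin_rcons.
exact: adjoinW.
Qed.

Lemma I3_ideal : ideal I3. Proof. exact: addgen_ideal. Qed.
Lemma I3_graded : graded I3.
Proof. by apply: addgen_graded => //; apply: lfs_homogeneous. Qed.
Lemma I2_ideal : ideal I2. Proof. exact: addgen_ideal. Qed.

Lemma I2E : I2 = adjoin I3 z.
Proof. by rewrite {1}rows_rcons /lfs map_rcons addgen_rcons. Qed.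

Lemma formsE : addgen J (forms L) = I2.
Proof. by rewrite forms_rows. Qed.

Lemma forms_topE : addgen J (forms (top_rows L)) = I3.
Proof. by rewrite forms_rows /top_rows rows_take. Qed.

Lemma hf_I3 d : hf I3 d.+1 = (hf I2 d.+1 + hf (colon I3 z) d)%N.
Proof.
have := hf_adjoin d I3_ideal I3_graded (linear_form_homog s`_k).
by rewrite -I2E addn1.
Qed.

Lemma hf_colon_le d : (hf (colon I3 z) d <= hf I3 d)%N.
Proof.
apply: hfS; [exact: I3_ideal | exact/colon_ideal/I3_ideal |].
by move=> f _; apply: sub_colon; apply: I3_ideal.
Qed.

Lemma hf_colon_eq d : hf I3 d = hf (colon I3 z) d <->
  (forall f, f \is d.-homog -> I3 (f * z) -> I3 f).
Proof.
have hC := colon_ideal z I3_ideal.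
have sub f : f \is d.-homog -> I3 f -> colon I3 z f.
  by move=> _; apply: sub_colon; apply: I3_ideal.
split=> [e f fh Ifz|h]; first exact: (hf_eq I3_ideal hC sub e fh).
apply/eqP; rewrite eqn_leq hf_colon_le andbT.
by apply: (hfS hC I3_ideal) => f fh; apply: h.
Qed.

Lemma hf_zero_degree : hf I3 0 = hf I2 0.
Proof.
by rewrite I2E (hf_adjoin_low I3_ideal I3_graded (linear_form_homog s`_k)).
Qed.

Lemma finite_colength : exists N, full I2 N.
Proof. exact: jacobian_finite_colength transversal_pairwise (ltnW big). Qed.

(** Here [J] contains both linear forms, which together with [L] generate all variables; so row 2
    vanishes from degree 1 on. *)
Lemma two_planes_full : n = 2%N -> full I2 1.
Proof.
move=> n2; have cases i : i = i1 \/ i = i2.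
  have lt := ltn_ord i; rewrite [X in (_ < X)%N]n2 in lt.
  by case: (posnP i) => h; [left | right]; apply: val_inj => //=; lia.
have third i j t : i != j -> (t != i) && (t != j) = false.
  case: (cases i) => ->; case: (cases j) => ->; case: (cases t) => ->;
  by rewrite ?eqxx ?andbF.
have cof i j : i != j -> cofactor_form i = al j.
  move=> ij; rewrite /cofactor_form (bigD1 j) 1?eq_sym //= big_pred0 ?mulr1 // => t.
  exact: third.
have Jal i j : i != j -> J (al j).
  move=> ij; have [w dw] := frame_dual ij.
  have sz := frame_size i j; set fr := s ++ _ in dw sz.
  have szs : size s = l.+1 by rewrite size_rows mE.
  have fi : fr`_l.+1 = normal i by rewrite /fr nth_cat szs ltnn subnn.
  have fj : fr`_l.+2 = normal j by rewrite /fr nth_cat szs ltnNge leqnSn /= subSnn.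
  (* The derivative of [Q] in the direction dual to the normal of [i] is the form of [j]. *)
  have : J (\sum_q (w l.+1 0 q) *: Q^`M(q)).
    by apply: ideal_sum hJ _ => q _; apply: (idealZ hJ); apply: jacobian_mem_partial.
  have -> : \sum_q (w l.+1 0 q) *: Q^`M(q) =
      \sum_(t < n) ((linear_form (normal (A := A) t)).@[w l.+1 0])%:MP * cofactor_form t.
    under eq_bigr => q _ do rewrite partial_defining scaler_sumr.
    rewrite exchange_big; apply: eq_bigr => t _ /=.
    rewrite meval_linear_form rmorph_sum mulr_suml; apply: eq_bigr => q _.
    by rewrite -mul_mpolyC mulrA -mpolyCM [w l.+1 0 q * _]mulrC.
  rewrite (bigD1 i) //= (bigD1 j) 1?eq_sym //= big_pred0; last first.
    by move=> t; apply: third.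
  have := dw l.+1 l.+1; rewrite sz fi eqxx => -> //.
  have := dw l.+1 l.+2; rewrite sz fj ltn_eqF // => -> //.
  by rewrite mpolyC1 mul1r mpolyC0 mul0r !addr0 (cof _ _ ij).
have hI := I2_ideal; apply: (full_mulX hI) => q f _; apply: (idealMr hI).
apply: adjoin_sub (transversal_pairwise i12 q) => //.
  apply: adjoin_sub => //; first by move=> g; apply: addgenr.
  by apply/addgenl/(Jal i2 i1); rewrite eq_sym.
by apply/addgenl/(Jal i1 i2).
Qed.

Lemma lin_meval0 t f : lin t f -> f.@[(0 : 'rV[K]_l.+3) 0] = 0.
Proof.
move=> [c ->]; rewrite rmorph_sum big1 // => j _ /=; rewrite mevalM.
have ltj : (j < size t)%N by have := ltn_ord j; rewrite [X in (_ < X)%N]size_map.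
rewrite (nth_map 0) // meval_linear_form [X in _ * X]big1 ?mulr0 // => i _.
by rewrite [X in _ * X]mxE mulr0.
Qed.

Lemma I2_proper : ~ I2 1.
Proof.
move=> [g [h [Jg lh e]]].
have e0 : pihomog (@mdeg l.+3) 0 g + pihomog (@mdeg l.+3) 0 h = 1.
  by rewrite -linearD /= -e pihomog_dE // dhomog1.
have g0 : pihomog (@mdeg l.+3) 0 g = 0.
  by apply: (jacobian_low charK (pihomogP _ _ _) big); apply: gJ.
have := lin_meval0 (lin_graded 0 lh).
by move: e0; rewrite g0 add0r => -> /eqP; rewrite meval1 oner_eq0.
Qed.

(** Below degree [n-1] the ideal [J] is zero, so a power of [al i1] would lie in the prime ideal of
    [L]. The bound controls the degrees of the generators of [J]. *)
Lemma full_degree_ge d : full I2 d -> (n <= d.+1)%N.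
Proof.
move=> h; rewrite leqNgt; apply/negP => lt.
have fh : al i1 ^+ d \is d.-homog by apply/homogX1/arr_form_homog.
have [g [r [Jg lr e]]] := h _ fh.
have e0 : pihomog (@mdeg l.+3) d g + pihomog (@mdeg l.+3) d r = al i1 ^+ d.
  by rewrite -linearD /= -e pihomog_dE.
have g0 : pihomog (@mdeg l.+3) d g = 0.
  by apply: (jacobian_low charK (pihomogP _ _ _) lt); apply: gJ.
have := lin_graded d lr; move: e0; rewrite g0 add0r => ->.
elim: d {h lt fh g r Jg lr e g0} => [|d IH]; last first.
  by rewrite exprS => /lin_prime[/first_normal_nmem|].
by move/lin_meval0 => /eqP; rewrite meval1 oner_eq0.
Qed.

(** [J] has no linear forms, so only the ideal of the linear forms matters in degree 1. *)
Lemma injective_degree0 : (2 < n)%N ->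
  forall f, f \is 0.-homog -> I3 (f * z) -> I3 f.
Proof.
move=> n3 f fh [g [r [Jg lr e]]].
have zh := linear_form_homog s`_k.
have fzh : f * z \is 1.-homog := dhomogM fh zh.
have e0 : pihomog (@mdeg l.+3) 1 g + pihomog (@mdeg l.+3) 1 r = f * z.
  by rewrite -linearD /= -e pihomog_dE.
have g0 : pihomog (@mdeg l.+3) 1 g = 0.
  by apply: (jacobian_low charK (pihomogP _ _ _) n3); apply: gJ.
have := lin_graded 1 lr; move: e0; rewrite g0 add0r => -> lfz.
by apply: addgenr => //; apply: rows_regular lfz; rewrite mE kE.
Qed.

(** Bayer-Stillman with [Lam] the ideal of the first [k] forms, [z] the next one, and two normals as
    [x] and [y], which complete a coordinate system. *)
Lemma injective_above d : full I2 d ->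
  (forall f, f \is d.-homog -> I3 (f * z) -> I3 f) ->
  forall e, (d <= e)%N -> forall f, f \is e.-homog -> I3 (f * z) -> I3 f.
Proof.
move=> fd inj e le; have [w dw] := frame_dual i12.
set fr := s ++ _ in dw; have sz : size fr = l.+3 := frame_size i1 i2.
have szs : size s = l.+1 by rewrite size_rows mE.
have tk : take l fr = take k s by rewrite kE /fr takel_cat // szs.
have fz : fr`_l = s`_k by rewrite /fr nth_cat szs ltnSn kE.
have fx : fr`_l.+1 = normal i1 by rewrite /fr nth_cat szs ltnn subnn.
have fy : fr`_l.+2 = normal i2 by rewrite /fr nth_cat szs ltnNge leqnSn /= subSnn.
have l0 : (l < size fr)%N by rewrite sz ltnS ltnW.
have l1 : (l.+1 < size fr)%N by rewrite sz.
have l2 : (l.+2 < size fr)%N by rewrite sz.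
have r0 := lin_take_regular dw l0; rewrite tk fz in r0.
have r1 := lin_take_regular dw l1; rewrite lin_takeS // tk fz fx in r1.
have r2 := lin_take_regular dw l2.
rewrite lin_takeS // lin_takeS // tk fz fx fy in r2.
have span (q : 'I_l.+3) : exists c1 c2 c3 : K, lin s' ('X_q -
    c1 *: linear_form (normal i1) - c2 *: linear_form (normal i2) - c3 *: z).
  have [c ->] := dual_basis_span q dw sz.
  exists (c l.+1), (c l.+2), (c l).
  rewrite !big_ord_recr /= fx fy fz.
  set u := \sum_(i < l) _; set u1 := _ *: z; set u2 := _ *: _; set u3 := _ *: _.
  have -> : u + u1 + u2 + u3 - u2 - u3 - u1 = u by ring.
  apply: ideal_sum (lin_ideal _) _ => i _; apply: (idealZ (lin_ideal _)).
  apply: lin_mem; rewrite -tk -(nth_take 0 (ltn_ord i)); apply: mem_nth.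
  by rewrite size_takel // ltnW.
have genI : generated_above I3 d.+1.
  apply: (ideal_gen_generated_above (erefl _)) => p.
  rewrite mem_cat inE -orbA => /or3P[/eqP ->|/mapP[j _ ->]|/mapP[a _ ->]].
  - by exists n; [apply: full_degree_ge | apply: defining_homog].
  - exists n.-1; first by have := full_degree_ge fd; lia.
    by apply: mderiv_homog; rewrite prednK ?defining_homog // ltnW.
  - by exists 1%N => //; apply: linear_form_homog.
have full3 f : f \is d.-homog -> adjoin I3 z f.
  by move=> fh; rewrite -I2E; apply: fd.
have [_] := bayer_stillman I3_ideal I3_graded (lin_ideal s') (lin_graded (s := s'))
  (fun f => addgenr hJ (G := lfs s') (f := f)) (linear_form_homog _)
  (linear_form_homog _) (linear_form_homog _) r0 r1 r2 span genI full3 inj le.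
exact.
Qed.

End GenericTuple.

(** * Additivity of the sectional matrix and regularity *)

Definition additive_at d := M 3 d.+1 = (M 2 d.+1 + M 3 d)%N.

Lemma generic_exists D : exists L, generic D L.
Proof. by case: (generic_linegen D). Qed.

Lemma generic_values D L d : generic D L -> (d < D)%N ->
  M 2 d = hf (addgen J (lfs (rows L))) d /\
  M 3 d = hf (addgen J (lfs (take k (rows L)))) d.
Proof.
by move=> [_ [h2 h3]] lt; rewrite -h2 // -h3 // formsE forms_topE.
Qed.

Lemma sectional_step d : (M 3 d.+1 <= M 2 d.+1 + M 3 d)%N.
Proof.
have [L gL] := generic_exists d.+2.
have [-> ->] := generic_values gL (ltnSn _).
have [_ ->] := generic_values gL (ltnW (ltnSn d.+1)).
by rewrite hf_I3 leq_add2l hf_colon_le.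
Qed.

Lemma additive_at_injective D L d : generic D L -> (d.+1 < D)%N ->
  additive_at d <->
  (forall f, f \is d.-homog -> addgen J (lfs (take k (rows L))) (f * linear_form (rows L)`_k) ->
     addgen J (lfs (take k (rows L))) f).
Proof.
move=> gL lt; rewrite -hf_colon_eq /additive_at.
have [-> ->] := generic_values gL lt; have [_ ->] := generic_values gL (ltnW lt).
rewrite hf_I3; split=> [/eqP|->] //.
by rewrite eqn_add2l => /eqP ->.
Qed.

Lemma sectional_degree0 : M 3 0 = M 2 0 /\ M 2 0 <> 0%N.
Proof.
have [L gL] := generic_exists 1; have [tL _] := gL.
have [-> ->] := generic_values gL (ltn0Sn 0); rewrite hf_zero_degree; split=> //.
move/(hf_eq0 _ (I2_ideal L)) => h; apply: (I2_proper (L := L)).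
by apply: h; apply: dhomog1.
Qed.

Lemma sectional2_zero d L : transversal L -> full (addgen J (lfs (rows L))) d -> M 2 d = 0%N.
Proof.
move=> tL fd; have [_ /(_ L)] := sectional_matrix_min charK 2 d hJ gJ.
by rewrite formsE (proj2 (hf_eq0 d (I2_ideal L)) fd) leqn0 => /eqP.
Qed.

Lemma sectional2_bounded : exists N, forall d, (N <= d)%N -> M 2 d = 0%N.
Proof.
have [[L tL] _] := transversal_linegen; have [N hN] := finite_colength tL.
exists N => d le; apply: (sectional2_zero tL).
exact: full_leq (I2_ideal L) le hN.
Qed.

(** The maximum is genuine and not the default value: row 2 is nonzero in degree 0 and finite
    colength bounds its support. *)
Lemma reduction_numberP : M 2 d0 <> 0%N /\ forall d, (d0 < d)%N -> M 2 d = 0%N.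
Proof.
have e2 : (l.+3 - (l.+3 - 2) = 2)%N by rewrite subKn.
have [N hN] := sectional2_bounded.
have s0 : exists d, M 2 d != 0%N by exists 0%N; apply/eqP; case: sectional_degree0.
have sle d : M 2 d != 0%N -> (d <= N)%N.
  by apply: contraNleq => /ltnW /hN ->.
have max_spec d : (M 2 d <> 0%N /\ forall e, M 2 e <> 0%N -> (e <= d)%N) ->
    M 2 d <> 0%N /\ forall e, (d < e)%N -> M 2 e = 0%N.
  move=> [nz hd]; split=> // e lt; apply: contrapT => /hd.
  by rewrite leqNgt lt.
apply: max_spec; rewrite /reduction_number e2; case: xgetP => [d _ //|none].
case: (ex_maxnP s0 sle) => d /eqP nz dmax.
by case: (none d); split=> // e /eqP /dmax.
Qed.

(** Two hyperplanes would force [d0 = 0], so there are at least three and [J] starts above degree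
    1. *)
Lemma additive_at0 : (0 < d0)%N -> additive_at 0.
Proof.
move=> d0gt; have [L gL] := generic_exists 2; have [tL _] := gL.
apply/(additive_at_injective gL) => //; apply: (injective_degree0 tL).
rewrite ltn_neqAle big andbT; apply/eqP => n2.
have [nz _] := reduction_numberP; apply: nz.
apply: (sectional2_zero tL); apply: (full_leq (I2_ideal L) d0gt).
exact: two_planes_full.
Qed.

Lemma free_additive d : free_arrangement A -> additive_at d.
Proof.
move=> fr; have [L gL] := generic_exists d.+2; have [tL _] := gL.
apply/(additive_at_injective gL) => // f _.
have lt : (k < m)%N by rewrite mE kE.
have sE := rows_rcons L.
apply: (free_regular (i1 := i1) (i2 := i2) charK fr); rewrite -?sE.
- exact: transversal_pairwise.
- exact: first_normal_nmem.
- exact: second_normal_nmem.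
- exact: rows_regular.
Qed.

(** Propagation starts in degree [d0+1], where row 2 vanishes. Injectivity in that degree compares
    degrees [d0+1] and [d0+2], hence the genericity bound [d0.+3]. *)
Lemma additive_regular L : (forall d, (d < d0.+2)%N -> additive_at d) ->
  generic d0.+3 L ->
  regular (addgen J (lfs (take k (rows L)))) (linear_form (rows L)`_k).
Proof.
move=> add gL; have [tL _] := gL.
have h := regular_homog (I3_ideal L) (@I3_graded L) (linear_form_homog (rows L)`_k).
apply: h => d f fh.
have inj e : (e < d0.+2)%N -> forall f, f \is e.-homog ->
    addgen J (lfs (take k (rows L))) (f * linear_form (rows L)`_k) ->
    addgen J (lfs (take k (rows L))) f.
  by move=> lt; apply/(additive_at_injective gL) => //; apply: add.
have [lt|ge] := ltnP d d0.+2; first exact: (inj d).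
apply: (injective_above tL (d := d0.+1)) fh => //; [|exact: inj|exact: ltnW].
apply/(hf_eq0 d0.+1 (I2_ideal L)).
have [<- _] := generic_values gL (leqnSn d0.+2).
by have [_ ->] := reduction_numberP.
Qed.

Lemma rows_update L t (a : 'rV[K]_l.+3) c : (t < m)%N ->
  rows (L + c *: (\matrix_(i < m, j < l.+3) (a 0 j *+ (i == t :> nat)))) =
  set_nth 0 (rows L) t ((rows L)`_t + c *: a).
Proof.
move=> lt; apply: (@eq_from_nth _ 0) => [|i].
  by rewrite size_set_nth !size_rows; apply/esym/maxn_idPr.
rewrite size_rows => lti; rewrite nth_set_nth /= (nth_rows _ (Ordinal lti)).
have [it|it] := eqVneq i t.
  subst i; rewrite (nth_rows L (Ordinal lti)); apply/rowP => j.
  by rewrite !mxE /= eqxx.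
rewrite (nth_rows L (Ordinal lti)); apply/rowP => j; rewrite !mxE /=.
by rewrite (negPf it) mulr0n mulr0 addr0.
Qed.

Lemma regular_descent D : (forall L, generic D L ->
    regular (addgen J (lfs (take k (rows L)))) (linear_form (rows L)`_k)) ->
  forall r t, (t + r = k)%N -> forall L, generic D L ->
    regular (addgen J (lfs (take t (rows L)))) (linear_form (rows L)`_t).
Proof.
move=> top; elim=> [|r IH] t tr L gL.
  by rewrite addn0 in tr; rewrite tr; apply: top.
have tr' : (t.+1 + r = k)%N by rewrite addSnnS.
have lt1 : (t.+1 < m)%N by rewrite mE -kE -tr'; lia.
have lt : (t < m)%N := ltnW lt1.
set a := (rows L)`_t.+1.
pose E := \matrix_(i < m, j < l.+3) (a 0 j *+ (i == t :> nat)).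
have rowsE c : rows (L + c *: E) = set_nth 0 (rows L) t ((rows L)`_t + c *: a).
  exact: rows_update.
have hI := addgen_ideal (lfs (take t (rows L))) hJ.
have gI : graded (addgen J (lfs (take t (rows L)))).
  by apply: addgen_graded => //; apply: lfs_homogeneous.
apply: (regular_of_pencil (z := linear_form a) (T := fun c => generic D (L + c *: E)) charK).
- exact: hI.
- exact: gI.
- exact: linear_form_homog.
- exact: linear_form_homog.
- by rewrite scale0r addr0.
- move=> q q0; have [_ /(_ L E gL)[q' q'0 hq']] := generic_linegen D.
  have [c] := poly_nonroot charK (mulf_neq0 q0 q'0).
  by rewrite hornerM mulf_eq0 negb_or => /andP[qc /hq' gc]; exists c.
move=> c gc; have := IH t.+1 tr' _ gc; rewrite rowsE.
have szs : size (set_nth 0 (rows L) t ((rows L)`_t + c *: a)) = m.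
  by rewrite size_set_nth size_rows; apply/maxn_idPr.
rewrite nth_set_nth /= gtn_eqF // -/a (take_nth 0) ?szs // nth_set_nth /= eqxx.
have -> : take t (set_nth 0 (rows L) t ((rows L)`_t + c *: a)) = take t (rows L).
  apply: (@eq_from_nth _ 0) => [|i]; first by rewrite !size_takel ?szs ?size_rows // ltnW.
  rewrite size_takel ?szs; last exact: ltnW.
  by move=> lti; rewrite !nth_take // nth_set_nth /= ltn_eqF.
by rewrite /lfs map_rcons addgen_rcons // linearD linearZ.
Qed.

Lemma additive_free : (forall d, (d < d0.+2)%N -> additive_at d) -> free_arrangement A.
Proof.
move=> add; have reg := regular_descent (fun L => additive_regular add (L := L)).
have [L gL] := generic_exists d0.+3; have [tL _] := gL.
have [w dw] := frame_dual tL i12.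
apply: (regular_free charK (ltnW big) (frame_size L i1 i2) dw) => t lt.
have ltm : (t < m)%N by rewrite mE.
rewrite frame_take ?frame_nth //; last exact: ltnW.
apply: (reg (k - t)%N) gL; rewrite subnKC // kE; exact: lt.
Qed.

End Main.

Local Close Scope ring_scope.

Theorem theorem7p1 (K : fieldType) (hK : [pchar K]%R =i pred0)
    (l : nat) (hl : 3 <= l) (A : arrangement K l) :
  let M := sectional_matrix (jacobian_ideal A) in
  let d0 := reduction_number (jacobian_ideal A) (l - 2) in
  let M_zero := forall i d : nat, 1 <= i <= l -> M i d = 0 in
  let cond1 := M 3 d0 = M 3 (d0 + 1) /\ M 3 (d0 + 1) = M 3 (d0 + 2) in
  let cond2 := M 3 d0 = \sum_(0 <= d < d0.+1) M 2 d in
  let cond2' := forall d : nat, 2 <= d <= d0 -> M 3 d = M 2 d + M 3 (d - 1) in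
  (free_arrangement A <-> M_zero \/ (cond1 /\ cond2)) /\
  (~ M_zero -> (cond2 <-> cond2')).
Proof.
case: l hl A => [|[|[|l]]] // _ A M d0 M_zero cond1 cond2 cond2'.
(* This separates exactly the zero matrix: with at most one hyperplane [J = S], otherwise row 2 is
   nonzero in degree 0. *)
have [small|big] := leqP (arr_size A) 1.
  have Mz : M_zero.
    move=> i d _; have hJ := jacobian_is_ideal A.
    have [[L hL] _] := sectional_matrix_min hK i d hJ (@jacobian_graded _ _ A).
    rewrite /M -hL.
    have hI := addgen_ideal (forms L) hJ.
    apply/(hf_eq0 d hI); apply: full_const => //.
    by apply: addgenl; apply: small_jacobian.
  split=> //; split=> _; [by left | exact: small_free].
have nMz : ~ M_zero.
  by move=> Mz; have [_] := sectional_degree0 hK big; apply; apply: Mz.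
have [M30 _] := sectional_degree0 hK big.
have tele := telescope_sum d0 M30 (sectional_step hK big).
have [_ M2above] := reduction_numberP hK big.
(* Row 2 vanishes in degrees [d0+1] and [d0+2], where additivity becomes equality of consecutive
   values of row 3. *)
have cond1P : cond1 <-> additive_at A d0 /\ additive_at A d0.+1.
  have z1 := M2above _ (ltnSn d0); have z2 := M2above _ (ltnW (ltnSn d0.+1)).
  by rewrite /cond1 /additive_at addn1 addn2 /M z1 z2 !add0n; split=> -[-> ->].
split.
  split=> [fr|[//|[/cond1P[e1 e2] /tele e]]].
    right; split; [apply/cond1P; split | apply/tele => d _]; exact: (free_additive hK big).
  apply: (additive_free hK big) => d; rewrite ltnS leq_eqVlt => /predU1P[->|] //.
  by rewrite ltnS leq_eqVlt => /predU1P[->|/e].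
move=> _; split=> [/tele e d|e].
  case: d => [|d] //; rewrite subn1 => /andP[_ led]; exact: e.
(* The equality in degree 1 is not part of [cond2'] and is supplied here. *)
apply/tele => -[|d] lt; first exact: (additive_at0 hK big).
by have := e d.+2; rewrite subn1; apply; rewrite ltnS.
Qed.
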